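(* For every graph $G$, the topological cycles in the space DTOP of $G$ induce a matroid; that is, the set of edge sets of topological cycles (homeomorphic images of the unit circle $S^1$) in DTOP is the set of circuits of a matroid with ground set $E(G)$.
   Context: Graphs may be infinite. A ray is a one-way infinite path; two rays of $G$ are equivalent if for every finite vertex set $S$ they have tails in the same component of $G-S$; the equivalence classes are the (vertex-)ends of $G$, forming the set $\Omega(G)$. For a finite vertex set $S$ and an end $\omega$, $C(S,\omega)$ is the component of $G-S$ containing tails of the rays of $\omega$ ($\omega$ lives in $C(S,\omega)$). A vertex $v$ dominates an end $\omega$ if there are infinitely many paths from $v$ to some ray of $\omega$ that pairwise meet only in $v$; an end is dominated if some vertex dominates it, undominated otherwise. The space $|G|$ (VTOP) has as points the vertices of $G$, the ends of $G$, and for each edge $e$ a set $e\times(0,1)$ of interior points (edges being copies of $[0,1]$ whose endpoints are identified with the endvertices). A basis of its topology consists of the sets that are open in the 1-complex (simplicial) topology of $G$, together with the sets $C_{\vec\epsilon}(S,\omega)$, where $S$ is a finite vertex set, $\omega$ an end, and $\vec\epsilon$ a function from the set of edges with exactly one endvertex in $C(S,\omega)$ to $(0,1)$: $C_{\vec\epsilon}(S,\omega)$ consists of all vertices of $C(S,\omega)$, all ends living in $C(S,\omega)$, all interior points of edges with both endvertices in $C(S,\omega)$, and, for each edge $f$ with exactly one endvertex $t(f)$ in $C(S,\omega)$, the points of $f\times(0,1)$ at distance less than $\vec\epsilon(f)$ from $t(f)$. DTOP is the subspace of $|G|$ obtained by deleting all dominated ends. The edge set of a topological cycle is the set of edges having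 an interior point on it. Matroids are (possibly infinite) matroids in the sense of Bruhn, Diestel, Kriesell, Pendavingh and Wollan. *)

(* Defs.v *)
From HB Require Import structures.
From mathcomp Require Import all_boot all_order all_algebra.
From mathcomp Require Import all_classical all_reals all_analysis.

Set Implicit Arguments.
Unset Strict Implicit.
Unset Printing Implicit Defensive.

Import Order.TTheory GRing.Theory Num.Theory.
Import numFieldNormedType.Exports.

Local Open Scope classical_set_scope.
Local Open Scope ring_scope.

(* Infinite matroids, by the independence axioms (I1), (I2), (I3), (IM) of    *)
(* Bruhn, Diestel, Kriesell, Pendavingh and Wollan.                           *)

Section MaximalMinimal.
Context {E : Type}.
Implicit Types (F : set (set E)) (A B : set E).

Definition maximal_in F A := F A /\ forall B, F B -> A `<=` B -> B = A.
Definition minimal_in F A := F A /\ forall B, F B -> B `<=` A -> B = A.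

End MaximalMinimal.

Record matroid (E : Type) := Matroid {
  indep : set (set E);
  indep0 : indep set0;
  indepS : forall I J, indep J -> I `<=` J -> indep I;
  indep_aug : forall I J,
    indep I -> ~ maximal_in indep I -> maximal_in indep J ->
    exists x, [/\ J x, ~ I x & indep (x |` I)];
  indep_max : forall I X, indep I -> I `<=` X ->
    exists B, maximal_in [set J | [/\ indep J, I `<=` J & J `<=` X]] B }.

Definition circuits (E : Type) (M : matroid E) : set (set E) :=
  [set C | minimal_in (~` indep M) C].

(* Vertex and edge sets are arbitrary types; loops and parallel edges are     *)
(* allowed. The order of the two endvertices of an edge carries no meaning:   *)
(* it only fixes which endvertex corresponds to 0 and which one to 1 when the *)
(* edge is regarded as a copy of [0, 1].                                      *)
Record graph := Graph {
  vertex : Type;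
  edge : Type;
  src : edge -> vertex;
  tgt : edge -> vertex }.

HB.instance Definition _ (G : graph) := gen_eqMixin (vertex G).
HB.instance Definition _ (G : graph) := gen_choiceMixin (vertex G).

Section Ends.
Context {G : graph}.
Implicit Types (S C : set (vertex G)) (u v x y : vertex G).

Definition adjacent x y :=
  exists e : edge G, (src e = x /\ tgt e = y) \/ (src e = y /\ tgt e = x).

Definition is_walk x (p : seq (vertex G)) :=
  path (fun u v => `[< adjacent u v >]) x p.

Definition is_path x (p : seq (vertex G)) := is_walk x p && uniq (x :: p).

Definition connected_avoiding S x y :=
  exists p, [/\ is_walk x p, last x p = y & forall z, z \in x :: p -> ~ S z].

Definition is_component S C :=
  exists2 x, ~ S x & C = [set y | connected_avoiding S x y].

(* Parallel edges are irrelevant for ends, so that rays (and the paths        *)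
(* witnessing domination) are given by their sequences of vertices.           *)
Record ray := Ray {
  ray_vertex :> nat -> vertex G;
  ray_inj : injective ray_vertex;
  ray_adj : forall n, adjacent (ray_vertex n) (ray_vertex n.+1) }.

Definition tail_in C (r : ray) := exists n, forall m, (n <= m)%N -> C (r m).

Definition ray_equiv (r r' : ray) :=
  forall S, finite_set S ->
    exists C, [/\ is_component S C, tail_in C r & tail_in C r'].

Record gend := GEnd {
  end_rays : set ray;
  end_class : exists r, end_rays = [set r' | ray_equiv r r'] }.

(* C(S, w), as a vertex set *)
Definition end_comp S (w : gend) : set (vertex G) :=
  [set x | exists C, [/\ is_component S C, forall r, end_rays w r -> tail_in C r & C x]].

Definition dominates v (w : gend) :=
  exists2 r, end_rays w r &
  exists2 P : set (seq (vertex G)), infinite_set P &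
    (forall p, P p -> is_path v p /\ range r (last v p)) /\
    (forall p q, P p -> P q -> p <> q ->
       forall x, x \in v :: p -> x \in v :: q -> x = v).

Definition dominated (w : gend) := exists v, dominates v w.

Lemma adjacentC x y : adjacent x y -> adjacent y x.
Proof. by move=> [e [[]|[]]] *; exists e; [right|left]. Qed.

Lemma connected_refl S x : ~ S x -> connected_avoiding S x x.
Proof. by move=> Sx; exists [::]; split=> // z; rewrite inE => /eqP ->. Qed.

Lemma connected_trans S y x z : connected_avoiding S x y ->
  connected_avoiding S y z -> connected_avoiding S x z.
Proof.
move=> [p [wp <- Sp]] [q [wq <- Sq]]; exists (p ++ q); split.
- by rewrite /is_walk cat_path; apply/andP.
- by rewrite last_cat.
- move=> u; rewrite -cat_cons mem_cat => /orP[/Sp//|uq].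
  by apply: Sq; rewrite inE uq orbT.
Qed.

Lemma connected_sym S x y :
  connected_avoiding S x y -> connected_avoiding S y x.
Proof.
move=> [p [wp <- Sp]]; exists (rev (belast x p)); split.
- rewrite /is_walk rev_path; apply: sub_path wp => u v /asboolP uv.
  by apply/asboolP; exact: adjacentC.
- by case: p {wp Sp} => //= a p; rewrite rev_cons last_rcons.
- move=> z; rewrite -rev_rcons mem_rev -lastI; exact: Sp.
Qed.

Lemma connected_sub S T x y : S `<=` T ->
  connected_avoiding T x y -> connected_avoiding S x y.
Proof. by move=> ST [p [? ? Tp]]; exists p; split=> // z /Tp + /ST. Qed.

Lemma component_eq S C D x :
  is_component S C -> is_component S D -> C x -> D x -> C = D.
Proof.
move=> [c _ ->] [d _ ->] /= cx dx; apply/seteqP; split=> y /= h.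
  exact: connected_trans (connected_trans dx (connected_sym cx)) h.
exact: connected_trans (connected_trans cx (connected_sym dx)) h.
Qed.

Lemma ray_tail_component S (r : ray) : finite_set S ->
  exists2 C, is_component S C & tail_in C r.
Proof.
move=> Sfin.
have [n nP] : exists n, forall m, (n <= m)%N -> ~ S (r m).
  have /finite_seqP[X XE] : finite_set (r @^-1` S).
    by apply: finite_preimage => // ? ? _ _; exact: ray_inj.
  exists (\max_(i <- X) i).+1 => m + Srm.
  have mX : m \in X by have : [set` X] m by rewrite -XE.
  by rewrite ltnNge leq_bigmax_seq.
exists [set y | connected_avoiding S (r n) y]; first by exists (r n); [exact: nP|].
exists n => m /subnK <-; elim: (m - n)%N => [|k IH] /=.
  by apply: connected_refl; exact: nP.
apply: connected_trans IH _; exists [:: r (k.+1 + n)%N]; split=> //=.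
  by rewrite /is_walk /= andbT; apply/asboolP; exact: ray_adj.
by move=> z; rewrite !inE => /orP[] /eqP ->; apply: nP; exact: leq_addl.
Qed.

Lemma tail_in_meet C D (r : ray) : tail_in C r -> tail_in D r ->
  exists2 x, C x & D x.
Proof.
move=> [n Cn] [m Dm]; exists (r (maxn n m)).
  by apply: Cn; exact: leq_maxl.
by apply: Dm; exact: leq_maxr.
Qed.

Lemma ray_equiv_refl (r : ray) : ray_equiv r r.
Proof. by move=> S /(ray_tail_component r)[C cC rC]; exists C. Qed.

Lemma end_compP S (w : gend) : finite_set S ->
  is_component S (end_comp S w) /\ forall r, end_rays w r -> tail_in (end_comp S w) r.
Proof.
move=> Sfin; have [r wE] := end_class w.
have wr : end_rays w r by rewrite wE; exact: ray_equiv_refl.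
have [C cC rC] := ray_tail_component r Sfin.
have CP r' : end_rays w r' -> tail_in C r'.
  rewrite wE => /(_ _ Sfin)[D [cD rD r'D]].
  have [x Cx Dx] := tail_in_meet rC rD.
  by rewrite (component_eq cC cD Cx Dx).
suff -> : end_comp S w = C by [].
apply/seteqP; split=> [x [D [cD wD Dx]]|x Cx]; last by exists C.
have [y Cy Dy] := tail_in_meet rC (wD _ wr).
by rewrite (component_eq cC cD Cy Dy).
Qed.

Lemma end_comp_sub S T (w : gend) : S `<=` T ->
  end_comp T w `<=` end_comp S w.
Proof.
move=> ST x [_ [[d Td ->] wD dx]]; exists [set y | connected_avoiding S d y].
split; first by exists d => // /ST.
- move=> r /wD[n nP]; exists n => m /nP; exact: connected_sub.
- exact: connected_sub dx.
Qed.

Lemma end_comp_eq S T (w w' : gend) : finite_set T -> S `<=` T ->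
  end_comp T w = end_comp T w' -> end_comp S w = end_comp S w'.
Proof.
move=> Tfin ST ww'; have Sfin := sub_finite_set ST Tfin.
have [[x Tx xE] _] := end_compP w Tfin.
have xT : end_comp T w x by rewrite xE; exact: connected_refl.
have [cw _] := end_compP w Sfin; have [cw' _] := end_compP w' Sfin.
apply: (component_eq cw cw' (x := x)); apply: end_comp_sub ST _ _ => //.
by rewrite -ww'.
Qed.

End Ends.
Arguments ray : clear implicits.
Arguments gend : clear implicits.

Section VTOP.
Context {R : realType} {G : graph}.

Definition oint := {t : R | 0 < t < 1}.

(* The point set of |G|. *)
Inductive vtop :=
  | VPoint of vertex G
  | EPoint of edge G & oint
  | OPoint of gend G.

HB.instance Definition _ := gen_eqMixin vtop.
HB.instance Definition _ := gen_choiceMixin vtop.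

(* The canonical map from the copy of [0, 1] belonging to e. *)
Definition edge_map (e : edge G) (t : R) : vtop :=
  if insub t is Some s then EPoint e s
  else VPoint (if t <= 0 then src e else tgt e).

(* The 1-complex of G is the quotient of the disjoint union of the vertex set *)
(* and of the copies of [0, 1] given by the edges.                            *)
Definition complex_open (U : set vtop) :=
  (forall w, ~ U (OPoint w)) /\
  forall e, open (edge_map e @^-1` U : set (subspace `[0, 1]%classic)).

(* Only the values of eps at edges with exactly one endvertex in C(S, w)      *)
(* matter.                                                                    *)
Definition end_nbhd (S : set (vertex G)) (w : gend G) (eps : edge G -> oint) :
    set vtop :=
  let C := end_comp S w in
  [set z | match z with
  | VPoint v => C v
  | EPoint e t =>
      [\/ C (src e) /\ C (tgt e),
          [/\ C (src e), ~ C (tgt e) & val t < val (eps e)]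
        | [/\ ~ C (src e), C (tgt e) & 1 - val t < val (eps e)]]
  | OPoint w' => end_comp S w' = C
  end].

Definition vtop_basis : set (set vtop) :=
  [set U | complex_open U \/
    exists S w eps, finite_set S /\ U = end_nbhd S w eps].

Definition complex_points : set vtop :=
  [set z | if z is OPoint _ then False else True].

Lemma edge_map0 e : edge_map e 0 = VPoint (src e).
Proof. by rewrite /edge_map insubF ?lexx // ltxx. Qed.

Lemma edge_map1 e : edge_map e 1 = VPoint (tgt e).
Proof. by rewrite /edge_map insubF ?ler10 // ltxx andbF. Qed.

Lemma edge_mapP e (t : R) : `[0, 1]%classic t ->
  [\/ t = 0, t = 1 | exists2 s : oint, val s = t & edge_map e t = EPoint e s].
Proof.
rewrite /= in_itv /= !le_eqVlt => /andP[/orP[/eqP <-|t0]]; first by constructor 1.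
move=> /orP[/eqP ->|t1]; first by constructor 2.
constructor 3; rewrite /edge_map; case: insubP => [s _ sE|]; first by exists s.
by rewrite t0 t1.
Qed.

Lemma complex_open_points : complex_open complex_points.
Proof.
split=> [w []|e]; rewrite (_ : _ @^-1` _ = setT); first exact: openT.
by apply/seteqP; split=> // t _ /=; rewrite /edge_map; case: insub.
Qed.

Lemma complex_openI U V : complex_open U -> complex_open V ->
  complex_open (U `&` V).
Proof.
move=> [Uw Ue] [Vw Ve]; split=> [w [/Uw]//|e].
by rewrite preimage_setI; apply: openI.
Qed.

Lemma complex_open_end_nbhd S w eps :
  complex_open (end_nbhd S w eps `&` complex_points).
Proof.
split=> [w' [_]//|e]; apply/open_subspaceP.
have H (s : oint) : 0 < val s < 1 by exact: (valP s).
have /andP[e0 e1] := H (eps e).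
set C := end_comp S w.
have [Cs|Cs] := pselect (C (src e)); have [Ct|Ct] := pselect (C (tgt e)).
- exists setT; first exact: openT.
  apply/seteqP; split=> t [h It]; split=> //.
  have [->|->|[s _]] := edge_mapP e It; rewrite /= ?edge_map0 ?edge_map1 //.
  by move=> -> ; split=> //; constructor 1.
- exists [set t | t < val (eps e)]; first exact: open_lt.
  apply/seteqP; split=> t [h It]; split=> //; move: h;
  have [->|->|[s <-]] := edge_mapP e It; rewrite /= ?edge_map0 ?edge_map1 //.
  + by move=> /(lt_trans e1); rewrite ltxx.
  + by move=> -> h; split=> //; constructor 2.
  + by case=> /Ct.
  + by move=> -> [[[]|[]|[]]].
- exists [set t | 1 - val (eps e) < t]; first exact: open_gt.
  apply/seteqP; split=> t [h It]; split=> //; move: h;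
  have [->|->|[s <-]] := edge_mapP e It; rewrite /= ?edge_map0 ?edge_map1 //.
  + by rewrite subr_lt0 => /(lt_trans e1); rewrite ltxx.
  + by rewrite ltrBlDr -ltrBlDl => -> h; split=> //; constructor 3.
  + by case=> /Cs.
  + by rewrite ltrBlDr ltrDl.
  + by move=> -> [[[]|[]|[_ _]]] //; rewrite ltrBlDr -ltrBlDl.
- exists set0; first exact: open0.
  apply/seteqP; split=> t [h It]; split=> //; move: h.
  have [->|->|[s <-]] := edge_mapP e It; rewrite /= ?edge_map0 ?edge_map1 //.
  + by case.
  + by case.
  + by move=> -> [[[]|[]|[]]].
Qed.

Lemma vtop_basis_complex U : vtop_basis U ->
  complex_open (U `&` complex_points).
Proof.
move=> [oU|[S [w [eps [_ ->]]]]]; last exact: complex_open_end_nbhd.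
by apply: complex_openI => //; exact: complex_open_points.
Qed.

Lemma end_nbhd_sub S T w w' (eps eps' : edge G -> oint) :
  finite_set T -> S `<=` T -> end_comp S w' = end_comp S w ->
  (forall e, val (eps' e) <= val (eps e)) ->
  end_nbhd T w' eps' `<=` end_nbhd S w eps.
Proof.
move=> Tfin ST ww' ee'; have sub : end_comp T w' `<=` end_comp S w.
  by rewrite -ww'; exact: end_comp_sub.
case=> [v /sub //|e t|w'' /(end_comp_eq Tfin ST)] /=; last by rewrite ww'.
case=> [[/sub ? /sub ?]|[/sub Cs _ te]|[_ /sub Ct te]]; first by constructor 1.
- have [Ct|Ct] := pselect (end_comp S w (tgt e)); first by constructor 1.
  by constructor 2; split=> //; exact: lt_le_trans te (ee' e).
- have [Cs|Cs] := pselect (end_comp S w (src e)); first by constructor 1.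
  by constructor 3; split=> //; exact: lt_le_trans te (ee' e).
Qed.

Let vtop_basis_cover : \bigcup_(U in vtop_basis) U = setT.
Proof.
apply/seteqP; split=> // z _.
have h2 : 0 < (2^-1 : R) < 1 by rewrite invr_gt0 ltr0n invf_lt1 ?ltr0n ?ltr1n.
case: z => [v|e t|w].
- by exists complex_points => //; left; exact: complex_open_points.
- by exists complex_points => //; left; exact: complex_open_points.
- exists (end_nbhd set0 w (fun=> exist (fun t : R => is_true (0 < t < 1)) _ h2)) => //; right.
  by do 3 eexists; split; last reflexivity.
Qed.

Let vtop_basis_join (U V : set vtop) (z : vtop) :
  vtop_basis U -> vtop_basis V -> U z -> V z ->
  exists W, [/\ vtop_basis W, W z & W `<=` U `&` V].
Proof.
move=> bU bV Uz Vz.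
have [zC|zC] := pselect (complex_points z).
  exists ((U `&` complex_points) `&` (V `&` complex_points)); split=> //.
  - by left; apply: complex_openI; exact: vtop_basis_complex.
  - by move=> y [[? _] [? _]].
case: z Uz Vz zC => [v _ _ []//|e t _ _ []//|w Uw Vw _].
case: bU bV => [[/(_ _ Uw)//]|[S [wS [eS [Sfin UE]]]]].
case=> [[/(_ _ Vw)//]|[T [wT [eT [Tfin VE]]]]]; subst U V.
pose e3 e := if val (eS e) <= val (eT e) then eS e else eT e.
have STfin : finite_set (S `|` T) by rewrite finite_setU.
exists (end_nbhd (S `|` T) w e3); split=> //.
  by right; exists (S `|` T), w, e3.
move=> y Wy; split; apply: end_nbhd_sub Wy => //.
- by move=> e; rewrite /e3; case: ifP => // /negbT; rewrite -ltNge => /ltW.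
- by move=> e; rewrite /e3; case: ifP.
Qed.

HB.instance Definition _ := isBaseTopological.Build vtop
  vtop_basis_cover vtop_basis_join.

Definition dtop : set vtop :=
  [set z | if z is OPoint w then ~ dominated w else True].

Definition edges_of (X : set dtop) : set (edge G) :=
  [set e | exists2 x, X x & exists t, val x = EPoint e t].

End VTOP.
Arguments vtop R G : clear implicits.
Arguments dtop R G : clear implicits.

Definition unit_circle (R : realType) : set (R * R) :=
  [set p | p.1 ^+ 2 + p.2 ^+ 2 = 1].
Arguments unit_circle : clear implicits.

Definition homeomorphic (T U : topologicalType) :=
  exists (f : T -> U) (g : U -> T),
    [/\ cancel f g, cancel g f, continuous f & continuous g].

(* Subsets carry the subspace topology, via the coercion set_type. *)
Definition topological_cycle (R : realType) (T : topologicalType) (X : set T) :=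
  homeomorphic (unit_circle R) X.

(* Main.v *)
From HB Require Import structures.
From mathcomp Require Import all_boot all_order all_algebra finmap.
From mathcomp Require Import all_classical all_reals all_analysis lra ring.
Require Import Defs.

(** The undominated ends are captured by a decreasing sequence of vertex sets
    [Y n] (a layering): the components of the [Y n] have finite neighbourhoods
    and form a tree whose branches are exactly the undominated ends.  A vertex
    set is decided if it is constant on some node of every branch; decided sets
    are the traces of the clopen subsets of the space of vertices and
    undominated ends.  An edge is spanned by [P] if no decided set separates its
    endvertices without separating the endvertices of an edge of [P].  Symmetric
    differences of decided sets give the exchange property, and maximal
    independent sets between [I] and [X] are built layer by layer: below a node
    only the finitely many traces on its finite neighbourhood matter, so that
    one can pass to a spanning subset independently in each node.

    A set [C] is a circuit of this matroid iff it is cut-cyclic: it is nonempty,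
    no decided set separates exactly one edge of [C], and any two edges of [C]
    are exactly the edges of [C] separated by some decided set.  Extending the
    indicators of decided sets linearly along the edges gives continuous
    functions on DTOP.  By the intermediate value theorem these show that the
    edge set of a topological cycle is cut-cyclic.  Conversely, given a
    cut-cyclic set [C] and an edge [e] of [C], the sets separating just [e] and
    [g], for the other edges [g] of [C], induce a linear order on the points of
    [C] off [e]; a weighted sum of their functions maps these points bijectively
    onto [0, 1], and [e] closes this arc up to a circle. *)

Set Implicit Arguments.
Unset Strict Implicit.
Unset Printing Implicit Defensive.

Import Order.TTheory GRing.Theory Num.Theory.
Import numFieldNormedType.Exports.

Local Open Scope classical_set_scope.

(** * Finite sets and monotone families *)

Lemma exists_argmin (T : Type) (P : set T) (f : T -> nat) :
  P !=set0 -> exists2 x, P x & forall y, P y -> (f x <= f y)%N.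
Proof.
move=> [x0 Px0]; pose Q n := `[< exists2 x, P x & f x = n >].
have exQ : exists n, Q n by exists (f x0); apply/asboolP; exists x0.
have [n /asboolP[x Px <-] minn] := ex_minnP exQ.
by exists x => // y Py; apply: minn; apply/asboolP; exists y.
Qed.

Lemma finite_set_uniform (T : Type) (S : set T) (Q : nat -> T -> Prop) :
  finite_set S -> (forall n m x, (n <= m)%N -> Q n x -> Q m x) ->
  (forall x, S x -> exists n, Q n x) -> exists n, forall x, S x -> Q n x.
Proof.
move=> finS monoQ exQ.
have /choice[k kP] : forall x, exists n, S x -> Q n x.
  by move=> x; have [/exQ[n ?]|nS] := pselect (S x); [exists n|exists 0%N].
have /finite_seqP[X XE] : finite_set (k @` S) by exact: finite_image.
exists (\max_(i <- X) i)%N => x Sx; apply: monoQ (kP _ Sx).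
by apply: leq_bigmax_seq => //; have : [set` X] (k x) by rewrite -XE; exists x.
Qed.

Lemma chain_eventually_all (T : eqType) (V : Type) (Q : set V -> T -> Prop)
    (F : set (set V)) (X1 : set V) (s : seq T) : total_on F subset -> F X1 ->
  (forall v, v \in s -> exists X, [/\ F X, X1 `<=` X &
     forall Z, F Z -> X `<=` Z -> Q Z v]) ->
  exists X, [/\ F X, X1 `<=` X &
    forall Z, F Z -> X `<=` Z -> {in s, forall v, Q Z v}].
Proof.
move=> tot FX1; elim: s => [_|v s IH h]; first by exists X1; split.
have [|X [FX X1X Xs]] := IH; first by move=> w ws; apply: h; rewrite inE ws orbT.
have [|X' [FX' X1X' X'v]] := h v; first by rewrite inE eqxx.
have [sub|sub] := tot _ _ FX FX'.
  exists X'; split=> // Z FZ X'Z w; rewrite inE => /orP[/eqP ->|ws].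
    exact: X'v.
  by apply: Xs => //; exact: subset_trans X'Z.
exists X; split=> // Z FZ XZ w; rewrite inE => /orP[/eqP ->|ws].
  by apply: X'v => //; exact: subset_trans XZ.
exact: Xs.
Qed.

Lemma nondecreasing_subset (T : Type) (P : nat -> set T) :
  (forall n, P n `<=` P n.+1) -> forall n m, (n <= m)%N -> P n `<=` P m.
Proof. by apply: homo_leq => [X|X Z W]; [exact: subset_refl|exact: subset_trans]. Qed.

Lemma nonincreasing_subset (T : Type) (P : nat -> set T) :
  (forall n, P n.+1 `<=` P n) -> forall n m, (n <= m)%N -> P m `<=` P n.
Proof.
apply: (@homo_leq _ P (fun X Z => Z `<=` X)) => [X|X Z W ZX XW]; first exact: subset_refl.
exact: subset_trans XW ZX.
Qed.

Lemma infinite_pigeonhole (T U : Type) (R : nat -> set T) (C : U -> set T)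
    (E : set T) (S : set U) n0 :
  (forall n, R n.+1 `<=` R n) -> (forall n, infinite_set (R n)) ->
  finite_set E -> finite_set S -> R n0 `<=` E `|` \bigcup_(x in S) C x ->
  exists2 x, S x & forall n, infinite_set (R n `&` C x).
Proof.
move=> RS infR finE finS cover; apply: contrapT => /forall2NP nS.
have le_sub := nonincreasing_subset RS.
have [n finR] : exists n, forall x, S x -> finite_set (R n `&` C x).
  apply: finite_set_uniform => //.
    by move=> n m x nm; apply: sub_finite_set; apply: setSI; exact: le_sub.
  by move=> x Sx; have [//|/existsNP[n /contrapT]] := nS x; exists n.
apply: (infR (maxn n n0)).
apply: (@sub_finite_set _ _ (E `|` \bigcup_(x in S) (R n `&` C x))).
  move=> f Rf; have [|[x Sx xf]] := cover _ (le_sub _ _ (leq_maxr n n0) _ Rf).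
    by left.
  by right; exists x => //; split=> //; exact: le_sub (leq_maxl n n0) _ Rf.
by rewrite finite_setU; split=> //; exact: bigcup_finite.
Qed.

(** A junk value if [A] is infinite. *)
Definition finite_card (T : choiceType) (A : set T) : nat := #|` fset_set A|%fset.

Section FiniteCard.
Context {T : choiceType}.
Implicit Types A B X Y : set T.

Lemma finite_card_le A B :
  finite_set B -> A `<=` B -> (finite_card A <= finite_card B)%N.
Proof.
move=> finB AB; have finA := sub_finite_set AB finB.
by apply: fsubset_leq_card; have := AB; rewrite (fset_set_sub finA finB).
Qed.

Lemma finite_card_lt A B x :
  finite_set B -> A `<=` B -> B x -> ~ A x -> (finite_card A < finite_card B)%N.
Proof.
move=> finB AB Bx nAx; have finA := sub_finite_set AB finB.
apply: fproper_ltn_card; rewrite fproperE.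
have := AB; rewrite (fset_set_sub finA finB) => -> /=.
by apply/fsubsetPn; exists x; rewrite in_fset_set // ?inE //; apply/negP; rewrite inE.
Qed.

Lemma finite_card_submodular A B X Y : finite_set A -> finite_set B ->
  X `|` Y `<=` A `|` B -> X `&` Y `<=` A `&` B ->
  (finite_card X + finite_card Y <= finite_card A + finite_card B)%N.
Proof.
move=> finA finB subU subI; have finU : finite_set (A `|` B) by rewrite finite_setU.
have := sub_finite_set subU finU; rewrite finite_setU => -[finX finY].
rewrite /finite_card -[X in (X <= _)%N]cardfsUI -[X in (_ <= X)%N]cardfsUI.
rewrite -!fset_setU // -!fset_setI //; apply: leq_add; apply: finite_card_le => //.
exact: finite_setIl.
Qed.

Lemma finite_card_eq A B : finite_set B -> A `<=` B ->
  (finite_card B <= finite_card A)%N -> A = B.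
Proof.
move=> finB AB cardBA; apply/seteqP; split=> // x Bx; apply: contrapT => nAx.
by move: cardBA; rewrite leqNgt (finite_card_lt finB AB Bx nAx).
Qed.

Lemma finite_powerset A : finite_set A -> finite_set [set X | X `<=` A].
Proof.
move=> finA.
apply: (@sub_finite_set _ _ [set [set` F] | F in [set` fpowerset (fset_set A)]]).
  move=> X /= XA; have finX := sub_finite_set XA finA.
  exists (fset_set X); last by rewrite fset_setK.
  by rewrite /= fpowersetE; move: XA; rewrite (fset_set_sub finX finA).
by apply: finite_image; exact: finite_fset.
Qed.

Lemma finite_card_bound A m :
  (forall X : {fset T}, [set` X] `<=` A -> (#|` X| <= m)%N) ->
  finite_set A /\ (finite_card A <= m)%N.
Proof.
move=> bound; have finA : finite_set A.
  apply: contrapT => /(@infinite_set_fset _ _ m.+1)[X XA].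
  by rewrite leqNgt ltnS bound.
by split=> //; apply: bound; rewrite fset_setK.
Qed.

End FiniteCard.

(** * Components and neighbourhoods of vertex sets *)

Section Components.
Context {G : graph}.
Implicit Types (O A B D Y Z : set (vertex G)) (W : set (vertex G) -> set (vertex G))
  (x y v : vertex G) (r : ray G).

(** Empty if [x] is not in [O]. *)
Definition component O x : set (vertex G) := [set y | connected_avoiding (~` O) x y].

Definition neighbors B : set (vertex G) :=
  [set v | ~ B v /\ exists2 b, B b & adjacent b v].

Definition closed_neighbors B : set (vertex G) := B `|` neighbors B.

Definition walk_connected D := forall x, D x -> D `<=` component D x.

Lemma component_subset O x : component O x `<=` O.
Proof. by move=> _ [p [_ <- h]]; apply: contrapT; apply: h; exact: mem_last. Qed.

Lemma component_self O x : O x -> component O x x.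
Proof. by move=> Ox; apply: connected_refl => /(_ Ox). Qed.

Lemma component_root O x y : component O x y -> O x.
Proof. by move=> [p [_ _ h]]; apply: contrapT; apply: h; rewrite inE eqxx. Qed.

Lemma component_same O x y : component O x y -> component O y = component O x.
Proof.
move=> xy; apply/seteqP; split=> z yz; first exact: connected_trans xy yz.
exact: connected_trans (connected_sym xy) yz.
Qed.

Lemma component_adjacent O x a b :
  component O x a -> O b -> adjacent a b -> component O x b.
Proof.
move=> xa Ob ab; have Oa := component_subset xa; apply: connected_trans xa _.
exists [:: b]; split=> //=; first by rewrite /is_walk /= andbT; apply/asboolP.
by move=> z; rewrite !inE => /orP[] /eqP -> h; exact: h.
Qed.

Lemma component_ind O x Z : Z x ->
  (forall a b, component O x a -> Z a -> O b -> adjacent a b -> Z b) ->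
  component O x `<=` Z.
Proof.
move=> Zx stepZ _ [p [walk_p <- Op]].
have Ox : O x by apply: contrapT; apply: Op; rewrite inE eqxx.
suff walk_Z q a : component O x a -> Z a -> is_walk a q ->
    (forall z, z \in a :: q -> ~ (~` O) z) -> Z (last a q).
  by apply: walk_Z => //; exact: component_self.
elim: q a => //= b q IH a xa Za /andP[/asboolP ab walk_q] Oq.
have Ob : O b by apply: contrapT; apply: Oq; rewrite !inE eqxx orbT.
apply: IH => //; first exact: component_adjacent xa Ob ab.
- exact: (stepZ a).
- by move=> z zq; apply: Oq; rewrite inE zq orbT.
Qed.

Lemma component_mono O O' x : O `<=` O' -> component O x `<=` component O' x.
Proof. by move=> OO' y; apply: connected_sub; exact: subsetC. Qed.

Lemma component_absorb O x Z a : component O x a -> Z a ->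
  (forall b c, component O x b -> component O x c -> Z b -> adjacent b c -> Z c) ->
  component O x `<=` Z.
Proof.
move=> xa Za stepZ; rewrite -(component_same xa); apply: component_ind => // b c.
rewrite (component_same xa) => xb Zb Oc bc.
by apply: (stepZ b) => //; exact: component_adjacent xb Oc bc.
Qed.

Lemma component_subcomponent O O' x a : component O x `<=` O' -> component O x a ->
  component O x `<=` component O' a.
Proof.
move=> sub xa; apply: (component_absorb xa).
  by apply: component_self; exact: sub.
by move=> b c xb xc ab bc; apply: component_adjacent ab _ bc; exact: sub.
Qed.

Lemma component_connected O x : walk_connected (component O x).
Proof.
move=> y xy; rewrite -(component_same xy); apply: component_subcomponent => //.
by apply: component_self; exact: component_subset xy.
Qed.

Lemma neighbors_component O x v : neighbors (component O x) v -> ~ O v.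
Proof. by move=> [nv [b xb bv]] Ov; apply: nv; exact: component_adjacent xb Ov bv. Qed.

Lemma closed_neighbors_adjacent B v w : B v -> adjacent v w -> closed_neighbors B w.
Proof.
move=> Bv vw; have [Bw|nBw] := pselect (B w); first by left.
by right; split=> //; exists v.
Qed.

Lemma neighbors_empty x O : ~ O x -> neighbors (component O x) = set0.
Proof.
by move=> nOx; apply/seteqP; split=> // v [_ [b /component_root]].
Qed.

Lemma component_setU_disjoint O D x : walk_connected D ->
  neighbors D `&` O = set0 -> D x -> component (O `|` D) x = D.
Proof.
move=> conD sepD Dx; apply/seteqP; split.
  apply: component_ind => // a b _ Da Ob ab.
  have [//|Nb] := closed_neighbors_adjacent Da ab.
  by case: Ob => // Ob; have : (neighbors D `&` O) b by []; rewrite sepD.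
by move=> y /(conD _ Dx); apply: component_mono; right.
Qed.

Lemma component_setU_outside O D x : neighbors D `&` O = set0 -> O x -> ~ D x ->
  component (O `|` D) x = component O x.
Proof.
move=> sepD Ox nDx.
have sep v : neighbors D v -> O v -> False.
  by move=> Nv Ov; have : (neighbors D `&` O) v by []; rewrite sepD.
have disjointD a : component O x a -> ~ D a.
  move=> xa Da; apply: nDx.
  apply: (component_absorb xa Da) (component_self Ox) => b c _ xc Db bc.
  have [//|Nc] := closed_neighbors_adjacent Db bc.
  by case: (sep _ Nc (component_subset xc)).
apply/seteqP; split; last by apply: component_mono; left.
apply: component_ind; first exact: component_self.
move=> a b _ xa [Ob|Db] ab; first exact: component_adjacent xa Ob ab.
have [Da|Na] := closed_neighbors_adjacent Db (adjacentC ab).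
  by case: (disjointD a).
by case: (sep _ Na (component_subset xa)).
Qed.

Lemma component_bigcup_chain (F : set (set (vertex G))) X x :
  total_on F subset -> F X -> X x ->
  component (\bigcup_(Y in F) Y) x =
    \bigcup_(Y in [set Y | F Y /\ X `<=` Y]) component Y x.
Proof.
move=> tot FX Xx; apply/seteqP; split; last first.
  by move=> y [Y [FY _]]; apply: component_mono => z Yz; exists Y.
apply: component_ind; first by exists X; [split|exact: component_self].
move=> a b _ [Y [FY XY] ya] [Y' FY' Y'b] ab.
have [YY'|Y'Y] := tot _ _ FY FY'; last first.
  by exists Y => //; apply: component_adjacent ya _ ab; exact: Y'Y.
exists Y'; first by split=> //; exact: subset_trans YY'.
exact: component_adjacent (component_mono YY' ya) Y'b ab.
Qed.

Lemma neighbors_component_bigcup_chain (F : set (set (vertex G))) X1 x v :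
  total_on F subset -> F X1 -> X1 x -> neighbors (component (\bigcup_(X in F) X) x) v ->
  exists X, [/\ F X, X1 `<=` X &
    forall Z, F Z -> X `<=` Z -> neighbors (component Z x) v].
Proof.
move=> tot FX1 X1x; rewrite (component_bigcup_chain tot FX1 X1x).
move=> [nv [b [X [FX X1X] xb] bv]]; exists X; split=> // Z FZ XZ.
split; last by exists b => //; exact: component_mono XZ _ xb.
by move=> zv; apply: nv; exists Z => //; split=> //; exact: subset_trans XZ.
Qed.

(** Each component [D] of [Y] is cut down to [D `\` W D]. *)
Definition refine Y W : set (vertex G) :=
  [set x | Y x /\ ~ W (component Y x) x].

Lemma component_refine Y W x :
  (forall y, Y y -> neighbors (component Y y) `<=` W (component Y y)) ->
  refine Y W x ->
  component (refine Y W) x = component (~` W (component Y x)) x /\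
  component (refine Y W) x `<=` component Y x.
Proof.
move=> NW [Yx nWx].
have sub : component (~` W (component Y x)) x `<=` component Y x.
  apply: component_ind; first exact: component_self.
  move=> a b _ xa nWb ab.
  by have [|/(NW _ Yx)] := closed_neighbors_adjacent xa ab.
suff E : component (refine Y W) x = component (~` W (component Y x)) x.
  by rewrite E.
apply/seteqP; split.
  apply: component_ind; first exact: component_self.
  move=> a b _ xa [Yb nWb] ab; have xb := component_adjacent (sub _ xa) Yb ab.
  by apply: component_adjacent xa _ ab; rewrite /setC /= -(component_same xb).
apply: component_subcomponent; last exact: component_self.
move=> a xa; have ya := sub _ xa; split; first exact: component_subset ya.
by rewrite (component_same ya); exact: component_subset xa.
Qed.

Lemma ray_avoids_finite (S : set (vertex G)) r : finite_set S -> tail_in (~` S) r.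
Proof.
move=> /(ray_tail_component r)[C [x _ ->] [n h]]; exists n => m /h.
by move=> [p [_ <- hp]]; apply: hp; exact: mem_last.
Qed.

Lemma tail_in_sub A B r : A `<=` B -> tail_in A r -> tail_in B r.
Proof. by move=> AB [n An]; exists n => m /An /AB. Qed.

Lemma tail_inI A B r : tail_in A r -> tail_in B r -> tail_in (A `&` B) r.
Proof.
move=> [n An] [m Bm]; exists (maxn n m) => k; rewrite geq_max => /andP[nk mk].
by split; [exact: An|exact: Bm].
Qed.

Lemma tail_in_component A r : tail_in A r ->
  exists n, A (r n) /\ tail_in (component A (r n)) r.
Proof.
move=> [n An]; exists n; split; [exact: An|exists n].
move=> m /subnK <-; elim: (m - n)%N => [|k IH].
  by apply: component_self; exact: An.
rewrite addSn; apply: component_adjacent IH _ (ray_adj r _).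
by apply: An; rewrite leqW // leq_addl.
Qed.

Lemma tail_in_or_off B r : finite_set (neighbors B) ->
  tail_in B r \/ tail_in (~` closed_neighbors B) r.
Proof.
move=> /(ray_avoids_finite r)[n offN].
have [[m [nm Bm]]|nB] := pselect (exists m, (n <= m)%N /\ B (r m)); last first.
  right; exists n => m nm [Bm|]; [by apply: nB; exists m|exact: offN].
left; exists m => k /subnK <-; elim: (k - m)%N => [|j IH]; first by rewrite add0n.
rewrite addSn; have [//|] := closed_neighbors_adjacent IH (ray_adj r _).
by move=> /offN[]; rewrite leqW // (leq_trans nm) // leq_addl.
Qed.

Lemma tail_in_diff A B r : finite_set (neighbors B) ->
  tail_in A r -> ~ tail_in B r -> tail_in (A `\` closed_neighbors B) r.
Proof.
by move=> finN Ar nBr; have [//|/(tail_inI Ar)] := tail_in_or_off r finN.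
Qed.

Lemma neighborsU A B : neighbors (A `|` B) `<=` neighbors A `|` neighbors B.
Proof.
move=> v [/not_orP[nA nB] [b [Ab|Bb] bv]]; first by left; split=> //; exists b.
by right; split=> //; exists b.
Qed.

Lemma neighborsI A B : neighbors (A `&` B) `<=` neighbors A `|` neighbors B.
Proof.
move=> v [nAB [b [Ab Bb] bv]].
have [Av|nA] := pselect (A v); last by left; split=> //; exists b.
by right; split; [move=> Bv; apply: nAB|exists b].
Qed.

Lemma neighborsD A B : neighbors (A `\` closed_neighbors B) `<=`
  (neighbors A `|` neighbors B) `\` B.
Proof.
move=> v [nv [b [Ab /not_orP[nB nNB]] bv]].
have nBv : ~ B v.
  by move=> Bv; apply: nNB; split=> //; exists v => //; exact: adjacentC.
split=> //; have [Av|nA] := pselect (A v); last by left; split=> //; exists b.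
by right; apply: contrapT => nNBv; apply: nv; split=> // -[].
Qed.

Definition order B := finite_card (neighbors B).

Lemma order_submodular A B : finite_set (neighbors A) -> finite_set (neighbors B) ->
  (order (A `|` B) + order (A `&` B) <= order A + order B)%N.
Proof.
move=> finA finB; apply: finite_card_submodular => //.
  by move=> v [/neighborsU|/neighborsI].
move=> v [[/not_orP[nA nB] _] [_ [b [Ab Bb] bv]]].
by split; split=> //; exists b.
Qed.

Lemma order_posimodular A B : finite_set (neighbors A) -> finite_set (neighbors B) ->
  (order (A `\` closed_neighbors B) + order (B `\` closed_neighbors A) <=
   order A + order B)%N.
Proof.
move=> finA finB; apply: finite_card_submodular => //.
  by move=> v [/neighborsD[]//|/neighborsD[+ _]]; rewrite setUC.
move=> v [vA vB]; have [_ nB] := neighborsD vA; have [_ nA] := neighborsD vB.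
move: vA vB => [_ [b [Ab _] bv]] [_ [c [Bc _] cv]].
by split; split=> //; [exists b|exists c].
Qed.

End Components.

(** * Regions and separating sets *)

Section Regions.
Context {G : graph}.
Implicit Types (O A B D S W : set (vertex G)) (x y v : vertex G) (r s : ray G).

Definition region_avoiding U B :=
  finite_set (neighbors B) /\ U `<=` ~` closed_neighbors B.

Lemma region_avoiding_sub U S A B : region_avoiding U A -> region_avoiding U B ->
  S `<=` A `|` B -> neighbors S `<=` neighbors A `|` neighbors B ->
  region_avoiding U S.
Proof.
move=> [finA avoidA] [finB avoidB] SAB NS; split.
  by apply: sub_finite_set NS _; rewrite finite_setU.
move=> u Uu [/SAB[Au|Bu]|/NS[Au|Bu]].
- by apply: (avoidA _ Uu); left.
- by apply: (avoidB _ Uu); left.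
- by apply: (avoidA _ Uu); right.
- by apply: (avoidB _ Uu); right.
Qed.

Section Separator.
Variable U : set (vertex G).

Local Notation region := (region_avoiding U).

Lemma region_setU A B : region A -> region B -> region (A `|` B).
Proof. by move=> rA rB; apply: region_avoiding_sub rA rB _ (@neighborsU _ A B). Qed.

Lemma region_setI A B : region A -> region B -> region (A `&` B).
Proof.
by move=> rA rB; apply: region_avoiding_sub rA rB _ (@neighborsI _ A B) => v [Av _]; left.
Qed.

Lemma region_setD A B : region A -> region B -> region (A `\` closed_neighbors B).
Proof.
move=> rA rB; apply: region_avoiding_sub rA rB _ _ => [v [Av _]|]; first by left.
by apply: subset_trans (@neighborsD _ A B) _; exact: subDsetl.
Qed.

Lemma region_component_empty O x : ~ O x -> region (component O x).
Proof.
move=> nOx; split; first by rewrite neighbors_empty.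
by move=> u _ []; [move=> /component_root|rewrite neighbors_empty].
Qed.

Definition tight A r := [/\ region A, tail_in A r &
  forall B, region B -> tail_in B r -> (order A <= order B)%N].

Lemma exists_tight B r : region B -> tail_in B r -> exists A, tight A r.
Proof.
move=> rB Br.
have [|A [rA Ar] minA] := @exists_argmin _ [set B | region B /\ tail_in B r] order.
  by exists B.
by exists A; split=> // B' rB' B'r; exact: minA.
Qed.

Lemma tight_order_le A B r : tight A r -> region B -> tail_in B r ->
  (order B <= order A)%N -> tight B r.
Proof.
move=> [_ _ minA] rB Br BA; split=> // B' rB' B'r.
exact: leq_trans BA (minA _ rB' B'r).
Qed.

Lemma tight_setU A B r s : tight A r -> tight B s -> tail_in A s -> tight (A `|` B) r.
Proof.
move=> tA [rB Bs minB] As; have [rA Ar _] := tA; have [[finA _] [finB _]] := (rA, rB).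
have := minB _ (region_setI rA rB) (tail_inI As Bs) => lowI.
apply: tight_order_le tA (region_setU rA rB) _ _.
  by apply: tail_in_sub Ar; left.
rewrite -(leq_add2r (order (A `&` B))).
by apply: leq_trans (order_submodular finA finB) _; rewrite leq_add2l.
Qed.

Lemma tight_setD A B r s : tight A r -> tight B s -> ~ tail_in A s -> ~ tail_in B r ->
  tight (A `\` closed_neighbors B) r.
Proof.
move=> tA [rB Bs minB] nAs nBr; have [rA Ar _] := tA.
have [[finA _] [finB _]] := (rA, rB).
have := minB _ (region_setD rB rA) (tail_in_diff finA Bs nAs) => lowD.
apply: tight_order_le tA (region_setD rA rB) (tail_in_diff finB Ar nBr) _.
rewrite -(leq_add2r (order (B `\` closed_neighbors A))).
by apply: leq_trans (order_posimodular finA finB) _; rewrite leq_add2l.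
Qed.

Variable Rs : set (ray G).
Hypothesis Rs_region : forall r, Rs r -> exists2 B, region B & tail_in B r.

Definition tight_family k O := forall x, O x ->
  (order (component O x) <= k)%N /\ exists2 r, Rs r & tight (component O x) r.

Definition maximal_tight_family k O :=
  tight_family k O /\ forall O', O `<` O' -> ~ tight_family k O'.

Lemma tight_family_leq k l O : (k <= l)%N -> tight_family k O -> tight_family l O.
Proof. by move=> kl famO x /famO[/leq_trans h ?]; split=> //; exact: h. Qed.

Lemma tight_family_region k O x : tight_family k O -> region (component O x).
Proof.
move=> famO; have [/famO[_ [r _ []]]//|] := pselect (O x).
exact: region_component_empty.
Qed.

Lemma tight_family_setU k O D r : tight_family k O -> walk_connected D ->
  neighbors D `&` O = set0 -> Rs r -> tight D r -> (order D <= k)%N ->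
  tight_family k (O `|` D).
Proof.
move=> famO conD sepD Rr tD Dk x OD; have [Dx|nDx] := pselect (D x).
  by rewrite component_setU_disjoint //; split=> //; exists r.
by rewrite component_setU_outside //; [case: OD => // /famO|case: OD].
Qed.

(** A tight region of an uncovered ray is uncrossed from the components of [O]
    by submodularity. *)
Lemma tight_uncrossed k O r A0 : tight_family k O ->
  (forall x, ~ tail_in (component O x) r) -> tight A0 r ->
  exists2 A, tight A r & neighbors A `&` O = set0.
Proof.
move=> famO uncovered tA0.
have [|A tA minA] := @exists_argmin _ [set A | tight A r]
  (fun A => finite_card (neighbors A `&` O)); first by exists A0.
exists A => //; have [[finA _] Ar _] := tA.
have no_improvement A' v : tight A' r -> neighbors A v -> O v -> ~ neighbors A' v ->
    neighbors A' `&` O `<=` neighbors A `&` O -> False.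
  move=> tA' Nv Ov nN' sub; have := minA _ tA'; rewrite leqNgt => /negP; apply.
  by apply: (@finite_card_lt _ _ _ v) => //; [exact: finite_setIl|case].
apply/seteqP; split=> // v [Nv Ov]; have [_ [s _ tB]] := famO _ Ov.
set B := component O v in tB; have Bv : B v by exact: component_self.
have NBO w : neighbors B w -> ~ O w by exact: neighbors_component.
have [As|nAs] := pselect (tail_in A s).
  apply: (no_improvement (A `|` B) v) => //; first exact: tight_setU tA tB As.
  - by move=> [nU _]; apply: nU; right.
  - by move=> w [/neighborsU[//|/NBO nO] Ow].
apply: (no_improvement (A `\` closed_neighbors B) v) => //.
- exact: tight_setD tA tB nAs (uncovered v).
- by move=> /neighborsD[_ /(_ Bv)].
- by move=> w [/neighborsD[[//|/NBO nO] _] Ow].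
Qed.

Lemma maximal_tight_family_covers k O A0 r : maximal_tight_family k O -> Rs r ->
  tight A0 r -> (order A0 <= k)%N -> exists x, tail_in (component O x) r.
Proof.
move=> [famO maxO] Rr tA0 A0k; apply: contrapT => /forallNP uncovered.
have [A tA sepA] := tight_uncrossed famO uncovered tA0.
have [rA Ar minA] := tA; have [finA _] := rA.
have [n [An Dr]] := tail_in_component Ar; set D := component A (r n) in Dr.
have ND : neighbors D `<=` neighbors A.
  move=> v Nv; have nAv := neighbors_component Nv; have [_ [b Db bv]] := Nv.
  by split=> //; exists b => //; exact: component_subset Db.
have conD : walk_connected D by exact: component_connected.
have sepD : neighbors D `&` O = set0.
  by apply/seteqP; split=> // v [/ND Nv Ov]; rewrite -sepA; split.
have tD : tight D r.
  apply: tight_order_le tA _ Dr _; last exact: (finite_card_le finA ND).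
  apply: (region_avoiding_sub rA rA) => v; last by move=> /ND; left.
  by move=> /component_subset; left.
have Dk : (order D <= k)%N.
  have [rA0 A0r _] := tA0; have [_ _ minD] := tD.
  exact: leq_trans (minD _ rA0 A0r) A0k.
apply: (maxO (O `|` D)); last exact: (tight_family_setU famO conD sepD Rr tD Dk).
split=> [|sub]; first by left.
apply: (uncovered (r n)); apply: tail_in_sub Dr.
apply: component_subcomponent; last exact: component_self.
by move=> z Dz; apply: sub; right.
Qed.

(** A member whose component at [x] has the largest order controls the
    component of the union. *)
Lemma tight_family_bigcup k (F : set (set (vertex G))) :
  F `<=` tight_family k -> total_on F subset -> tight_family k (\bigcup_(X in F) X).
Proof.
move=> famF tot x [X0 FX0 X0x]; set O := \bigcup_(X in F) X.
have [|X1 [FX1 X1x] maxX] := @exists_argmin _ [set X | F X /\ X x]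
  (fun X => (k - order (component X x))%N); first by exists X0.
have [lek [r Rr [r1 tail1 min1]]] := famF _ FX1 _ X1x.
have OE := component_bigcup_chain tot FX1 X1x.
have maxorder X : F X -> X1 `<=` X -> (order (component X x) <= order (component X1 x))%N.
  move=> FX X1X; have [leX _] := famF _ FX _ (X1X _ X1x).
  by rewrite -(leq_sub2lE (m := k)) //; apply: maxX; split=> //; exact: X1X.
have regionF X : F X -> region (component X x).
  by move=> /famF; exact: tight_family_region.
have evN v : neighbors (component O x) v -> exists X, [/\ F X, X1 `<=` X &
    forall Z, F Z -> X `<=` Z -> neighbors (component Z x) v].
  exact: neighbors_component_bigcup_chain.
have [finO orderO] : finite_set (neighbors (component O x)) /\
    (order (component O x) <= order (component X1 x))%N.
  apply: finite_card_bound => S SN.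
  have [X [FX X1X XS]] := @chain_eventually_all _ _
    (fun Z v => neighbors (component Z x) v) _ _ (enum_fset S) tot FX1
    (fun v vS => evN v (SN v vS)).
  apply: leq_trans (maxorder X FX X1X); rewrite -(set_fsetK S).
  apply: finite_card_le; first by have [] := regionF X FX.
  by move=> v vS; exact: XS FX (@subset_refl _ X) _ vS.
split; first exact: leq_trans orderO lek.
exists r => //; split; last by move=> B rB Br; exact: leq_trans orderO (min1 _ rB Br).
  split=> // u Uu [|/evN[X [FX X1X NX]]].
    rewrite OE => -[X [FX X1X] xu].
    by have [_ /(_ u Uu)[]] := regionF X FX; left.
  by have [_ /(_ u Uu)[]] := regionF X FX; right; exact: NX FX (@subset_refl _ X).
by rewrite OE; apply: tail_in_sub tail1 => y xy; exists X1 => //; split.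
Qed.

Lemma exists_maximal_tight_family k P : tight_family k P ->
  exists2 O, P `<=` O & maximal_tight_family k O.
Proof.
move=> famP; have [A [famA maxA]] : exists A, tight_family k (P `|` A) /\
    forall B, A `<` B -> ~ tight_family k (P `|` B).
  apply: (@Zorn_bigcup _ (fun A => tight_family k (P `|` A))) => F FP tot.
  have [->|/set0P[X0 FX0]] := eqVneq F set0; first by rewrite bigcup_set0 setU0.
  have -> : P `|` \bigcup_(X in F) X = \bigcup_(Z in [set P `|` X | X in F]) Z.
    apply/seteqP; split=> [x [Px|[X FX Xx]]|x [_ [X FX <-] [Px|Xx]]].
    - by exists (P `|` X0); [exists X0|left].
    - by exists (P `|` X); [exists X|right].
    - by left.
    - by right; exists X.
  apply: tight_family_bigcup => [_ [X FX <-]|]; first exact: FP.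
  move=> _ _ [X FX <-] [Z FZ <-].
  by have [XZ|ZX] := tot _ _ FX FZ; [left|right]; exact: setUS.
exists (P `|` A) => //; split=> // O' [PAO' O'PA] famO'; apply: (maxA O').
  by split=> [x Ax|O'A]; [apply: PAO'; right|apply: O'PA => x /O'A; right].
by rewrite (_ : P `|` O' = O') //; apply/setUidPr => x Px; apply: PAO'; left.
Qed.

Lemma exists_maximal_tight_chain : exists P : nat -> set (vertex G),
  forall k, P k `<=` P k.+1 /\ maximal_tight_family k (P k).
Proof.
have /choice[next nextP] : forall kP : nat * set (vertex G), exists O,
    tight_family kP.1 kP.2 -> kP.2 `<=` O /\ maximal_tight_family kP.1 O.
  move=> [k P]; have [famP|nP] := pselect (tight_family k P); last by exists P.
  by have [Q ? ?] := exists_maximal_tight_family famP; exists Q.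
pose P := fix P k := if k is l.+1 then next (k, P l) else next (0%N, set0).
have maxP k : maximal_tight_family k (P k).
  elim: k => [|k [famP _]].
    by have [|_] := nextP (0%N, set0).
  by have [|_] // := nextP (k.+1, P k); first exact: tight_family_leq famP.
exists P => k; split=> //; have [|] // := nextP (k.+1, P k).
exact: tight_family_leq (leqnSn k) (maxP k).1.
Qed.

End Separator.

Section Exhaustion.
Variables (U : set (vertex G)) (P : nat -> set (vertex G)).
Hypothesis P_nondecreasing : forall k, P k `<=` P k.+1.
Hypothesis P_region : forall k x, region_avoiding U (component (P k) x).

Let O := \bigcup_k P k.

Let P_subset k : P k `<=` O. Proof. by move=> x Px; exists k. Qed.

Lemma component_bigcup_nondecreasing x y :
  component O x y -> exists k, component (P k) x y.
Proof.
move=> xy; have [k _ Pkx] := component_root xy.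
suff : component O x `<=` [set y | exists k, component (P k) x y] by apply.
apply: component_ind; first by exists k; exact: component_self.
move=> a b _ [i xa] [j _ Pjb] ab; exists (maxn i j).
have le_sub := nondecreasing_subset P_nondecreasing.
apply: component_adjacent ab; last exact: le_sub (leq_maxr i j) _ Pjb.
exact: component_mono (le_sub _ _ (leq_maxl i j)) _ xa.
Qed.

Lemma exhaustion_center_caught x y : component O x y -> exists k, component (P k) y x.
Proof. by move=> xy; apply: component_bigcup_nondecreasing; exact: connected_sym. Qed.

Section Centers.
Variable d : vertex G.

Let center v := xget d (component O v).

Let center_component v : O v -> component O v (center v).
Proof. by move=> Ov; apply: (xgetPex d); exists v; exact: component_self. Qed.

Let center_same v w : component O v w -> center w = center v.
Proof. by move=> vw; rewrite /center (component_same vw). Qed.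

(** In every component of the union of the [P k] we fix a vertex and separate
    along the neighbourhoods of the components of the [P k] containing it. *)
Definition exhaustion_separator : set (vertex G) :=
  ~` O `|` [set v | exists k, neighbors (component (P k) (center v)) v].

Local Notation W := exhaustion_separator.

Let separator_complement : ~` W `<=` O.
Proof. by move=> v nWv; apply: contrapT => nO; apply: nWv; left. Qed.

Let caught x : O x -> exists k, component (P k) (center x) x.
Proof. by move=> /center_component; exact: exhaustion_center_caught. Qed.

Lemma exhaustion_separator_finite k x :
  O x -> finite_set (W `&` component (P k) (center x)).
Proof.
move=> Ox.
apply: (@sub_finite_set _ _ (\bigcup_(i in `I_k) neighbors (component (P i) (center x)))).
  move=> v [Wv kv]; have Ov : O v by exact: P_subset (component_subset kv).
  have cv : center v = center x.
    apply: center_same; apply: connected_trans (center_component Ox) _.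
    exact: component_mono (@P_subset k) _ kv.
  case: Wv => //= -[i]; rewrite cv => Ni; exists i => //=.
  rewrite ltnNge; apply/negP => ki; case: Ni => + _; apply.
  exact: component_mono (nondecreasing_subset P_nondecreasing ki) _ kv.
by apply: bigcup_finite => // i _; have [] := P_region i (center x).
Qed.

Lemma exhaustion_separator_region x : region_avoiding U (component (~` W) x).
Proof.
have [Wx|nWx] := pselect (W x); first by apply: region_component_empty; rewrite /setC.
have Ox := separator_complement nWx; have [k kx] := caught Ox.
set B := component (P k) (center x) in kx; have [finB avoidB] := P_region k (center x).
have DB : component (~` W) x `<=` B.
  apply: component_ind => // a b xa Ba nWb ab.
  have [//|Nb] := closed_neighbors_adjacent Ba ab.
  have xb := component_adjacent (component_mono separator_complement xa)
    (separator_complement nWb) ab.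
  by exfalso; apply: nWb; right; exists k; rewrite (center_same xb).
have ND : neighbors (component (~` W) x) `<=` neighbors B `|` (W `&` B).
  move=> v Nv; have /contrapT Wv := neighbors_component Nv; have [_ [b xb bv]] := Nv.
  by have [|] := closed_neighbors_adjacent (DB _ xb) bv; [right|left].
split.
  apply: sub_finite_set ND _; rewrite finite_setU; split=> //.
  exact: exhaustion_separator_finite.
by move=> u Uu uD; apply: (avoidB _ Uu); case: uD => [/DB|/ND[|[_]]]; [left|right|left].
Qed.

Lemma exhaustion_separator_tail k x r :
  tail_in (component (P k) x) r -> tail_in (~` W) r.
Proof.
move=> tail_x; have le_sub := nondecreasing_subset P_nondecreasing.
have [n /(_ n (leqnn n)) xn] := tail_x.
have Ox := P_subset (component_root xn); have [j jx] := caught Ox.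
have {}tail_x : tail_in (component (P (maxn k j)) (center x)) r.
  apply: tail_in_sub tail_x; have xm := component_mono (le_sub _ _ (leq_maxr k j)) jx.
  by rewrite -(component_same xm); exact/component_mono/le_sub/leq_maxl.
have finW := exhaustion_separator_finite (maxn k j) Ox.
have := tail_inI tail_x (ray_avoids_finite r finW).
by apply: tail_in_sub => v [xv nWv] Wv; exact: nWv.
Qed.

End Centers.

End Exhaustion.

Lemma exists_separating_set U (Rs : set (ray G)) :
  (forall r, Rs r -> exists2 B, region_avoiding U B & tail_in B r) ->
  exists W, [/\ U `<=` W, forall x, region_avoiding U (component (~` W) x) &
    forall r, Rs r -> tail_in (~` W) r].
Proof.
move=> Rs_region; have [P maxP] := exists_maximal_tight_chain U Rs.
have P_region k x : region_avoiding U (component (P k) x).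
  exact: tight_family_region (maxP k).2.1.
have [[d _]|no_vertex] := pselect (exists d : vertex G, True); last first.
  by exists setT; split=> // [x|r _]; case: no_vertex; [exists x|exists (r 0%N)].
pose P_nondecreasing k := (maxP k).1; exists (exhaustion_separator P d); split.
- move=> u Uu; left=> -[k _ Pu]; have [_ /(_ u Uu)[]] := P_region k u.
  by left; exact: component_self.
- exact: exhaustion_separator_region.
- move=> r Rr; have [B rB Br] := Rs_region r Rr; have [A tA] := exists_tight rB Br.
  have [x] := maximal_tight_family_covers (maxP (order A)).2 Rr tA (leqnn _).
  exact: exhaustion_separator_tail.
Qed.

End Regions.

(** * Layerings *)

Section Layering.
Context {G : graph}.
Implicit Types (D U W Y : set (vertex G)) (x v : vertex G) (r : ray G).

(** By [undominated_free], the rays of undominated ends are free. *)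
Definition free_ray r :=
  forall U, finite_set U -> exists2 B, region_avoiding U B & tail_in B r.

Record layering (Y : nat -> set (vertex G)) : Prop := Layering {
  layeringS : forall n, Y n.+1 `<=` Y n;
  layering_finite : forall n x, finite_set (neighbors (component (Y n) x));
  layering_neighbors : forall n x, Y n.+1 x ->
    neighbors (component (Y n.+1) x) `<=` component (Y n) x;
  layering_neighbors_nonempty : forall n x, Y n.+1 x ->
    neighbors (component (Y n.+1) x) !=set0;
  layering_free_ray : forall n r, free_ray r -> tail_in (Y n) r }.

Lemma node_separating_set D : finite_set (neighbors D) -> D !=set0 ->
  exists W, [/\ neighbors D `<=` W, D `&` W !=set0,
    forall x, region_avoiding (neighbors D) (component (~` W) x) &
    forall r, free_ray r -> tail_in (~` W) r].
Proof.
move=> finD [d Dd]; set U := neighbors D `|` [set d].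
have finU : finite_set U by rewrite finite_setU.
have [W [UW W_region W_tail]] :=
  @exists_separating_set _ U free_ray (fun r free_r => free_r _ finU).
exists W; split=> //; first by move=> v Nv; apply: UW; left.
  by exists d; split=> //; apply: UW; right.
by move=> x; have [finx avoidx] := W_region x; split=> // v Nv; apply: avoidx; left.
Qed.

Lemma exists_next_layer Y : (forall x, finite_set (neighbors (component Y x))) ->
  exists Y', [/\ Y' `<=` Y, forall x, finite_set (neighbors (component Y' x)),
    forall x, Y' x -> neighbors (component Y' x) `<=` component Y x,
    forall x, Y' x -> neighbors (component Y' x) !=set0 &
    forall r, free_ray r -> tail_in Y r -> tail_in Y' r].
Proof.
move=> finY; have /choice[W WP] : forall D, exists W, finite_set (neighbors D) -> D !=set0 ->
    [/\ neighbors D `<=` W, D `&` W !=set0,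
      forall x, region_avoiding (neighbors D) (component (~` W) x) &
      forall r, free_ray r -> tail_in (~` W) r].
  move=> D; have [[finD D0]|nD] := pselect (finite_set (neighbors D) /\ D !=set0).
    by have [W ?] := node_separating_set finD D0; exists W.
  by exists set0 => finD D0; case: nD.
have WY x (Yx : Y x) := WP _ (finY x) (ex_intro _ x (component_self Yx)).
have NW y : Y y -> neighbors (component Y y) `<=` W (component Y y) by move=> /WY[].
have refineE x (Y'x : refine Y W x) := component_refine NW Y'x.
exists (refine Y W); split.
- by move=> x [].
- move=> x; have [Y'x|nY'x] := pselect (refine Y W x); last by rewrite neighbors_empty.
  rewrite (refineE x Y'x).1; have [Yx _] := Y'x.
  by have [_ _ /(_ x)[]] := WY _ Yx.
- move=> x Y'x v Nv; have [Yx _] := Y'x; have [E sub] := refineE x Y'x.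
  have [_ _ /(_ x)[_ avoidx] _] := WY _ Yx; have [_ [b xb bv]] := Nv.
  have [//|/avoidx[]] := closed_neighbors_adjacent (sub _ xb) bv.
  by right; rewrite -E.
- move=> x Y'x; have [Yx _] := Y'x; have [E sub] := refineE x Y'x.
  have [_ [d [Dd Wd]] _ _] := WY _ Yx; apply: contrapT => N0.
  suff : component (refine Y W) x d by rewrite E => /component_subset.
  suff : component Y x `<=` component (refine Y W) x by apply.
  apply: component_ind; first exact: component_self.
  move=> a b _ xa _ ab; have [//|Nb] := closed_neighbors_adjacent xa ab.
  by case: N0; exists b.
- move=> r free_r /tail_in_component[n [Yn tail_n]].
  have [_ _ _ /(_ r free_r) tailW] := WY _ Yn.
  apply: tail_in_sub (tail_inI tail_n tailW) => x [nx nWx].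
  by split; [exact: component_subset nx|rewrite (component_same nx)].
Qed.

Lemma exists_layering : exists Y : nat -> set (vertex G), layering Y.
Proof.
pose locally_finite Y := forall x, finite_set (neighbors (component Y x)).
have /choice[next nextP] : forall Y, exists Y', locally_finite Y ->
    [/\ Y' `<=` Y, locally_finite Y',
      forall x, Y' x -> neighbors (component Y' x) `<=` component Y x,
      forall x, Y' x -> neighbors (component Y' x) !=set0 &
      forall r, free_ray r -> tail_in Y r -> tail_in Y' r].
  move=> Y; have [/exists_next_layer[Y' ?]|nY] := pselect (locally_finite Y).
    by exists Y'.
  by exists Y.
pose Y n := iter n next setT.
have finY n : locally_finite (Y n).
  elim: n => [|n /nextP[]//] x.
  suff -> : neighbors (component (Y 0%N) x) = set0 by [].
  by apply/seteqP; split=> // v /neighbors_component /(_ Logic.I).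
exists Y; split=> // [n|n|n|n r free_r].
- by have [] := nextP _ (finY n).
- by have [_ _ + _ _] := nextP _ (finY n).
- by have [_ _ _ + _] := nextP _ (finY n).
- elim: n => [|n IH]; first by exists 0%N.
  by have [_ _ _ _] := nextP _ (finY n); apply.
Qed.

End Layering.

(** * Decided sets *)

HB.instance Definition _ (G : graph) := gen_eqMixin (edge G).
HB.instance Definition _ (G : graph) := gen_choiceMixin (edge G).

Lemma setYP (T : Type) (A B : set T) x : (A `+` B) x <-> ~ (A x <-> B x).
Proof.
rewrite /setY /setU /setD /=.
by have [] := pselect (A x); have [] := pselect (B x); tauto.
Qed.

Section Separation.
Context {G : graph}.
Implicit Types (A B D : set (vertex G)) (P Q : set (edge G)) (e : edge G).

Definition separates A e := ~ (A (src e) <-> A (tgt e)).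

Definition touching D : set (edge G) := [set e | D (src e) \/ D (tgt e)].

Lemma separatesC A e : separates (~` A) e <-> separates A e.
Proof.
rewrite /separates /setC /=.
by have [] := pselect (A (src e)); have [] := pselect (A (tgt e)); tauto.
Qed.

Lemma separatesY A B e :
  separates (A `+` B) e <-> ~ (separates A e <-> separates B e).
Proof.
rewrite /separates !setYP.
have [] := pselect (A (src e)); have [] := pselect (A (tgt e));
by have [] := pselect (B (src e)); have [] := pselect (B (tgt e)); tauto.
Qed.

Lemma separatesI A B e : separates (A `&` B) e -> separates A e \/ separates B e.
Proof.
rewrite /separates /setI /=.
by have [] := pselect (A (src e) <-> A (tgt e)); tauto.
Qed.

Lemma separatesU A B e : separates (A `|` B) e -> separates A e \/ separates B e.
Proof.
rewrite /separates /setU /=.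
by have [] := pselect (A (src e) <-> A (tgt e)); tauto.
Qed.

Lemma adjacent_edge e : adjacent (src e) (tgt e).
Proof. by exists e; left. Qed.

Lemma touching_sub A B : A `<=` B -> touching A `<=` touching B.
Proof. by move=> AB e [/AB|/AB]; [left|right]. Qed.

Lemma touching_src A e : A (src e) -> touching A e. Proof. by left. Qed.
Lemma touching_tgt A e : A (tgt e) -> touching A e. Proof. by right. Qed.

Lemma touching_closed_neighbors D e : touching D e ->
  closed_neighbors D (src e) /\ closed_neighbors D (tgt e).
Proof.
have st := adjacent_edge e; have ts := adjacentC st.
by case=> De; split; solve [by left|exact: closed_neighbors_adjacent De _].
Qed.

Lemma touching_component_same O x y e : touching (component O x) e ->
  touching (component O y) e -> component O x = component O y.
Proof.
have meet u v : component O x u -> component O y v -> adjacent u v ->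
    component O x = component O y.
  move=> xu yv uv; have xv := component_adjacent xu (component_subset yv) uv.
  by rewrite -(component_same xv) (component_same yv).
have st := adjacent_edge e; have ts := adjacentC st.
case=> xe [] ye.
- by rewrite -(component_same xe) (component_same ye).
- exact: meet xe ye st.
- exact: meet xe ye ts.
- by rewrite -(component_same xe) (component_same ye).
Qed.

End Separation.

Section Decided.
Context {G : graph}.
Variable Y : nat -> set (vertex G).
Hypothesis layY : layering Y.
Implicit Types (A B D N : set (vertex G)) (x y u v : vertex G) (z : nat -> vertex G)
  (P Q F I J X : set (edge G)) (e f g : edge G).

Local Notation node n x := (component (Y n) x).

Lemma node_neighbors_finite n x : finite_set (neighbors (node n x)).
Proof. exact: layering_finite layY n x. Qed.

Lemma layer_subset n m : (n <= m)%N -> Y m `<=` Y n.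
Proof. move=> nm; exact: (nonincreasing_subset (layeringS layY) nm). Qed.

Lemma node_subset n m x : (n <= m)%N -> node m x `<=` node n x.
Proof. by move=> /layer_subset; exact: component_mono. Qed.

Lemma node_closed_neighbors n x : closed_neighbors (node n.+1 x) `<=` node n x.
Proof.
move=> v [|Nv]; first exact: node_subset.
by have [_ [b /component_root Yx _]] := Nv; exact: (layering_neighbors layY Yx).
Qed.

Lemma layers_vanish x : exists n, ~ Y n x.
Proof.
apply: contrapT => /forallNP inY; have Yx n : Y n x by apply: contrapT.
have [y Ny] := layering_neighbors_nonempty layY (Yx 1%N).
have y0 : node 0 x y by apply: node_closed_neighbors; right.
suff sub : node 0 x `<=` [set z | forall m, node m x z] by case: Ny; case; exact: sub.
apply: component_ind => [m|a b _ xa _ ab m]; first exact: component_self.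
by apply: node_closed_neighbors; exact: closed_neighbors_adjacent (xa m.+1) ab.
Qed.

Lemma finite_outside_layer S : finite_set S -> exists n, S `<=` ~` Y n.
Proof.
move=> finS; apply: (finite_set_uniform (Q := fun n x => ~ Y n x)) => //.
- by move=> n m x nm nY /(layer_subset nm).
- by move=> x _; exact: layers_vanish.
Qed.

Lemma edge_outside_layer e : exists n, ~ Y n (src e) /\ ~ Y n (tgt e).
Proof.
have [|n off] := @finite_outside_layer [set src e; tgt e]; first exact: finite_set2.
by exists n; split; apply: off; [left|right].
Qed.

Lemma layer_not_touching n x e : ~ Y n (src e) -> ~ Y n (tgt e) ->
  ~ touching (node n x) e.
Proof. by move=> ns nt [/component_subset|/component_subset]. Qed.

Definition branch z := forall n, Y n (z n) /\ node n (z n) (z n.+1).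

Lemma branch_node z n m : branch z -> (n <= m)%N -> node n (z n) (z m).
Proof.
move=> bz /subnK <-; elim: (m - n)%N => [|k IH]; first exact: component_self (bz n).1.
rewrite addSn -(component_same IH); exact: node_subset (leq_addl _ _) _ (bz (k + n)%N).2.
Qed.

Lemma branch_node_subset z n m :
  branch z -> (n <= m)%N -> node m (z m) `<=` node n (z n).
Proof.
by move=> bz nm; rewrite -(component_same (branch_node bz nm)); exact: node_subset.
Qed.

Lemma exists_branch (Q : nat -> vertex G -> Prop) n0 x0 :
  (forall n x, Q n x -> Y n x) -> Q n0 x0 ->
  (forall n x, Q n x -> exists2 y, Q n.+1 y & node n x y) ->
  exists2 z, branch z & forall n, (n0 <= n)%N -> Q n (z n).
Proof.
move=> QY Q0 stepQ.
have /choice[next nextP] : forall nx : nat * vertex G, exists y, Q nx.1 nx.2 ->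
    Q nx.1.+1 y /\ node nx.1 nx.2 y.
  move=> [n x]; have [/stepQ[y ? ?]|nQ] := pselect (Q n x); first by exists y.
  by exists x.
pose z := fix z k := if k is l.+1 then next ((n0 + l)%N, z l) else x0.
have Qz k : Q (n0 + k)%N (z k).
  elim: k => [|k IH]; first by rewrite addn0.
  by rewrite addnS; have [] := nextP (_, _) IH.
exists (fun n => z (n - n0)%N) => [n|n n0n]; last by rewrite -{1}(subnKC n0n).
have [n0n|nn0] := leqP n0 n.
  rewrite subSn //; have := Qz (n - n0)%N; rewrite subnKC // => Qn.
  by split; [exact: QY|have [] := nextP (_, _) Qn; rewrite /= subnKC].
rewrite (eqP (ltnW nn0 : (n - n0 == 0)%N)) (eqP (nn0 : (n.+1 - n0 == 0)%N)) /=.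
have Yn : Y n x0 by apply: layer_subset (ltnW nn0) _ _; exact: QY.
by split=> //; exact: component_self.
Qed.

Definition decided A := forall z, branch z ->
  exists n, node n (z n) `<=` A \/ node n (z n) `<=` ~` A.

Lemma decided_node n x : decided (node n x).
Proof.
move=> z bz; exists n; have [xz|nxz] := pselect (node n x (z n)).
  by left; rewrite (component_same xz).
right=> v zv xv; apply: nxz; rewrite -(component_same xv); exact: connected_sym.
Qed.

Lemma decided_finite A : finite_set A -> decided A.
Proof.
move=> /finite_outside_layer[n off] z bz; exists n; right=> v /component_subset Yv Av.
exact: off Av Yv.
Qed.

Lemma decided1 v : decided [set v].
Proof. exact/decided_finite/finite_set1. Qed.

Lemma decidedC A : decided A -> decided (~` A).
Proof.
by move=> dA z /dA[n [h|h]]; exists n; [right; rewrite setCK|left].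
Qed.

Lemma decidedI A B : decided A -> decided B -> decided (A `&` B).
Proof.
move=> dA dB z bz; have [n nA] := dA _ bz; have [m mB] := dB _ bz.
exists (maxn n m); have sub_n := branch_node_subset bz (leq_maxl n m).
have sub_m := branch_node_subset bz (leq_maxr n m).
case: nA => [nA|nA]; last by right=> v /sub_n/nA nAv [].
case: mB => [mB|mB]; last by right=> v /sub_m/mB nBv [].
by left=> v zv; split; [exact/nA/sub_n|exact/mB/sub_m].
Qed.

Lemma decidedU A B : decided A -> decided B -> decided (A `|` B).
Proof.
move=> dA dB; rewrite -(setCK (A `|` B)) setCU.
by apply: decidedC; apply: decidedI; exact: decidedC.
Qed.

Lemma decidedY A B : decided A -> decided B -> decided (A `+` B).
Proof.
by move=> dA dB; rewrite /setY !setDE; apply: decidedU; apply: decidedI => //;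
  exact: decidedC.
Qed.

(** * Spanned edges *)

Definition invariant P A := decided A /\ forall e, P e -> ~ separates A e.

Definition linked P u v := forall A, invariant P A -> (A u <-> A v).

Definition spanned P : set (edge G) := [set e | linked P (src e) (tgt e)].

Lemma invariantC P A : invariant P A -> invariant P (~` A).
Proof.
by move=> [dA iA]; split=> [|e /iA]; [exact: decidedC|rewrite separatesC].
Qed.

Lemma invariantU P A B : invariant P A -> invariant P B -> invariant P (A `|` B).
Proof.
move=> [dA iA] [dB iB]; split=> [|e Pe /separatesU[]]; first exact: decidedU.
  exact: iA.
exact: iB.
Qed.

Lemma invariant0 P : invariant P set0.
Proof. by split=> [|e _]; [exact: decided_finite|rewrite /separates; tauto]. Qed.

Lemma invariant_bigcup_seq P (T : choiceType) (s : seq T) (F : T -> set (vertex G)) :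
  {in s, forall t, invariant P (F t)} -> invariant P (\bigcup_(t in [set` s]) F t).
Proof.
move=> iF; rewrite bigcup_seq big_seq.
by elim/big_ind: _ => [|A B|t /iF//]; [exact: invariant0|exact: invariantU].
Qed.

Lemma invariant_bigcap_seq P (T : choiceType) (s : seq T) (F : T -> set (vertex G)) :
  {in s, forall t, invariant P (F t)} -> invariant P (\bigcap_(t in [set` s]) F t).
Proof.
move=> iF; rewrite -(setCK (bigcap _ _)) setC_bigcap; apply: invariantC.
by apply: invariant_bigcup_seq => t /iF; exact: invariantC.
Qed.

Lemma invariant_sub P Q A : P `<=` Q -> invariant Q A -> invariant P A.
Proof. by move=> PQ [dA iA]; split=> // e /PQ /iA. Qed.

Lemma spannedP P e : spanned P e <-> forall A, invariant P A -> ~ separates A e.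
Proof.
by split=> [link A iA|h A iA]; [move=> /(_ (link A iA))|exact: contrapT (h A iA)].
Qed.

Lemma not_spannedP P e :
  ~ spanned P e <-> exists2 A, invariant P A & separates A e.
Proof.
split=> [|[A iA sA] /spannedP/(_ A iA)]; last by apply.
by rewrite spannedP => /existsNP[A /not_implyP[iA /contrapT sA]]; exists A.
Qed.

Lemma linked_mono P Q u v : P `<=` Q -> linked P u v -> linked Q u v.
Proof. by move=> PQ uv A iA; apply: uv; exact: invariant_sub PQ iA. Qed.

Lemma linked_spanned P Q u v : P `<=` spanned Q -> linked P u v -> linked Q u v.
Proof.
move=> PQ uv A iA; apply: uv; split=> [|e Pe]; first by case: iA.
by have /spannedP : spanned Q e by [exact: PQ]; apply.
Qed.

Lemma linked_sym P u v : linked P u v -> linked P v u.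
Proof. by move=> uv A iA; have [] := uv A iA. Qed.

Lemma linked_trans P v u w : linked P u v -> linked P v w -> linked P u w.
Proof. by move=> uv vw A iA; rewrite (uv A iA); exact: vw. Qed.

Lemma linked_set0 u v : linked set0 u v -> u = v.
Proof.
move=> uv; have [] // : [set u] u <-> [set u] v.
  by apply: uv; split=> //; exact: decided1.
by move=> /(_ erefl).
Qed.

Lemma linked_separated P s t :
  ~ linked P s t -> exists A, [/\ invariant P A, A s & ~ A t].
Proof.
move=> /existsNP[A /not_implyP[iA nst]]; have [As|nAs] := pselect (A s).
  by exists A; split=> // At; exact: nst.
exists (~` A); split=> //; first exact: invariantC.
by move=> nAt; apply: nst.
Qed.

Lemma spanned_mono P Q : P `<=` Q -> spanned P `<=` spanned Q.
Proof. by move=> PQ e; exact: linked_mono. Qed.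

Lemma spanned_self P : P `<=` spanned P.
Proof. by move=> e Pe; apply/spannedP => A [_]; exact. Qed.

Lemma spanned_trans P Q : P `<=` spanned Q -> spanned P `<=` spanned Q.
Proof. by move=> PQ e; exact: linked_spanned. Qed.

Lemma spanned_exchange P e f :
  spanned (f |` P) e -> ~ spanned P e -> spanned (e |` P) f.
Proof.
move=> /spannedP fPe /not_spannedP[A [dA iA] sA]; apply/spannedP => B [dB iB] sB.
have sAf : separates A f.
  by apply: contrapT => nAf; apply: (fPe A) => //; split=> // g [->|/iA].
have nBe : ~ separates B e by apply: iB; left.
apply: (fPe (A `+` B)); last by rewrite separatesY; tauto.
split=> [|g [->|Pg]]; [exact: decidedY|by rewrite separatesY; tauto|].
have nBg : ~ separates B g by apply: iB; right.
by have nAg := iA _ Pg; rewrite separatesY; tauto.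
Qed.

(** Only finitely many traces on a finite set are involved, hence the Boolean
    combinations of decided sets suffice. *)
Lemma invariant_trace N P B : finite_set N ->
  (forall s t, N s -> N t -> linked P s t -> (B s <-> B t)) ->
  exists2 A, invariant P A & forall s, N s -> (A s <-> B s).
Proof.
move=> /finite_seqP[X NX] B_linked.
have /choice[A AP] : forall st : vertex G * vertex G, exists A,
    ~ linked P st.1 st.2 -> [/\ invariant P A, A st.1 & ~ A st.2].
  move=> [s t]; have [st|/linked_separated[A ?]] := pselect (linked P s t).
    by exists set0.
  by exists A.
have separated s t : N s -> N t -> B s -> ~ B t -> ~ linked P s t.
  by move=> Ns Nt Bs nBt /(B_linked _ _ Ns Nt)[/(_ Bs)].
pose inB s := `[< B s >].
pose A_ s := \bigcap_(t in [set` [seq t <- X | ~~ inB t]]) A (s, t).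
have A_P s : N s -> B s -> [/\ invariant P (A_ s), A_ s s & forall t, N t -> ~ B t -> ~ A_ s t].
  move=> Ns Bs; have sepX t : t \in [seq t <- X | ~~ inB t] -> ~ linked P s t.
    rewrite mem_filter => /andP[/asboolPn nBt tX]; apply: separated => //.
    by rewrite NX.
  split.
  - by apply: invariant_bigcap_seq => t /sepX/(AP (s, t))[].
  - by move=> t /sepX/(AP (s, t))[].
  - move=> t Nt nBt Ast; have [_ _] := AP (s, t) (separated _ _ Ns Nt Bs nBt).
    apply; apply: Ast; rewrite /= mem_filter; apply/andP.
    by split; [exact/asboolPn|move: Nt; rewrite NX].
exists (\bigcup_(s in [set` [seq s <- X | inB s]]) A_ s).
  apply: invariant_bigcup_seq => s; rewrite mem_filter => /andP[/asboolP Bs sX].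
  by have [] := A_P s; rewrite ?NX.
move=> t Nt; split=> [[s /=]|Bt].
  rewrite mem_filter => /andP[/asboolP Bs sX] Ast; apply: contrapT => nBt.
  by have [||_ _ /(_ t Nt nBt)] := A_P s; rewrite ?NX.
exists t; last by have [] := A_P t.
by rewrite /= mem_filter; apply/andP; split; [exact/asboolP|move: Nt; rewrite NX].
Qed.

Section Glue.
Variables (O : set (vertex G)) (AD : set (vertex G) -> set (vertex G)) (B : set (vertex G)).
Hypothesis O_branch : forall z, branch z -> exists n, node n (z n) `<=` O.
Hypothesis AD_neighbors : forall x s, O x ->
  neighbors (component O x) s -> (AD (component O x) s <-> B s).

Definition glue : set (vertex G) :=
  [set w | (O w /\ AD (component O w) w) \/ (~ O w /\ B w)].

Lemma glue_outside w : ~ O w -> (glue w <-> B w).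
Proof. by rewrite /glue /=; tauto. Qed.

Lemma glue_inside x w : O x -> closed_neighbors (component O x) w ->
  (glue w <-> AD (component O x) w).
Proof.
move=> Ox [xw|Nw].
  by have Ow := component_subset xw; rewrite /glue /= -(component_same xw); tauto.
by have nOw := neighbors_component Nw; rewrite AD_neighbors // glue_outside.
Qed.

Lemma glue_separates x e : O x -> touching (component O x) e ->
  (separates glue e <-> separates (AD (component O x)) e).
Proof.
move=> Ox /touching_closed_neighbors[cs ct].
by rewrite /separates (glue_inside Ox cs) (glue_inside Ox ct).
Qed.

Lemma decided_glue : (forall x, O x -> decided (AD (component O x))) -> decided glue.
Proof.
move=> dAD z bz; have [n zO] := O_branch bz.
have Oz : O (z n) by apply: zO; exact: component_self (bz n).1.
have sub w : node n (z n) w -> component O (z n) w.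
  by apply: component_subcomponent => //; exact: component_self (bz n).1.
have [m zm] := dAD _ Oz _ bz; exists (maxn n m).
have glueE w : node (maxn n m) (z (maxn n m)) w ->
    (glue w <-> AD (component O (z n)) w).
  by move=> /(branch_node_subset bz (leq_maxl n m))/sub ?; apply: glue_inside => //; left.
have sub_m := branch_node_subset bz (leq_maxr n m).
case: zm => zm; [left|right] => w zw; first by apply/glueE => //; exact/zm/sub_m.
by move=> /(glueE _ zw); exact/zm/sub_m.
Qed.

End Glue.

Lemma linked_local O P B u v : (forall x, finite_set (neighbors (component O x))) ->
  (forall z, branch z -> exists n, node n (z n) `<=` O) ->
  (forall e, P e -> ~ O (src e) -> ~ O (tgt e) -> ~ separates B e) ->
  (forall x s t, O x -> neighbors (component O x) s -> neighbors (component O x) t ->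
     linked (P `&` touching (component O x)) s t -> (B s <-> B t)) ->
  linked P u v -> ~ O u -> ~ O v -> (B u <-> B v).
Proof.
move=> finO O_branch B_outside B_linked uv nOu nOv.
have /choice[AD ADP] : forall D, exists A, (exists2 x, O x & D = component O x) ->
    invariant (P `&` touching D) A /\ forall s, neighbors D s -> (A s <-> B s).
  move=> D; have [[x Ox ->]|nD] := pselect (exists2 x, O x & D = component O x).
    by have [A ? ?] := invariant_trace (finO x) (fun s t => B_linked x s t Ox); exists A.
  by exists set0.
have ADx x (Ox : O x) := ADP _ (ex_intro2 _ _ x Ox erefl).
have AD_neighbors x s : O x -> neighbors (component O x) s -> (AD (component O x) s <-> B s).
  by move=> Ox; apply: (ADx x Ox).2.
rewrite -(glue_outside AD B nOu) -(glue_outside AD B nOv); apply: uv; split.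
  by apply: decided_glue => // x Ox; case: (ADx x Ox) => -[].
have inside e x : P e -> O x -> touching (component O x) e -> ~ separates (glue O AD B) e.
  move=> Pe Ox xe; rewrite (glue_separates AD_neighbors Ox xe).
  by have [[_ iA] _] := ADx x Ox; exact: iA.
move=> e Pe; have [Os|nOs] := pselect (O (src e)).
  by apply: (inside e (src e)) => //; left; exact: component_self.
have [Ot|nOt] := pselect (O (tgt e)).
  by apply: (inside e (tgt e)) => //; right; exact: component_self.
by rewrite /separates !glue_outside //; exact: B_outside.
Qed.

Lemma linked_edge e : linked [set e] (src e) (tgt e).
Proof. exact: (@spanned_self [set e]). Qed.

Lemma linked_local_family (family : set (edge G) -> Prop) O P u v :
  (forall x, finite_set (neighbors (component O x))) ->
  (forall z, branch z -> exists n, node n (z n) `<=` O) ->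
  family set0 -> (forall P1 P2, family P1 -> family P2 -> family (P1 `|` P2)) ->
  (forall e, P e -> family [set e]) ->
  (forall x, family (P `&` touching (component O x))) ->
  linked P u v -> ~ O u -> ~ O v ->
  exists P', [/\ P' `<=` P, linked P' u v & family P'].
Proof.
move=> finO O_branch family0 familyU family1 family_touching uv nOu nOv.
pose B := [set w | exists P', [/\ P' `<=` P, linked P' u w & family P']].
have extend P1 s t : P1 `<=` P -> family P1 -> linked P1 s t -> B s -> B t.
  move=> P1P family_P1 st [P' [P'P us family_P']]; exists (P' `|` P1); split.
  - by rewrite subUset.
  - apply: (@linked_trans _ s); first by apply: linked_mono us; left.
    by apply: linked_mono st; right.
  - exact: familyU.
have extend_iff P1 s t : P1 `<=` P -> family P1 -> linked P1 s t -> (B s <-> B t).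
  by move=> ? ? st; split; apply: (extend P1) => //; exact: linked_sym.
suff [+ _] : B u <-> B v by apply; exists set0; split.
apply: (linked_local (O := O) (P := P)) uv nOu nOv => // [e Pe _ _|x s t _ _ _].
  apply; apply: (extend_iff [set e]) => [_ -> //||]; last exact: linked_edge.
  exact: family1.
by apply: extend_iff; first exact: subIsetl.
Qed.

Lemma node_linked_local n P B u v :
  (forall e, P e -> ~ Y n (src e) -> ~ Y n (tgt e) -> ~ separates B e) ->
  (forall x s t, neighbors (node n x) s -> neighbors (node n x) t ->
     linked (P `&` touching (node n x)) s t -> (B s <-> B t)) ->
  linked P u v -> ~ Y n u -> ~ Y n v -> (B u <-> B v).
Proof.
move=> B_outside B_linked; apply: linked_local => //.
- exact: node_neighbors_finite.
- by move=> z bz; exists n; exact: component_subset.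
- by move=> x s t _; exact: B_linked.
Qed.

(** * Thin edge sets *)

Definition thin n P := exists es S, [/\ finite_set es, finite_set S &
  P `<=` es `|` \bigcup_(x in S) touching (node n x)].

Lemma thin_mono n m P Q : (n <= m)%N -> Q `<=` P -> thin m P -> thin n Q.
Proof.
move=> nm QP [es [S [fin_es finS PS]]]; exists es, S; split=> //.
move=> f /QP/PS[|[x Sx xf]]; [by left|right; exists x => //].
exact: touching_sub (node_subset nm) _ xf.
Qed.

Lemma thinU n P Q : thin n P -> thin n Q -> thin n (P `|` Q).
Proof.
move=> [es [S [fin_es finS PS]]] [es' [S' [fin_es' finS' QS']]].
exists (es `|` es'), (S `|` S'); split; rewrite ?finite_setU //.
move=> f [/PS|/QS'] [ef|[x Sx xf]].
- by left; left.
- by right; exists x => //; left.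
- by left; right.
- by right; exists x => //; right.
Qed.

Lemma thin_finite n P : finite_set P -> thin n P.
Proof. by move=> finP; exists P, set0; split=> // f; left. Qed.

Lemma thin_touching n P x : thin n (P `&` touching (node n x)).
Proof. by exists set0, [set x]; split=> // f [_ xf]; right; exists x. Qed.

(** König's lemma: otherwise some branch has infinitely many separated edges at
    each of its nodes, contradicting that the branch is decided. *)
Lemma thin_finite_separated (P : nat -> set (edge G)) A :
  (forall n, P n.+1 `<=` P n) -> (forall n, thin n (P n)) -> decided A ->
  exists n, finite_set (P n `&` separates A).
Proof.
move=> PS thinP dA; apply: contrapT => /forallNP infP.
have le_sub := nonincreasing_subset PS.
pose heavy m x := forall n, infinite_set (P n `&` separates A `&` touching (node m x)).
have heavy_touching m x : heavy m x ->
    exists2 f, separates A f & touching (node m x) f.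
  by move=> /(_ 0%N)/infinite_setN0[f [[_ sf] xf]]; exists f.
have heavyY m x : heavy m x -> Y m x.
  by move=> /heavy_touching[f _ [/component_root|/component_root]].
have [x heavyx] : exists x, heavy 0%N x.
  have [es [S [fin_es finS PSx]]] := thinP 0%N.
  have [||x _ heavyx] := @infinite_pigeonhole _ _ (fun n => P n `&` separates A)
    (fun x => touching (node 0%N x)) es S 0%N _ infP fin_es finS.
  - by move=> n; exact: setSI.
  - by move=> f [/PSx].
  - by exists x.
have [m y heavyy|z bz heavyz] := exists_branch heavyY heavyx.
  have [es [S [fin_es finS PSx]]] := thinP m.+1.
  have [||w _ heavyw] := @infinite_pigeonhole _ _
    (fun n => P n `&` separates A `&` touching (node m y))
    (fun x => touching (node m.+1 x)) es S m.+1 _ heavyy fin_es finS.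
  - by move=> n; apply: setSI; exact: setSI.
  - by move=> f [[/PSx]].
  have {}heavyw n : infinite_set (P n `&` separates A `&` touching (node m.+1 w)
      `&` touching (node m y)).
    by apply: sub_infinite_set (heavyw n) => f [[]].
  exists w; first by move=> n; apply: sub_infinite_set (heavyw n) => f [].
  have [f [[_ wf] yf]] := infinite_setN0 (heavyw 0%N).
  have wf' := touching_sub (node_subset (leqnSn m)) wf.
  rewrite (touching_component_same yf wf').
  by case: wf' => /component_root; exact: component_self.
have [n zn] := dA _ bz; have [f sf zf] := heavy_touching _ _ (heavyz n.+1 isT).
have [/node_closed_neighbors zs /node_closed_neighbors zt] := touching_closed_neighbors zf.
move: zs zt; rewrite (component_same (branch_node bz (leqnSn n))) => zs zt.
by apply: sf; case: zn => zn; split=> h; [exact: zn|exact: zn|case: (zn _ zs)|case: (zn _ zt)].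
Qed.

Lemma thin_all_finite_separated P A :
  (forall n, thin n P) -> decided A -> finite_set (P `&` separates A).
Proof.
by move=> thinP /(@thin_finite_separated (fun=> P))[] // n.
Qed.

Lemma linked_thin n P u v : linked P u v -> ~ Y n u -> ~ Y n v ->
  exists P', [/\ P' `<=` P, linked P' u v & thin n P'].
Proof.
apply: linked_local_family; first exact: node_neighbors_finite.
- by move=> z bz; exists n; exact: component_subset.
- exact: thin_finite.
- by move=> P1 P2; exact: thinU.
- by move=> e _; exact/thin_finite/finite_set1.
- exact: thin_touching.
Qed.

Lemma spanned_thin P e : spanned P e ->
  exists P', [/\ P' `<=` P, spanned P' e & forall n, thin n P'].
Proof.
move=> Pe; have [n0 [ns nt]] := edge_outside_layer e.
have /choice[next nextP] : forall kP : nat * set (edge G), exists P', spanned kP.2 e ->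
    [/\ P' `<=` kP.2, spanned P' e & thin (n0 + kP.1)%N P'].
  move=> [k Q]; have [Qe|nQ] := pselect (spanned Q e); last by exists Q.
  have out v : ~ Y n0 v -> ~ Y (n0 + k)%N v by apply: contra_not; exact/layer_subset/leq_addr.
  by have [P' ?] := linked_thin Qe (out _ ns) (out _ nt); exists P'.
pose Q := fix Q k := if k is l.+1 then next (k, Q l) else next (0%N, P).
have QP k : [/\ Q k `<=` (if k is l.+1 then Q l else P), spanned (Q k) e &
    thin (n0 + k)%N (Q k)].
  by elim: k => [|k [_ Qk _]]; [exact: (nextP (0%N, P))|exact: (nextP (k.+1, Q k))].
have QS k : Q k.+1 `<=` Q k by have [] := QP k.+1.
have thinQ n : thin n (Q n).
  by have [_ _] := QP n; apply: thin_mono => //; exact: leq_addl.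
exists (\bigcap_n Q n); split.
- by move=> f /(_ 0%N Logic.I); have [+ _ _] := QP 0%N; exact.
- apply/spannedP => A [dA iA] sA; have [n fin] := thin_finite_separated QS thinQ dA.
  have le_sub := nonincreasing_subset QS.
  have [||m gone] := @finite_set_uniform _ _ (fun m f => ~ Q m f) fin.
  - by move=> i j f ij; apply: contra_not; exact: le_sub.
  - move=> f [_ sf]; apply: contrapT => /forallNP h; apply: (iA f _ sf) => i _.
    exact: contrapT (h i).
  have [_ /spannedP/(_ A) h _] := QP (maxn n m); apply: h sA; split=> // f Qf sf.
  apply: (gone f); last exact: le_sub (leq_maxr n m) _ Qf.
  by split=> //; exact: le_sub (leq_maxl n m) _ Qf.
- by move=> n; apply: thin_mono (leqnn n) _ (thinQ n) => f /(_ n Logic.I).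
Qed.

(** * Independent sets and bases *)

Definition coloop F : set (edge G) := [set e | ~ spanned (F `\ e) e].

Definition independent I := I `<=` coloop I.

Lemma coloop_sub P Q : P `<=` Q -> coloop Q `<=` coloop P.
Proof. by move=> PQ e; apply: contra_not; apply: spanned_mono; exact: setSD. Qed.

Lemma coloop_separated F e : F e -> coloop F e ->
  exists2 A, decided A & forall f, F f -> (separates A f <-> f = e).
Proof.
move=> Fe /not_spannedP[A [dA iA] sA]; exists A => // f Ff.
by split=> [sAf|->//]; apply: contrapT => fe; exact: iA sAf.
Qed.

Lemma independent_sub I J : independent J -> I `<=` J -> independent I.
Proof. by move=> indJ IJ e /IJ/indJ; exact: coloop_sub. Qed.

Lemma independentU1 I e : independent I -> ~ spanned I e -> independent (e |` I).
Proof.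
move=> indI nIe f [->|If] spf.
  by apply: nIe; apply: spanned_mono spf => g [[->|//] /(_ erefl)].
have [fe|fe] := pselect (f = e).
  by apply: nIe; apply: spanned_self; rewrite -fe.
apply: nIe; apply: (@spanned_mono (f |` (I `\ f))); first by move=> g [->|[]].
apply: spanned_exchange (indI _ If); apply: spanned_mono spf => g [[->|Ig] gf].
  by left.
by right.
Qed.

Lemma independent_augment I J : independent I -> independent J ->
  (exists2 e, ~ I e & independent (e |` I)) ->
  (forall e, independent (e |` J) -> J e) ->
  exists e, [/\ J e, ~ I e & independent (e |` I)].
Proof.
move=> indI indJ [e nIe indIe] maxJ; apply: contrapT => no_augment.
have JI : J `<=` spanned I.
  move=> f Jf; apply: contrapT => nIf; apply: no_augment; exists f; split=> //.
    by move=> If; apply: nIf; exact: spanned_self.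
  exact: independentU1.
have spanJ f : spanned J f.
  apply: contrapT => nJf; apply: (nJf); apply: spanned_self; apply: maxJ.
  exact: independentU1.
apply: (indIe e); first by left.
apply: (@spanned_mono I); last exact: spanned_trans JI _ (spanJ e).
by move=> f If; split; [right|move=> fe; apply: nIe; rewrite -fe].
Qed.

(** Corrects [A] by sets separating a single edge of [F]. *)
Lemma clear_separated (T : set (vertex G) -> Prop) (E : set (vertex G) -> Prop) F
    (s : seq (edge G)) A : (forall A B, T A -> E B -> T (A `+` B)) -> T A ->
  (forall t, t \in s -> F t ->
     exists2 B, E B & forall f, F f -> (separates B f <-> f = t)) ->
  exists2 A', T A' & forall f, F f -> (separates A' f <-> separates A f /\ f \notin s).
Proof.
move=> TE TA; elim: s => [|t s IH] single; first by exists A => // f _; split=> [|[]].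
have [|A' TA' A'F] := IH; first by move=> f fs; apply: single; rewrite inE fs orbT.
have [[Ft sA't]|nt] := pselect (F t /\ separates A' t).
  have [|B EB BF] := single t _ Ft; first by rewrite inE eqxx.
  exists (A' `+` B) => [|f Ff]; first exact: TE.
  have sBf := BF _ Ff; have sA'f := A'F _ Ff; rewrite separatesY inE negb_or.
  have [ft|/eqP ft] := eqVneq f t; first by rewrite ft in sBf sA'f *; split=> [|[]//]; tauto.
  by rewrite /= -sA'f; have [] := pselect (separates A' f); tauto.
exists A' => // f Ff; rewrite (A'F _ Ff) inE negb_or.
split=> [[sA fs]|[sA /andP[_ fs]]]; split=> //; apply/andP; split=> //.
by apply/eqP => ft; apply: nt; rewrite -ft; split=> //; apply/(A'F _ Ff).
Qed.

Lemma clear_coloops F (Z : set (edge G)) A : finite_set Z -> decided A ->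
  Z `<=` coloop F ->
  exists2 A', decided A' & forall f, F f -> (separates A' f <-> separates A f /\ ~ Z f).
Proof.
move=> /finite_seqP[s sE] dA ZF; have ZP f : f \in s <-> Z f by rewrite sE.
have [|t ts Ft|A' dA' A'F] := @clear_separated decided decided F s A _ dA.
- exact: decidedY.
- by have [|B dB BF] := @coloop_separated F t Ft; [exact/ZF/ZP|exists B].
exists A' => // f Ff; rewrite A'F //.
by split=> -[sA fs]; split=> //; [move=> /ZP; exact/negP|apply/negP => /ZP].
Qed.

Lemma independent_coloops I J : I `<=` J -> independent I -> J `\` I `<=` coloop J ->
  independent J.
Proof.
move=> IJ indI JI e Je; have [Ie|nIe] := pselect (I e); last exact: JI.
move=> /spanned_thin[P [PJ Pe thinP]].
have [A [dA iA] sA] := (not_spannedP _ _).1 (indI _ Ie).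
have [f [Pf sf]|A' dA' A'J] := @clear_coloops J _ A (thin_all_finite_separated thinP dA) dA.
  have [Jf fe] := PJ _ Pf; apply: JI; split=> // If.
  exact: (iA f (conj If fe) sf).
move/spannedP: Pe => /(_ A'); apply; last first.
  by rewrite A'J //; split=> // -[/PJ[_ /(_ erefl)]].
by split=> // f Pf; rewrite A'J; [move=> [sf]; apply|have [] := PJ _ Pf].
Qed.

(** The edges spanned by [P] once the vertices of [N] are identified. *)
Definition spanned_mod N P : set (edge G) := [set e | forall A, invariant P A ->
  (forall s t, N s -> N t -> (A s <-> A t)) -> ~ separates A e].

Lemma spanned_mod_self N P : P `<=` spanned_mod N P.
Proof. by move=> e Pe A [_ iA] _; exact: iA. Qed.

Lemma spanned_mod_trans N P Q :
  P `<=` spanned_mod N Q -> spanned_mod N P `<=` spanned_mod N Q.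
Proof.
move=> PQ e Pe A iA constA; apply: Pe => //; split=> [|f /PQ]; first by case: iA.
by apply.
Qed.

Definition traces N P : set (set (vertex G)) := [set A `&` N | A in invariant P].

Lemma traces_finite N P : finite_set N -> finite_set (traces N P).
Proof.
move=> finN; apply: sub_finite_set (finite_powerset finN) => _ [A _ <-].
exact: subIsetr.
Qed.

Lemma traces_sub N P Q : P `<=` Q -> traces N Q `<=` traces N P.
Proof. by move=> PQ _ [A iA <-]; exists A => //; exact: invariant_sub iA. Qed.

Lemma spanned_mod_spanned N P Q : P `<=` Q -> traces N P `<=` traces N Q ->
  Q `<=` spanned_mod N P -> Q `<=` spanned P.
Proof.
move=> PQ trPQ QP e Qe; apply/spannedP => A iA sA.
have [A1 iA1 A1N] := trPQ (A `&` N) (ex_intro2 _ _ A iA erefl).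
have agree v : N v -> (A1 v <-> A v).
  move=> Nv; have /seteqP[A1A AA1] := A1N.
  by split=> Av; [have [] := A1A v (conj Av Nv)|have [] := AA1 v (conj Av Nv)].
have nA1e : ~ separates A1 e by apply: iA1.2.
apply: (QP e Qe (A `+` A1)); last by rewrite separatesY; tauto.
- split=> [|f Pf]; first by apply: decidedY; [case: iA|case: iA1].
  have nAf := iA.2 _ Pf; have nA1f := iA1.2 _ (PQ _ Pf).
  by rewrite separatesY; tauto.
- by move=> s t Ns Nt; have := agree _ Ns; have := agree _ Nt; rewrite !setYP; tauto.
Qed.

Definition loose N I F := forall F1, I `<=` F1 -> F1 `<=` F ->
  F `<=` spanned_mod N F1 -> F `<=` spanned F1.

(** A set realizing as many traces on [N] as possible is loose. *)
Lemma exists_loose N I F : finite_set N -> I `<=` F ->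
  exists M, [/\ I `<=` M, M `<=` F, F `<=` spanned_mod N M & loose N I M].
Proof.
move=> finN IF; pose bound := finite_card [set A | A `<=` N].
have trace_bound P : (finite_card (traces N P) <= bound)%N.
  by apply: finite_card_le => [|_ [A _ <-]]; [exact: finite_powerset|exact: subIsetr].
have [|M [IM MF FM] maxM] := @exists_argmin _
  [set M | [/\ I `<=` M, M `<=` F & F `<=` spanned_mod N M]]
  (fun M => (bound - finite_card (traces N M))%N).
  by exists F; split=> //; exact: spanned_mod_self.
exists M; split=> // F1 IF1 F1M MF1; apply: spanned_mod_spanned (MF1) => //.
rewrite (@finite_card_eq _ (traces N M) (traces N F1)) //.
- exact: (traces_finite F1 finN).
- exact: (traces_sub F1M).
- rewrite -(leq_sub2lE (m := bound)) //; apply: maxM; split=> //.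
    exact: (subset_trans F1M MF).
  by apply: subset_trans FM _; exact: spanned_mod_trans.
Qed.

Lemma exists_finite_completion N M F : finite_set N -> M `<=` F ->
  F `<=` spanned_mod N M ->
  exists Z : set (edge G), [/\ finite_set Z, Z `<=` F & F `<=` spanned (M `|` Z)].
Proof.
move=> finN MF FM.
have [|Z [finZ ZF] minZ] := @exists_argmin (set (edge G))
  [set Z | finite_set Z /\ Z `<=` F] (fun Z => finite_card (traces N (M `|` Z))).
  by exists set0; split.
exists Z; split=> // e Fe.
have eZF : (e |` Z) `<=` F by rewrite subUset; split=> // _ ->.
have sub : M `|` Z `<=` M `|` (e |` Z) by apply: setUS; right.
apply: (@spanned_mod_spanned N (M `|` Z) (M `|` (e |` Z))) => //; last by right; left.
  rewrite (@finite_card_eq _ (traces N (M `|` (e |` Z))) (traces N (M `|` Z))) //.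
  - exact: (traces_finite _ finN).
  - exact: (traces_sub sub).
  - by apply: minZ; split=> //; rewrite finite_setU; split=> //; exact: finite_set1.
apply: (@subset_trans _ F); first by rewrite subUset.
apply: subset_trans FM _; apply: spanned_mod_trans => f Mf.
by apply: spanned_mod_self; left.
Qed.

Lemma separates_restrict A D e : (forall s, neighbors D s -> ~ A s) ->
  (separates (A `&` D) e <-> touching D e /\ separates A e).
Proof.
move=> A_off; have [De|/not_orP[ns nt]] := pselect (touching D e); last first.
  by rewrite /separates /touching /setI /=; tauto.
have agree v : closed_neighbors D v -> ((A `&` D) v <-> A v).
  by move=> [Dv|/A_off nAv]; rewrite /setI /=; tauto.
have [/agree Es /agree Et] := touching_closed_neighbors De.
by rewrite /separates Es Et; tauto.
Qed.

Lemma spanned_mod_node n x F F1 M Z : F1 `<=` F -> F `<=` spanned F1 ->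
  finite_set Z -> Z `<=` coloop F -> F `&` touching (node n x) `<=` M `|` Z ->
  F `&` touching (node n x) `&` ~` Z `<=` spanned_mod (neighbors (node n x)) (F1 `&` M).
Proof.
move=> F1F FF1 finZ ZF FMZ e [[Fe xe] nZe] A iA constA sA.
wlog A_off : A iA constA sA / forall s, neighbors (node n x) s -> ~ A s.
  move=> wl; have [[s Ns As]|offN] := pselect (exists2 s, neighbors (node n x) s & A s).
    apply: (wl (~` A)); [exact: invariantC| |by rewrite separatesC|].
      by move=> u v Nu Nv; have := constA _ _ Nu Nv; rewrite /setC /=; tauto.
    by move=> t Nt; have := constA _ _ Ns Nt; rewrite /setC /=; tauto.
  by apply: (wl A) => // s Ns As; apply: offN; exists s.
have restrictE f := separates_restrict f A_off.
have dAx : decided (A `&` node n x) by apply: decidedI; [case: iA|exact: decided_node].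
have [A' dA' A'F] := clear_coloops finZ dAx ZF.
have /spannedP/(_ A') : spanned F1 e by exact: FF1.
apply; last by rewrite A'F // restrictE.
split=> // f F1f; have Ff := F1F _ F1f; rewrite A'F // restrictE => -[[xf sf] nZf].
by have [Mf|//] := FMZ f (conj Ff xf); apply: iA.2 sf.
Qed.

Lemma component_refine_layers n (depth : set (vertex G) -> nat) x :
  (forall D, n <= depth D)%N ->
  let O := refine (Y n) (fun D => ~` Y (depth D)) in
  O x -> component O x = node (depth (node n x)) x.
Proof.
move=> depth_ge O Ox; have [y _ v Nv|-> _] := component_refine _ Ox.
  apply: (contra_not (@layer_subset _ _ (depth_ge _) v)).
  exact: neighbors_component Nv.
by rewrite setCK.
Qed.

(** The layers below each node are cut off so deeply that the edges of [S] lie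
    outside. *)
Lemma exists_deep_refinement n S u v : (forall x, finite_set (S `&` touching (node n x))) ->
  exists O, [/\ forall x, finite_set (neighbors (component O x)),
    forall z, branch z -> exists m, node m (z m) `<=` O, ~ O u /\ ~ O v &
    forall e, S e -> ~ O (src e) /\ ~ O (tgt e)].
Proof.
move=> finS; pose K D := [set u; v] `|`
  ([set src e | e in S `&` touching D] `|` [set tgt e | e in S `&` touching D]).
have /choice[depth depthP] : forall D, exists m, (n <= m)%N /\
    (finite_set (S `&` touching D) -> K D `<=` ~` Y m).
  move=> D; have [finD|] := pselect (finite_set (S `&` touching D)); last by exists n.
  have [|m off] := @finite_outside_layer (K D).
    rewrite finite_setU; split; first exact: finite_set2.
    by rewrite finite_setU; split; exact: finite_image.
  exists (maxn n m); split=> [|_ w Kw]; first exact: leq_maxl.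
  by move=> /(layer_subset (leq_maxr n m)); exact: off.
have depth_ge D : (n <= depth D)%N by case: (depthP D).
pose O := refine (Y n) (fun D => ~` Y (depth D)).
have nO x : K (node n x) x -> ~ O x.
  by move=> Kx [_ /contrapT]; exact: (depthP _).2 (finS x) _ Kx.
exists O; split=> [x|z bz||e Se].
- have [Ox|nOx] := pselect (O x); last by rewrite neighbors_empty.
  by rewrite component_refine_layers //; exact: node_neighbors_finite.
- exists (depth (node n (z n))) => w zw.
  have nw := branch_node_subset bz (depth_ge _) zw.
  split; first exact: component_subset nw.
  by rewrite (component_same nw) /setC /= => /(_ (component_subset zw)).
- by split; apply: nO; left; [left|right].
- split=> Oe; apply: (nO _ _ Oe); right; [left|right]; exists e => //; split=> //.
    by apply: touching_src; apply: component_self; case: Oe.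
  by apply: touching_tgt; apply: component_self; case: Oe.
Qed.

Lemma linked_finite_part n M S u v : (forall x, finite_set (S `&` touching (node n x))) ->
  linked (M `|` S) u v ->
  exists2 S0 : set (edge G), finite_set S0 /\ S0 `<=` S & linked (M `|` S0) u v.
Proof.
move=> finS uv; have [U [finU U_branch [nUu nUv] offS]] := exists_deep_refinement u v finS.
pose family P := exists2 S0 : set (edge G), finite_set S0 /\ S0 `<=` S & P `<=` M `|` S0.
have family_M P : P `<=` M -> family P by move=> PM; exists set0; [split|move=> e /PM; left].
have [|P1 P2|e|x|P [_ uvP [S0 S0P PS0]]] :=
    linked_local_family (family := family) finU U_branch _ _ _ _ uv nUu nUv.
- exact: family_M.
- move=> [S1 [finS1 S1S] P1S] [S2 [finS2 S2S] P2S]; exists (S1 `|` S2).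
    by rewrite finite_setU subUset.
  by move=> e [/P1S|/P2S] [Me|Se]; [left|right; left|left|right; right].
- move=> [Me|Se]; first by apply: family_M => _ ->.
  by exists [set e]; [split; [exact: finite_set1|move=> _ ->]|right].
- by apply: family_M => e [[//|/offS[ns nt]] [/component_subset|/component_subset]].
- by exists S0 => //; exact: linked_mono uvP.
Qed.

Lemma exists_coloop_base n M S : (forall x, finite_set (S `&` touching (node n x))) ->
  exists T : set (edge G), [/\ T `<=` S, S `<=` spanned (M `|` T) &
    forall t, T t -> ~ spanned (M `|` (T `\ t)) t].
Proof.
move=> finS.
pose good (T : set (edge G)) := T `<=` S /\ forall t, T t -> ~ spanned (M `|` (T `\ t)) t.
have [T [[TS Tcoloop] maxT]] : exists T, good T /\ forall U, T `<` U -> ~ good U.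
  apply: (@Zorn_bigcup _ good) => F Fgood tot.
  split; first by move=> e [X /Fgood[XS _] /XS].
  move=> t [X1 FX1 X1t]; set U := \bigcup_(X in F) X => spU.
  have [x|S0 [finS0 S0U] spt] := linked_finite_part (n := n) (S := U `\ t) _ spU.
    by apply: sub_finite_set (finS x) => e [[[X /Fgood[XS _] /XS]]].
  have /finite_seqP[s sE] := finS0.
  have [|X [FX X1X Xs]] := @chain_eventually_all _ _ (fun X f => X f) F X1 s tot FX1.
    move=> f fs; have [[X FX Xf] _] : (U `\ t) f by apply: S0U; rewrite sE.
    have [X1X|XX1] := tot _ _ FX1 FX; first by exists X; split=> // Z _; exact.
    by exists X1; split=> // Z _ /(_ _ (XX1 _ Xf)).
  have [_ /(_ t (X1X _ X1t))] := Fgood _ FX; apply; apply: spanned_mono spt.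
  move=> e [Me|S0e]; [by left|right; split; last by have [] := S0U _ S0e].
  by apply: (Xs X) => //; move: S0e; rewrite sE.
exists T; split=> // t St; apply: contrapT => nt; have nTt : ~ T t.
  by move=> Tt; apply: nt; apply: spanned_self; right.
apply: (maxT (t |` T)); first by split=> [e|/(_ t (or_introl erefl))//]; right.
split; first by rewrite subUset; split=> // _ ->.
move=> f [->|Tf] spf.
  by apply: nt; apply: spanned_mono spf => e [|[[->|] ne]]; [left|case: ne|right].
apply: nt; apply: (@spanned_mono (f |` (M `|` (T `\ f)))).
  by move=> e [->|[|[]]]; [right|left|right].
apply: spanned_exchange (Tcoloop _ Tf); apply: spanned_mono spf.
by move=> e [|[[->|Te] ef]]; [right; left|left|right; right].
Qed.

Record skeleton I F D M Z : Prop := Skeleton {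
  skeleton_base : I `&` touching D `<=` M;
  skeleton_sub : M `<=` F `&` touching D;
  skeleton_finite : finite_set Z;
  skeleton_completion_sub : Z `<=` F `&` touching D;
  skeleton_spanned : F `&` touching D `<=` spanned (M `|` Z);
  skeleton_loose : loose (neighbors D) (I `&` touching D) M }.

Lemma exists_skeleton I F D : I `<=` F -> finite_set (neighbors D) ->
  exists M Z, skeleton I F D M Z.
Proof.
move=> IF finD; have IFD : I `&` touching D `<=` F `&` touching D by exact: setSI.
have [M [IM MF FM looseM]] := exists_loose finD IFD.
by have [Z [finZ ZF FMZ]] := exists_finite_completion finD MF FM; exists M, Z.
Qed.

(** One step of the construction of a base of [F] containing [I]: outside the
    [n]-th layer the set is already independent over [I], and spanning subsets
    can be chosen independently in each node. *)
Record base_step n I F F' : Prop := BaseStep {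
  base_step_base : I `<=` F';
  base_step_sub : F' `<=` F;
  base_step_spanned : F `<=` spanned F';
  base_step_coloop : forall e,
    F' e -> ~ I e -> ~ Y n (src e) -> ~ Y n (tgt e) -> coloop F' e;
  base_step_local : forall F1 x, I `<=` F1 -> F1 `<=` F' -> F' `<=` spanned F1 ->
    F' `&` touching (node n x) `<=` spanned (F1 `&` touching (node n x)) }.

Section BaseStep.
Variables (n : nat) (I F : set (edge G)).
Hypothesis IF : I `<=` F.
Variables M Z : set (vertex G) -> set (edge G).
Hypothesis skel : forall x, skeleton I F (node n x) (M (node n x)) (Z (node n x)).

Let core : set (edge G) := I `|` \bigcup_x M (node n x).
Let rest : set (edge G) := [set e | [/\ F e, ~ I e &
  (~ Y n (src e) /\ ~ Y n (tgt e)) \/ exists x, Z (node n x) e]].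

Let core_sub : core `<=` F.
Proof. by move=> e [/IF//|[x _ /(skeleton_sub (skel x))[]]]. Qed.

Let spanned_core_rest : F `<=` spanned (core `|` rest).
Proof.
move=> e Fe; have [Ie|nIe] := pselect (I e); first by apply: spanned_self; left; left.
have in_node x : touching (node n x) e -> spanned (core `|` rest) e.
  move=> xe; apply: spanned_trans (skeleton_spanned (skel x) (conj Fe xe)) => f [Mf|Zf].
    by apply: spanned_self; left; right; exists x.
  apply: spanned_self; have [If|nIf] := pselect (I f); first by left; left.
  by right; split=> //; [case: (skeleton_completion_sub (skel x) Zf)|right; exists x].
have [Ys|nYs] := pselect (Y n (src e)).
  by apply: (in_node (src e)); apply: touching_src; exact: component_self.
have [Yt|nYt] := pselect (Y n (tgt e)).
  by apply: (in_node (tgt e)); apply: touching_tgt; exact: component_self.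
by apply: spanned_self; right; split=> //; left.
Qed.

Let rest_touching x : rest `&` touching (node n x) `<=` Z (node n x).
Proof.
move=> e [[_ _ [[ns nt] /(layer_not_touching ns nt)//|[y Ze] xe]]].
have [_ ye] := skeleton_completion_sub (skel y) Ze.
by rewrite (touching_component_same xe ye).
Qed.

Let core_touching x : core `&` touching (node n x) `<=` M (node n x).
Proof.
move=> e [[Ie|[y _ Me]] xe]; first exact: skeleton_base (skel x) _ (conj Ie xe).
have [_ ye] := skeleton_sub (skel y) Me.
by rewrite (touching_component_same xe ye).
Qed.

Lemma base_step_of_skeletons : exists F', base_step n I F F'.
Proof.
have [x|T [T_rest rest_T T_coloop]] := @exists_coloop_base n core rest.
  exact: (sub_finite_set (@rest_touching x) (skeleton_finite (skel x))).
pose F' := core `|` T.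
have T_not_core t : T t -> ~ core t.
  by move=> Tt core_t; apply: (T_coloop _ Tt); apply: spanned_self; left.
have F'_coloop : T `<=` coloop F'.
  move=> t Tt; apply: contra_not (T_coloop _ Tt); apply: spanned_mono.
  by move=> e [[core_e|Te] et]; [left|right].
have F'_touching x : F' `&` touching (node n x) `<=`
    M (node n x) `|` (T `&` Z (node n x)).
  move=> e [[core_e|Te] xe]; first by left; exact: core_touching.
  by right; split=> //; apply: rest_touching; split=> //; exact: T_rest.
exists F'; split.
- by left; left.
- by move=> e [/core_sub|/T_rest[]].
- apply: subset_trans spanned_core_rest _; apply: spanned_trans => f [core_f|rest_f];
    last exact: rest_T.
  by apply: spanned_self; left.
- move=> e [[//|[x _ Me]]|/F'_coloop//] _ ns nt.
  have [_ xe] := skeleton_sub (skel x) Me.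
  by case: (layer_not_touching ns nt xe).
- move=> F1 x IF1 F1F' F'F1.
  have TF1 : T `<=` F1.
    move=> t Tt; apply: contrapT => nt; apply: (F'_coloop _ Tt).
    apply: spanned_mono (F'F1 t _); last by right.
    by move=> e F1e; split; [exact: F1F'|move=> et; apply: nt; rewrite -et].
  have M_F1 : M (node n x) `<=` spanned (F1 `&` M (node n x)).
    apply: (skeleton_loose (skel x)) => [e [Ie xe]|e []//|e Me].
      by split; [exact: IF1|exact: skeleton_base (skel x) _ (conj Ie xe)].
    have [_ xe] := skeleton_sub (skel x) Me.
    have core_e : core e by right; exists x.
    apply: (@spanned_mod_node n x F' F1 _ (T `&` Z (node n x))) => //.
    - exact: finite_setIr (skeleton_finite (skel x)).
    - by move=> t [/F'_coloop].
    - by split; [split=> //; left|move=> [/T_not_core]].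
  move=> e [F'e xe]; have [Me|[/TF1 F1e _]] := F'_touching x e (conj F'e xe).
    apply: spanned_mono (M_F1 _ Me) => f [F1f Mf]; split=> //.
    by have [] := skeleton_sub (skel x) Mf.
  by apply: spanned_self; split.
Qed.

End BaseStep.

Lemma exists_base_step n I F : I `<=` F -> exists F', base_step n I F F'.
Proof.
move=> IF; have /choice[MZ skel] : forall D, exists MZ : set (edge G) * set (edge G),
    finite_set (neighbors D) -> skeleton I F D MZ.1 MZ.2.
  move=> D; have [/(exists_skeleton IF)[M [Z ?]]|nD] := pselect (finite_set (neighbors D)).
    by exists (M, Z).
  by exists (set0, set0).
apply: (@base_step_of_skeletons n I F IF (fun D => (MZ D).1) (fun D => (MZ D).2)) => x.
exact/skel/node_neighbors_finite.
Qed.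

Definition broken A P n x := exists s t, [/\ neighbors (node n x) s,
  neighbors (node n x) t, linked (P `&` touching (node n x)) s t & ~ (A s <-> A t)].

Lemma linked_broken n P A u v :
  (forall e, P e -> ~ Y n (src e) -> ~ Y n (tgt e) -> ~ separates A e) ->
  linked P u v -> ~ Y n u -> ~ Y n v -> ~ (A u <-> A v) -> exists x, broken A P n x.
Proof.
move=> A_outside uv nu nv nA; apply: contrapT => none; apply: nA.
apply: (node_linked_local (P := P)) uv nu nv => // x s t Ns Nt st.
by apply: contrapT => nst; apply: none; exists x, s, t.
Qed.

Lemma broken_layer A P n x : broken A P n x -> Y n x.
Proof. by move=> [s [t [[_ [b /component_root]]]]]. Qed.

Lemma branch_not_broken A z : decided A -> branch z ->
  exists n, forall m P, (n <= m)%N -> ~ broken A P m.+1 (z m.+1).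
Proof.
move=> dA bz; have [n zn] := dA _ bz; exists n => m P nm [s [t [Ns Nt _ nst]]].
have sub v : neighbors (node m.+1 (z m.+1)) v -> node n (z n) v.
  move=> Nv; have := node_closed_neighbors (or_intror Nv).
  by rewrite (component_same (branch_node bz (leqnSn _))); exact: branch_node_subset.
by apply: nst; case: zn => zn; have := zn _ (sub _ Ns); have := zn _ (sub _ Nt);
  rewrite /setC /=; tauto.
Qed.

Section BaseLimit.
Variables (I : set (edge G)) (F : nat -> set (edge G)).
Hypothesis indI : independent I.
Hypothesis F_step : forall n, base_step n I (F n) (F n.+1).

Let F_le n m : (n <= m)%N -> F m `<=` F n.
Proof. by apply: nonincreasing_subset => k; exact: base_step_sub (F_step k). Qed.

Let F_spanned n m : (n <= m)%N -> F n `<=` spanned (F m).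
Proof.
move=> /subnK <-; elim: (m - n)%N => [|k IH]; first exact: spanned_self.
rewrite addSn; apply: subset_trans IH _; apply: spanned_trans.
exact: base_step_spanned (F_step _).
Qed.

Let base n : I `<=` F n.+1. Proof. exact: base_step_base (F_step n). Qed.

Let in_limit n e :
  F n.+1 e -> ~ Y n (src e) -> ~ Y n (tgt e) -> (\bigcap_m F m) e.
Proof.
move=> Fe ns nt m _; have [mn|nm] := leqP m n.+1; first exact: F_le mn _ Fe.
have [Ie|nIe] := pselect (I e); first by case: m nm => // m _; exact: base.
apply: contrapT => nFe; apply: (base_step_coloop (F_step n) Fe nIe ns nt).
apply: spanned_mono (F_spanned (ltnW nm) Fe) => f Ff.
by split; [exact: F_le (ltnW nm) _ Ff|move=> fe; apply: nFe; rewrite -fe].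
Qed.

Lemma base_limit_independent : independent (\bigcap_n F n).
Proof.
apply: (independent_coloops (I := I)) => // [e Ie [|n] _|e [Je nIe]]; last 1 first.
- have [n [ns nt]] := edge_outside_layer e.
  apply: coloop_sub (base_step_coloop (F_step n) (Je n.+1 Logic.I) nIe ns nt).
  by move=> f; apply.
- exact: (@F_le 0%N 1%N isT _ (@base 0%N _ Ie)).
- exact: base.
Qed.

Lemma broken_below A n x : invariant (\bigcap_m F m) A -> broken A (F n.+1) n x ->
  exists2 y, broken A (F n.+2) n.+1 y & node n x y.
Proof.
move=> [_ iA] [s [t [Ns Nt st nst]]].
have {}st : linked (F n.+2 `&` touching (node n x)) s t.
  apply: linked_spanned st; apply: (base_step_local (F_step n)); first exact: base.
  - exact: F_le.
  - exact: F_spanned.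
have out v : neighbors (node n x) v -> ~ Y n.+1 v.
  by move=> Nv /(layeringS layY); exact: neighbors_component Nv.
have [f [Ff _] fs ft|y [s' [t' [Ns' Nt' st' nst']]]] :=
    linked_broken _ st (out _ Ns) (out _ Nt) nst.
  by apply: iA; exact: in_limit Ff fs ft.
exists y.
  by exists s', t'; split=> //; apply: linked_mono st' => f [[]].
have [[f [[_ xf] yf]]|none] :=
    pselect (exists f, (F n.+2 `&` touching (node n x) `&` touching (node n.+1 y)) f).
  have yf' := touching_sub (node_subset (leqnSn n)) yf.
  rewrite (touching_component_same xf yf'); apply: component_self.
  by case: yf' => /component_root.
exfalso; apply: nst'; suff -> : s' = t' by [].
by apply: linked_set0; apply: linked_mono st' => f Ff; apply: none; exists f.
Qed.

(** An edge that the limit fails to span could be traced along a branch through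
    all layers, contradicting that the witnessing set is decided. *)
Lemma base_limit_spanned : F 0%N `<=` spanned (\bigcap_n F n).
Proof.
move=> e F0e; apply/spannedP => A iA sA; have [n0 [ns nt]] := edge_outside_layer e.
have [f Ff fs ft|x0 broken0] := linked_broken _ (F_spanned (leq0n n0.+1) F0e) ns nt sA.
  by apply: iA.2; exact: in_limit Ff fs ft.
have [n x|n x|z bz brokenz] := exists_branch (Q := fun n x => broken A (F n.+1) n x) _ broken0.
- exact: broken_layer.
- exact: broken_below.
have [n unbroken] := branch_not_broken iA.1 bz.
apply: (unbroken (maxn n n0) _ (leq_maxl _ _)); apply: brokenz.
exact: leqW (leq_maxr _ _).
Qed.

End BaseLimit.

Lemma exists_base I X : independent I -> I `<=` X ->
  exists J, [/\ independent J, I `<=` J, J `<=` X & X `<=` spanned J].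
Proof.
move=> indI IX.
have /choice[next nextP] : forall nF : nat * set (edge G), exists F', I `<=` nF.2 ->
    base_step nF.1 I nF.2 F'.
  move=> [n F]; have [/(exists_base_step n)[F' ?]|nI] := pselect (I `<=` F); first by exists F'.
  by exists F.
pose F := fix F n := if n is k.+1 then next (k, F k) else X.
have IF n : I `<=` F n by elim: n => //= n /(nextP (n, _))/base_step_base.
have F_step n : base_step n I (F n) (F n.+1) by exact: (nextP (n, F n) (IF n)).
exists (\bigcap_n F n); split.
- exact: base_limit_independent F_step.
- by move=> e Ie n _; exact: IF.
- by move=> e /(_ 0%N Logic.I).
- exact: base_limit_spanned F_step.
Qed.

End Decided.

(** * The matroid and its circuits *)

Section LayerMatroid.
Context {G : graph}.
Variable Y : nat -> set (vertex G).
Hypothesis layY : layering Y.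
Implicit Types (A B : set (vertex G)) (I J C P X : set (edge G)) (e f g : edge G).

Let independent_set0 : independent Y set0. Proof. by []. Qed.

Let independent_subset I J : independent Y J -> I `<=` J -> independent Y I.
Proof. exact: independent_sub. Qed.

Let independent_augmentation I J : independent Y I -> ~ maximal_in (independent Y) I ->
  maximal_in (independent Y) J -> exists e, [/\ J e, ~ I e & independent Y (e |` I)].
Proof.
move=> indI nmaxI [indJ maxJ]; apply: independent_augment => //; last first.
  by move=> e /maxJ <-; [left|right].
apply: contrapT => none; apply: nmaxI; split=> // B indB IB; apply/seteqP; split=> // e Be.
apply: contrapT => nIe; apply: none; exists e => //; apply: independent_sub indB _.
by rewrite subUset; split=> // _ ->.
Qed.

Let independent_maximal I X : independent Y I -> I `<=` X -> exists B : set (edge G),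
  maximal_in [set J | [/\ independent Y J, I `<=` J & J `<=` X]] B.
Proof.
move=> indI IX; have [J [indJ IJ JX XJ]] := exists_base layY indI IX.
exists J; split=> // B [indB _ BX] JB; apply/seteqP; split=> // e Be.
apply: contrapT => nJe; apply: (indB _ Be); apply: spanned_mono (XJ _ (BX _ Be)) => f Jf.
by split; [exact: JB|move=> fe; apply: nJe; rewrite -fe].
Qed.

Definition layer_matroid : matroid (edge G) := Matroid independent_set0
  independent_subset independent_augmentation independent_maximal.

Record cut_cyclic C : Prop := CutCyclic {
  cut_cyclic_nonempty : C !=set0;
  cut_cyclic_other : forall A e, decided Y A -> C e -> separates A e ->
    exists f, [/\ C f, f <> e & separates A f];
  cut_cyclic_pair : forall e f, C e -> C f -> e <> f ->
    exists2 A, decided Y A & forall g, C g -> (separates A g <-> g = e \/ g = f) }.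

Lemma cut_cyclic_spanned C e : cut_cyclic C -> C e -> spanned Y (C `\ e) e.
Proof.
move=> cC Ce; apply/spannedP => A [dA iA] sA.
have [f [Cf fe sf]] := cut_cyclic_other cC dA Ce sA.
by apply: (iA f).
Qed.

Lemma circuit_independent C e : circuits layer_matroid C -> C e -> independent Y (C `\ e).
Proof.
move=> [_ minC] Ce; apply: contrapT => depCe.
have CE := minC _ depCe (@subDsetl _ _ _).
by have : (C `\ e) e; [rewrite CE|case=> _; apply].
Qed.

Lemma circuit_spanned C e : circuits layer_matroid C -> C e -> spanned Y (C `\ e) e.
Proof.
move=> circC Ce; have [depC _] := circC.
have /existsNP[e0 /not_implyP[Ce0 /contrapT span0]] := depC.
have [->//|/eqP ee0] := eqVneq e e0.
apply: (@spanned_mono _ Y (e0 |` ((C `\ e) `\ e0))).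
  by move=> f [->|[]//]; split=> //; exact/nesym.
apply: (spanned_exchange layY).
  apply: spanned_mono span0 => f [Cf fe0]; have [->|/eqP fe] := eqVneq f e; first by left.
  by right.
by apply: (circuit_independent circC Ce); split=> //; exact/nesym.
Qed.

Lemma circuit_cut_cyclic C : circuits layer_matroid C -> cut_cyclic C.
Proof.
move=> circC; have other A e : decided Y A -> C e -> separates A e ->
    exists f, [/\ C f, f <> e & separates A f].
  move=> dA Ce sA; apply: contrapT => none.
  have /spannedP/(_ A) := circuit_spanned circC Ce; apply=> //; split=> // f [Cf fe] sf.
  by apply: none; exists f.
split=> //.
  have [depC _] := circC.
  by have /existsNP[e /not_implyP[Ce _]] := depC; exists e.
move=> e f Ce Cf ef.
have indCe := circuit_independent circC Ce (conj Cf (nesym ef)).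
have [A [dA iA] sA] := (not_spannedP _ _ _).1 indCe; exists A => // g Cg.
have only h : C h -> separates A h -> h = e \/ h = f.
  move=> Ch sh; apply: contrapT => /not_orP[he hf]; apply: iA sh.
  by split.
split=> [|[->|->]//]; first exact: only.
have [h [Ch hf sh]] := other _ _ dA Cf sA.
by have [<-|] := only _ Ch sh.
Qed.

Lemma cut_cyclic_circuit C : cut_cyclic C -> circuits layer_matroid C.
Proof.
move=> cC; split.
  have [e Ce] := cut_cyclic_nonempty cC.
  by move=> /(_ e Ce); apply; exact: cut_cyclic_spanned.
move=> B depB BC; apply/seteqP; split=> // e Ce; apply: contrapT => nBe; apply: depB.
move=> f Bf; have ef : e <> f by move=> ef; apply: nBe; rewrite ef.
have [A dA AC] := cut_cyclic_pair cC Ce (BC _ Bf) ef.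
apply/not_spannedP; exists A; last by rewrite AC; [right|exact: BC].
split=> // g [Bg gf]; rewrite AC; last exact: BC.
by case=> [ge|//]; apply: nBe; rewrite -ge.
Qed.

Lemma layer_circuitP C : circuits layer_matroid C <-> cut_cyclic C.
Proof. by split; [exact: circuit_cut_cyclic|exact: cut_cyclic_circuit]. Qed.

(** Some thin subset of [C] already contains a circuit. *)
Lemma cut_cyclic_thin C n : cut_cyclic C -> thin Y n C.
Proof.
move=> cC; have [e Ce] := cut_cyclic_nonempty cC.
have [P [PC Pe thinP]] := spanned_thin layY (cut_cyclic_spanned cC Ce).
have [_ minC] := cut_cyclic_circuit cC.
rewrite -(minC (e |` P)).
- by apply: thinU => //; exact/thin_finite/finite_set1.
- move=> /(_ e (or_introl erefl)); apply; apply: spanned_mono Pe => f Pf.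
  by split; [right|have [] := PC _ Pf].
- by rewrite subUset; split=> [_ ->//|f /PC[]].
Qed.

End LayerMatroid.

(** * Undominated ends and branches *)

(** Greedy choice of infinitely many disjoint lists. *)
Lemma infinite_disjoint_seqs (T : eqType) (P : seq T -> Prop) :
  (forall L : seq T, exists p, [/\ P p, p != [::] & {in p, forall z, z \notin L}]) ->
  exists2 Q : set (seq T), infinite_set Q & Q `<=` P /\
    forall p q, Q p -> Q q -> p <> q -> forall z, z \in p -> z \notin q.
Proof.
move=> /choice[next nextP].
pose L := fix L n := if n is k.+1 then L k ++ next (L k) else [::].
pose p n := next (L n).
have pP n : [/\ P (p n), p n != [::] & {in p n, forall z, z \notin L n}] by exact: nextP.
have p_L n m : (n < m)%N -> {subset p n <= L m}.
  elim: m => // m IH; rewrite ltnS leq_eqVlt => /orP[/eqP <-|/IH sub] z zp /=.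
    by rewrite mem_cat zp orbT.
  by rewrite mem_cat sub.
have disjoint_lt n m : (n < m)%N -> forall z, z \in p n -> z \in p m -> False.
  by move=> nm z /(p_L _ _ nm) zL zm; have [_ _ /(_ z zm)] := pP m; rewrite zL.
have disjoint n m z : n <> m -> z \in p n -> z \in p m -> False.
  move=> nm zn zm; have [lt|lt|/nm//] := ltngtP n m.
    exact: disjoint_lt lt z zn zm.
  exact: disjoint_lt lt z zm zn.
have p_inj : injective p.
  move=> n m pnm; apply: contrapT => nm; have [_ + _] := pP n.
  case E : (p n) => [//|z s] _.
  by apply: (disjoint n m z nm); rewrite -?pnm E inE eqxx.
exists (range p); last first.
  split=> [_ [n _ <-]|_ _ [n _ <-] [m _ <-] nm z zn]; first by have [] := pP n.
  by apply/negP => zm; apply: (disjoint n m z) => // nmE; apply: nm; rewrite nmE.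
move=> fin; apply: infinite_nat.
have -> : [set: nat] = p @^-1` range p by apply/seteqP; split=> // n _; exists n.
by apply: finite_preimage => // a b _ _; exact: p_inj.
Qed.

Lemma disjoint_seqs_finite (T : eqType) (Q : set (seq T)) (F : set T) : finite_set F ->
  (forall p q, Q p -> Q q -> p <> q -> forall z, z \in p -> z \notin q) ->
  (forall p, Q p -> exists2 z, z \in p & F z) -> finite_set Q.
Proof.
move=> finF disjointQ meetF.
have /choice[pick pickP] : forall z, exists p, forall q, Q q -> z \in q -> p = q.
  move=> z; have [[p [Qp zp]]|none] := pselect (exists p, Q p /\ z \in p); last first.
    by exists [::] => q Qq zq; case: none; exists q.
  exists p => q Qq zq; apply: contrapT => pq.
  by have := disjointQ _ _ Qp Qq pq z zp; rewrite zq.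
apply: (@sub_finite_set _ _ (pick @` F)); last exact: finite_image.
by move=> p Qp; have [z zp Fz] := meetF p Qp; exists z => //; exact: pickP.
Qed.

(** Concatenation of the walks [s n :: p n] from [s n] to [s n.+1]. *)
Lemma infinite_concat (T : eqType) (e : rel T) (s : nat -> T) (p : nat -> seq T) :
  (forall n, [/\ path e (s n) (p n), last (s n) (p n) = s n.+1 & p n != [::]]) ->
  exists x : nat -> T, (forall k, e (x k) (x k.+1)) /\
    forall n, exists k0, forall k, (k0 <= k)%N -> exists2 m, (n <= m)%N & x k \in p m.
Proof.
move=> walk_p; pose L := fix L n := if n is k.+1 then L k ++ p k else [::].
have sizeL n : (n <= size (L n))%N.
  elim: n => //= n IH; rewrite size_cat -addn1 leq_add // lt0n size_eq0.
  by have [] := walk_p n.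
have L_prefix n m : (n <= m)%N -> exists q, L m = L n ++ q.
  move=> /subnK <-; elim: (m - n)%N => [|k [q IH]]; first by exists [::]; rewrite cats0.
  by exists (q ++ p (k + n)%N); rewrite addSn /= IH catA.
pose x k := nth (s 0%N) (L k.+1) k.
have xE k n : (k < n)%N -> nth (s 0%N) (L n) k = x k.
  by move=> /L_prefix[q ->]; rewrite nth_cat (leq_trans _ (sizeL k.+1)).
have pathL n : path e (s 0%N) (L n) /\ last (s 0%N) (L n) = s n.
  elim: n => //= n [pathn lastn]; have [pathp lastp _] := walk_p n.
  by rewrite cat_path last_cat pathn lastn pathp lastp.
exists x; split=> [k|n].
  have /(pathP (s 0%N))/(_ k.+1 (sizeL k.+2)) := (pathL k.+2).1.
  by rewrite -[nth _ (_ :: _) _]/(nth (s 0%N) (L k.+2) k) !xE.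
exists (size (L n)) => k nk.
have kL : (k < size (L k.+1))%N by exact: sizeL.
suff step m : (size (L n) <= k < size (L m))%N ->
    exists2 i, (n <= i)%N & nth (s 0%N) (L m) k \in p i.
  by apply: (step k.+1); rewrite nk.
elim: m => [|m IH]; first by rewrite ltn0 andbF.
rewrite /= size_cat nth_cat => /andP[_ km]; have [lt|ge] := ltnP k (size (L m)).
  by apply: IH; rewrite nk.
exists m; last by rewrite mem_nth // ltn_subLR.
rewrite leqNgt; apply/negP => mn; have [q Lq] := L_prefix _ _ mn.
move: km; rewrite -size_cat -/(L m.+1) ltnNge (leq_trans _ nk) // Lq.
by rewrite [in X in (_ <= X)%N]size_cat leq_addr.
Qed.

(** Deleting all loops: every vertex is left after its last visit. *)
Lemma loop_erasure (T : Type) (x : nat -> T) :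
  (forall v, exists k0, forall k, x k = v -> (k <= k0)%N) ->
  exists q : nat -> nat, [/\ injective (x \o q), forall j, (j <= q j)%N &
    forall j, x (q j.+1) = x (q j).+1].
Proof.
move=> finite_visits.
have /choice[l lP] : forall k, exists j, [/\ (k <= j)%N, x j = x k &
    forall i, (j < i)%N -> x i <> x k].
  move=> k; have [k0 visits] := finite_visits (x k).
  have [|j [kj xj] maxj] := @exists_argmin _ [set j | (k <= j)%N /\ x j = x k]
    (fun j => (k0 - j)%N); first by exists k.
  exists j; split=> // i ji xi; have := maxj i (conj (leq_trans kj (ltnW ji)) xi).
  by rewrite leq_sub2lE ?visits // leqNgt ji.
pose q := fix q j := if j is i.+1 then l (q i).+1 else l 0%N.
have q_last j i : (q j < i)%N -> x i <> x (q j).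
  by case: j => [|j] /=; [have [_ -> h] := lP 0%N|have [_ -> h] := lP (q j).+1]; exact: h.
have qS j : (q j < q j.+1)%N by have [] := lP (q j).+1.
have q_lt : {homo q : i j / (i < j)%N} by apply: homo_ltn qS; exact: ltn_trans.
exists q; split=> [i j /= xij|j|j]; last by have [] := lP (q j).+1.
  have [/q_lt/q_last|/q_lt/q_last|//] := ltngtP i j; first by rewrite xij.
  by rewrite xij.
by elim: j => // j IH; exact: leq_ltn_trans IH (qS j).
Qed.

Section Ends.
Context {G : graph}.
Implicit Types (S B D O U : set (vertex G)) (u v x y : vertex G) (w : gend G) (r : ray G).

Lemma is_componentP S D :
  is_component S D <-> exists2 x, ~ S x & D = component (~` S) x.
Proof. by rewrite /component setCK. Qed.

Lemma ray_equiv_sym r r' : ray_equiv r r' -> ray_equiv r' r.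
Proof. by move=> rr' S /rr'[D [? ? ?]]; exists D. Qed.

Lemma ray_equiv_trans r r' r'' : ray_equiv r r' -> ray_equiv r' r'' -> ray_equiv r r''.
Proof.
move=> rr' r'r'' S finS; have [C [cC Cr Cr']] := rr' _ finS.
have [D [cD Dr' Dr'']] := r'r'' _ finS; have [x Cx Dx] := tail_in_meet Cr' Dr'.
by exists C; split=> //; rewrite (component_eq cC cD Cx Dx).
Qed.

Lemma end_rays_equiv w r r' : end_rays w r -> end_rays w r' -> ray_equiv r r'.
Proof.
have [r0 ->] := end_class w => /= r0r r0r'.
exact: ray_equiv_trans (ray_equiv_sym r0r) r0r'.
Qed.

Lemma end_rays_nonempty w : exists r, end_rays w r.
Proof. by have [r ->] := end_class w; exists r; exact: ray_equiv_refl. Qed.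

Lemma end_rays_closed w r r' : end_rays w r -> ray_equiv r r' -> end_rays w r'.
Proof. by have [r0 ->] := end_class w => /= r0r; exact: ray_equiv_trans. Qed.

Lemma gend_eq w w' r : end_rays w r -> end_rays w' r -> w = w'.
Proof.
move=> wr w'r; have : end_rays w = end_rays w'.
  apply/seteqP; split=> s ws; first exact: end_rays_closed w'r (end_rays_equiv wr ws).
  exact: end_rays_closed wr (end_rays_equiv w'r ws).
case: w w' {wr w'r} => [X cX] [X' cX'] /= XX'; subst X'.
by rewrite (Prop_irrelevance cX cX').
Qed.

Lemma tail_in_ray_equiv O x r r' : finite_set (neighbors (component O x)) ->
  tail_in (component O x) r -> ray_equiv r r' -> tail_in (component O x) r'.
Proof.
move=> finN xr rr'; have [//|off] := tail_in_or_off r' finN.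
have [D [/is_componentP[y ny DE] Dr Dr']] := rr' _ finN; rewrite DE in Dr Dr'.
have [a Da xa] := tail_in_meet Dr xr; have [b Db nxb] := tail_in_meet Dr' off.
exfalso; apply: nxb; left.
suff : component (~` neighbors (component O x)) y `<=` component O x by apply.
apply: component_absorb Da xa _ => c d _ yd xc cd.
by have [//|/(component_subset yd)] := closed_neighbors_adjacent xc cd.
Qed.

Lemma walk_meets_neighbors D x (p : seq (vertex G)) : is_walk x p -> ~ D x ->
  D (last x p) -> exists2 z, z \in x :: p & neighbors D z.
Proof.
elim: p x => [|y p IH] x //= /andP[/asboolP xy walk_p] nDx Dlast.
have [Dy|nDy] := pselect (D y).
  by exists x; [rewrite inE eqxx|split=> //; exists y => //; exact: adjacentC].
by have [z zp Nz] := IH _ walk_p nDy Dlast; exists z => //; rewrite inE zp orbT.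
Qed.

Lemma connected_avoiding_path S x y : connected_avoiding S x y -> exists p,
  [/\ is_path x p, last x p = y & {in p, forall z, ~ S z}].
Proof.
move=> [q [walk_q lastq offS]]; exists (shorten x q).
move: lastq; case/shortenP: walk_q => p walk_p uniq_p sub lastp.
split=> [||z /sub zq]; [by rewrite /is_path /is_walk walk_p|by []|].
by apply: offS; rewrite inE zq orbT.
Qed.

Lemma undominated_separator w r v : end_rays w r -> ~ dominates v w ->
  exists S, [/\ finite_set S, ~ S v &
    exists D, [/\ is_component S D, tail_in D r & ~ D v]].
Proof.
move=> wr ndom; apply: contrapT => nosep; apply: ndom; exists r => //.
have [L|Q infQ [QP disjointQ]] := @infinite_disjoint_seqs _
    (fun p : seq (vertex G) => is_path v p /\ range r (last v p)).
  pose S := [set` L] `\ v; have finS : finite_set S by exact/finite_setD/finite_seq.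
  have nSv : ~ S v by move=> [_ /(_ erefl)].
  have [D cD Dr] := ray_tail_component r finS.
  have Dv : D v by apply: contrapT => nDv; apply: nosep; exists S; split=> //; exists D.
  have [k /(_ k (leqnn k))[Drk nrk]] := tail_inI Dr (ray_avoids_finite r (finite_set1 v)).
  have [x nSx DE] := cD; rewrite DE in Dv Drk.
  have [p [path_p lastp offS]] :=
    connected_avoiding_path (connected_trans (connected_sym Dv) Drk).
  exists p; split; first by split=> //; exists k.
    by apply/eqP => p0; apply: nrk; rewrite -lastp p0.
  move=> z zp; apply/negP => zL; apply: (offS z zp); split=> // zv.
  by have /andP[_ /andP[/negP nvp _]] := path_p; apply: nvp; rewrite -zv.
exists Q => //; split=> // p q Qp Qq pq x; rewrite !inE => /orP[/eqP//|xp] /orP[/eqP//|xq].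
by have := disjointQ _ _ Qp Qq pq x xp; rewrite xq.
Qed.

Lemma undominated_free w r : end_rays w r -> ~ dominated w -> free_ray r.
Proof.
move=> wr ndom U finU.
have /choice[S SP] : forall u, exists S, [/\ finite_set S, ~ S u &
    exists D, [/\ is_component S D, tail_in D r & ~ D u]].
  by move=> u; apply: undominated_separator wr _ => du; apply: ndom; exists u.
pose T := \bigcup_(u in U) S u.
have finT : finite_set T by apply: bigcup_finite => // u _; have [] := SP u.
have [C /is_componentP[x nx CE] Cr] := ray_tail_component r finT.
have NC : neighbors C `<=` T.
  by move=> v; rewrite CE => /neighbors_component /contrapT.
exists C => //; split; first exact: sub_finite_set NC finT.
move=> u Uu uC; have [finS nSu [D [/is_componentP[y ny DE] Dr nDu]]] := SP u.
have CD : C `<=` D.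
  have [a Ca Da] := tail_in_meet Cr Dr; rewrite CE in Ca; rewrite DE in Da.
  rewrite CE DE -(component_same Da); apply: component_subcomponent Ca.
  by move=> z /component_subset nTz Sz; apply: nTz; exists u.
apply: nDu; case: uC => [/CD//|[_ [b /CD Db bu]]].
by rewrite DE in Db *; exact: component_adjacent Db nSu bu.
Qed.

(** Infinitely many disjoint paths cannot pass a finite neighbourhood. *)
Lemma dominates_closed_neighbors D v w : finite_set (neighbors D) ->
  (forall r, end_rays w r -> tail_in D r) -> dominates v w -> closed_neighbors D v.
Proof.
move=> finN tailD [r wr [P infP [P_path P_disjoint]]]; apply: contrapT => /not_orP[nDv nNv].
have [N DN] := tailD r wr.
pose F := neighbors D `|` [set r i | i in `I_N].
have finF : finite_set F by rewrite finite_setU; split=> //; exact: finite_image.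
apply: infP; apply: (@sub_finite_set _ _ ([::] |` (P `\ [::]))).
  by move=> p Pp; have [->|/eqP] := eqVneq p [::]; [left|right].
rewrite finite_setU; split; first exact: finite_set1.
have path_uniq p : P p -> v \notin p by move=> /P_path[/andP[_ /andP[]]].
apply: (disjoint_seqs_finite finF) => [p q [Pp _] [Pq _] pq z zp|p [Pp p0]].
  apply/negP => zq; have := P_disjoint _ _ Pp Pq pq z; rewrite !inE zp zq !orbT.
  by move=> /(_ isT isT) zv; move: (path_uniq _ Pp); rewrite -zv zp.
have [/andP[walk_p _] [i _ ri]] := P_path _ Pp.
have last_p : last v p \in p by case: p p0 {Pp walk_p ri} => //= a p _; exact: mem_last.
have [Ni|iN] := leqP N i; last by exists (last v p) => //; right; exists i.
have [|a] := walk_meets_neighbors walk_p nDv; first by rewrite -ri; exact: DN.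
by rewrite inE => /orP[/eqP ->//|ap Na]; exists a => //; left.
Qed.

End Ends.

Section EndNodes.
Context {G : graph}.
Variable Y : nat -> set (vertex G).
Hypothesis layY : layering Y.
Implicit Types (A B D S : set (vertex G)) (x v : vertex G) (w : gend G) (r : ray G)
  (z : nat -> vertex G).

Local Notation node n x := (component (Y n) x).

Definition end_node n w := end_comp (~` Y n) w.

Lemma end_nodeP n w : ~ dominated w -> exists x, [/\ Y n x, end_node n w = node n x &
  forall r, end_rays w r -> tail_in (node n x) r].
Proof.
move=> nd; have [r wr] := end_rays_nonempty w; have free_r := undominated_free wr nd.
have [m [Ym tail_m]] := tail_in_component (layering_free_ray layY n free_r).
have tail_all r' : end_rays w r' -> tail_in (node n (r m)) r'.
  move=> wr'; apply: tail_in_ray_equiv (end_rays_equiv wr wr') => //.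
  exact: node_neighbors_finite.
exists (r m); split=> //; apply/seteqP; split=> v.
  move=> [C [[x nx CE] Cw Cv]]; have [a Ca ma] := tail_in_meet (Cw _ wr) tail_m.
  by rewrite CE in Ca Cv; rewrite -(component_same ma) (component_same Ca).
by move=> mv; exists (node n (r m)); split=> //; exists (r m) => // /(_ Ym).
Qed.

Lemma end_node_neighbors_finite n w : ~ dominated w -> finite_set (neighbors (end_node n w)).
Proof. by move=> /(end_nodeP n)[x [_ -> _]]; exact: node_neighbors_finite. Qed.

Lemma end_node_layer n w : ~ dominated w -> end_node n w `<=` Y n.
Proof. by move=> /(end_nodeP n)[x [_ -> _]]; exact: component_subset. Qed.

Lemma end_node_nonempty n w : ~ dominated w -> end_node n w !=set0.
Proof.
by move=> /(end_nodeP n)[x [Yx -> _]]; exists x; exact: component_self.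
Qed.

Lemma tail_in_end_node n w r : ~ dominated w -> end_rays w r -> tail_in (end_node n w) r.
Proof. by move=> /(end_nodeP n)[x [_ -> tail_x]] /tail_x. Qed.

Lemma end_node_component n w a : ~ dominated w -> end_node n w a -> end_node n w = node n a.
Proof.
by move=> /(end_nodeP n)[x [_ -> _]] xa; rewrite (component_same xa).
Qed.

Lemma decided_end_node n w : ~ dominated w -> decided Y (end_node n w).
Proof. by move=> /(end_nodeP n)[x [_ -> _]]; exact: decided_node. Qed.

Lemma end_node_neighbors n w : ~ dominated w ->
  end_comp (neighbors (end_node n w)) w = end_node n w.
Proof.
move=> nd; have finN := end_node_neighbors_finite n nd.
have [/is_componentP[y ny E] tailC] := end_compP w finN; rewrite E in tailC *.
have [r wr] := end_rays_nonempty w.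
have [a Ca wa] := tail_in_meet (tailC _ wr) (tail_in_end_node n nd wr).
apply/seteqP; split.
  apply: component_absorb Ca wa _ => b c _ yc wb bc.
  by have [//|/(component_subset yc)] := closed_neighbors_adjacent wb bc.
rewrite (end_node_component nd wa) in Ca *; rewrite -(component_same Ca).
apply: component_subcomponent; last exact/component_self/(end_node_layer nd wa).
by move=> v av [].
Qed.

Lemma end_node_end_comp S w : finite_set S -> ~ dominated w ->
  exists n, end_node n w `<=` end_comp S w.
Proof.
move=> finS nd; have [n offY] := finite_outside_layer layY finS; exists n.
have [/is_componentP[y ny ->] tailC] := end_compP w finS.
have [r wr] := end_rays_nonempty w.
have [a Ca wa] := tail_in_meet (tailC _ wr) (tail_in_end_node n nd wr).
rewrite (end_node_component nd wa) -(component_same Ca).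
apply: component_mono => v Yv Sv; exact: offY Sv Yv.
Qed.

Lemma end_node_of_end_comp n w w' : ~ dominated w -> ~ dominated w' ->
  end_comp (neighbors (end_node n w)) w' = end_comp (neighbors (end_node n w)) w ->
  end_node n w' = end_node n w.
Proof.
move=> nd nd'; rewrite end_node_neighbors // => E.
have [_ tailC] := end_compP w' (end_node_neighbors_finite n nd); rewrite E in tailC.
have [r wr] := end_rays_nonempty w'.
have [a wa w'a] := tail_in_meet (tailC _ wr) (tail_in_end_node n nd' wr).
by rewrite (end_node_component nd wa) (end_node_component nd' w'a).
Qed.

Lemma end_node_inj w w' : ~ dominated w -> ~ dominated w' ->
  (forall n, end_node n w = end_node n w') -> w = w'.
Proof.
move=> nd nd' ww'; have [r wr] := end_rays_nonempty w.
have [r' wr'] := end_rays_nonempty w'.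
apply: (gend_eq (r := r')) => //; apply: (end_rays_closed wr) => S finS.
have [n sub] := end_node_end_comp finS nd.
have [cC tailC] := end_compP w finS; exists (end_comp S w); split=> //; first exact: tailC.
by apply: tail_in_sub sub _; rewrite ww'; exact: tail_in_end_node.
Qed.

Lemma end_branch w : ~ dominated w ->
  exists2 z, branch Y z & forall n, end_node n w = node n (z n).
Proof.
move=> nd; have /choice[z zP] := fun n => end_nodeP n nd.
exists z => [n|n]; last by have [] := zP n.
have [Yn _ tail_n] := zP n; have [Yn1 _ tail_n1] := zP n.+1; split=> //.
have [r wr] := end_rays_nonempty w.
have [a na n1a] := tail_in_meet (tail_n _ wr) (tail_n1 _ wr).
have za := node_subset layY (leqnSn n) n1a.
by rewrite -(component_same na); exact: connected_sym.
Qed.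

Lemma end_node_subset n m w : ~ dominated w -> (n <= m)%N ->
  end_node m w `<=` end_node n w.
Proof.
by move=> /end_branch[z bz zE] nm; rewrite !zE; exact: branch_node_subset.
Qed.

(** A walk through the nodes of the branch visits each vertex only finitely
    often; deleting its loops leaves a ray. *)
Lemma exists_branch_ray z : branch Y z -> exists r, forall n, tail_in (node n (z n)) r.
Proof.
move=> bz; have /choice[s sP] : forall n, exists v, neighbors (node n.+1 (z n.+1)) v.
  move=> n; exact: (layering_neighbors_nonempty layY (bz n.+1).1).
have sD n : node n (z n) (s n).
  rewrite -(component_same (branch_node layY bz (leqnSn n))).
  by apply: node_closed_neighbors => //; right.
have /choice[p pP] : forall n, exists p, [/\ is_walk (s n) p,
    last (s n) p = s n.+1 & {in p, forall v, node n (z n) v}].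
  move=> n; have sSn := branch_node_subset layY bz (leqnSn n) (sD n.+1).
  have [p [walk_p lastp inD]] := component_connected (sD n) sSn.
  exists p; split=> // v vp; apply: contrapT; apply: inD; by rewrite inE vp orbT.
have [n|x [adj_x late_x]] :=
    @infinite_concat (vertex G) (fun u v => `[< adjacent u v >]) s p.
  have [walk_p lastp _] := pP n; split=> //; apply/eqP => p0.
  by have [+ _] := sP n; apply; move: lastp; rewrite p0 /= => ->.
have late n : exists k0, forall k, (k0 <= k)%N -> node n (z n) (x k).
  have [k0 x_p] := late_x n; exists k0 => k /x_p[m nm xm].
  by apply: (branch_node_subset layY bz nm); have [_ _] := pP m; exact.
have [v|q [q_inj q_ge q_next]] := @loop_erasure _ x.
  have [n nY] := layers_vanish layY v; have [k0 x_n] := late n; exists k0 => k xk.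
  rewrite leqNgt; apply/negP => /ltnW/x_n/component_subset.
  by rewrite xk.
have adj_q j : adjacent (x (q j)) (x (q j.+1)) by rewrite q_next; exact/asboolP/adj_x.
exists (Ray q_inj adj_q) => n; have [k0 x_n] := late n; exists k0 => j k0j.
exact/x_n/(leq_trans k0j (q_ge j)).
Qed.

Lemma branch_end z : branch Y z ->
  exists2 w, ~ dominated w & forall n, end_node n w = node n (z n).
Proof.
move=> bz; have [r tail_r] := exists_branch_ray bz.
pose w := @GEnd G [set r' | ray_equiv r r'] (ex_intro _ r erefl).
have tail_w n r' : end_rays w r' -> tail_in (node n (z n)) r'.
  by apply: tail_in_ray_equiv (tail_r n); exact: node_neighbors_finite.
have nd : ~ dominated w.
  move=> [v dom_v]; have [n nY] := layers_vanish layY v.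
  have finN := node_neighbors_finite layY n.+1 (z n.+1).
  have vz := dominates_closed_neighbors finN (tail_w n.+1) dom_v.
  exact: nY (component_subset (node_closed_neighbors layY vz)).
exists w => // n; have wr : end_rays w r by exact: ray_equiv_refl.
have [a wa za] := tail_in_meet (tail_in_end_node n nd wr) (tail_r n).
by rewrite (end_node_component nd wa) (component_same za).
Qed.

End EndNodes.

Local Open Scope ring_scope.

(** * Compactness and continuity *)

Lemma hausdorff_of_separation (R : realType) (T : topologicalType) :
  (forall p q : T, p <> q -> exists2 F : T -> R, continuous F & F p <> F q) ->
  hausdorff_space T.
Proof.
move=> sep p q pq; apply: contrapT => /sep[F cF Fpq].
have e0 : 0 < `|F p - F q| / 2 by rewrite divr_gt0 // normr_gt0 subr_eq0; exact/eqP.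
have near_p : nbhs p [set y | `|F p - F y| < `|F p - F q| / 2].
  by have /cvgrPdist_lt/(_ _ e0) := cF p.
have near_q : nbhs q [set y | `|F q - F y| < `|F p - F q| / 2].
  by have /cvgrPdist_lt/(_ _ e0) := cF q.
have [y [/= yp yq]] := pq _ _ near_p near_q.
have : `|F p - F q| <= `|F p - F y| + `|F q - F y|.
  by rewrite (distrC (F q)); exact: ler_distD.
by lra.
Qed.

Lemma continuous_pair (T U V : topologicalType) (f : T -> U) (g : T -> V) :
  continuous f -> continuous g -> continuous (fun x => (f x, g x)).
Proof.
by move=> cf cg x; apply: (@cvg_pair _ _ _ (nbhs x) (nbhs (f x)) (nbhs (g x)));
  [exact: cf|exact: cg].
Qed.

Lemma compact_set_type (T : topologicalType) (A : set T) :
  compact A -> compact [set: A].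
Proof.
move=> cptA F FF _; have HA : fmap (@set_val _ A) F A.
  rewrite /fmap /=; suff -> : set_val @^-1` A = [set: A] by exact: filterT.
  by apply/seteqP; split=> // -[x xA] _; exact: set_mem xA.
have [p [Ap cluster_p]] := cptA (fmap (@set_val _ A) F) _ HA.
exists (exist _ p (mem_set Ap)); split=> // U V FU [_ [[W oW <-] Wp WV]].
have [_ [[u Uu <-] Wu]] : (set_val @` U) `&` W !=set0.
  apply: cluster_p; last exact: open_nbhs_nbhs.
  have : F (set_val @^-1` (set_val @` U)) by apply: filterS FU => u Uu; exists u.
  exact.
by exists u; split=> //; exact: WV.
Qed.

Lemma continuous_inverse_compact (T U : topologicalType) (f : T -> U) (g : U -> T) :
  compact [set: T] -> hausdorff_space U -> continuous f -> cancel f g -> cancel g f ->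
  continuous g.
Proof.
move=> cptT hausU cf fg gf; apply/continuous_closedP => Z clZ.
have -> : g @^-1` Z = f @` Z.
  by apply/seteqP; split=> [y Zy|_ [x Zx <-]]; [exists (g y)|rewrite /preimage /= fg].
apply: compact_closed => //; apply: continuous_compact.
  exact: continuous_subspaceT.
exact: subclosed_compact clZ cptT _.
Qed.

Lemma compact_finite_cover (T : topologicalType) (K : set T) (U : T -> set T) :
  compact K -> (forall x, K x -> nbhs x (U x)) ->
  exists2 s : seq T, {in s, forall x, K x} & K `<=` \bigcup_(x in [set` s]) U x.
Proof.
move=> cptK nbhsU; apply: contrapT => nocover.
pose rest (s : seq T) := K `\` \bigcup_(x in [set` s]) U x.
pose F : set_system T := [set V | exists2 s : seq T, {in s, forall x, K x} & rest s `<=` V].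
have FF : ProperFilter F.
  split.
    move=> [s sK rest0]; apply: nocover; exists s => // y Ky.
    by apply: contrapT => ny; exact: (rest0 y).
  split; first by exists [::].
  - move=> V W [s sK sV] [s' s'K s'W]; exists (s ++ s').
      by move=> x; rewrite mem_cat => /orP[/sK|/s'K].
    move=> y [Ky ny]; split; [apply: sV|apply: s'W]; split=> // -[x xs Uxy];
      by apply: ny; exists x => //; rewrite /= mem_cat xs ?orbT.
  - by move=> V W VW [s sK sV]; exists s => //; exact: subset_trans VW.
have [|q [Kq cluster_q]] := cptK F FF; first by exists [::] => // y [].
have [y [[_ ny] Uqy]] : rest [:: q] `&` U q !=set0.
  apply: cluster_q; last exact: nbhsU.
  by exists [:: q] => // x; rewrite inE => /eqP ->.
by apply: ny; exists q; rewrite /= ?inE.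
Qed.

(** * The space DTOP *)

Section Points.
Context {R : realType} {G : graph}.
Implicit Types (e f g : edge G) (v : vertex G) (w : gend G) (t s : R) (x y : dtop R G).

Local Notation vtop := (vtop R G).

Lemma vtop_basis_open (U : set vtop) : vtop_basis U -> open U.
Proof. by move=> bU; exists [set U]; [move=> _ ->|rewrite bigcup_set1]. Qed.

Lemma dtop_nbhsP x (U : set (dtop R G)) : nbhs x U <->
  exists2 B : set vtop, vtop_basis B /\ B (val x) & forall y, B (val y) -> U y.
Proof.
split=> [[_ [[W [D DB <-] <-] [B DBB Bx] WU]]|[B [bB Bx] BU]].
  by exists B => [|y By]; [split=> //; exact: DB|apply: WU; exists B].
by exists (set_val @^-1` B); split=> //; exists B => //; exact: vtop_basis_open.
Qed.

Definition vertex_pt v : dtop R G :=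
  exist _ (VPoint v) (mem_set (I : dtop R G (VPoint v))).

Lemma dtop_edge_map e t : dtop R G (edge_map e t).
Proof. by rewrite /edge_map; case: insub. Qed.

Definition edge_pt e t : dtop R G := exist _ (edge_map e t) (mem_set (dtop_edge_map e t)).

Definition end_pt w (nd : ~ dominated w) : dtop R G :=
  exist _ (OPoint w) (mem_set (nd : dtop R G (OPoint w))).

Lemma edge_pt0 e : edge_pt e 0 = vertex_pt (src e).
Proof. by apply: val_inj; rewrite /= edge_map0. Qed.

Lemma edge_pt1 e : edge_pt e 1 = vertex_pt (tgt e).
Proof. by apply: val_inj; rewrite /= edge_map1. Qed.

Lemma val_edge_pt e t (t01 : 0 < t < 1) : val (edge_pt e t) = EPoint e (exist _ t t01).
Proof. by rewrite /= /edge_map insubT. Qed.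

Variant dtop_spec x : Prop :=
  | DtopVertex v of x = vertex_pt v
  | DtopEdge e t of 0 < t < 1 & x = edge_pt e t
  | DtopEnd w (nd : ~ dominated w) of x = end_pt nd.

Lemma dtopP x : dtop_spec x.
Proof.
case: x => -[v|e [t t01]|w] xP; have := set_mem xP => /= dx.
- by apply: (@DtopVertex _ v); apply: val_inj.
- by apply: (@DtopEdge _ e t) => //; apply: val_inj; rewrite val_edge_pt.
- by apply: (@DtopEnd _ w dx); apply: val_inj.
Qed.

Definition inner_edge e : set (dtop R G) := [set edge_pt e t | t in `]0, 1[].

Definition vertex_or_end : set (dtop R G) := [set x | forall e, ~ inner_edge e x].

Lemma inner_edge_pt e t : 0 < t < 1 -> inner_edge e (edge_pt e t).
Proof. by exists t; rewrite //= in_itv. Qed.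

Lemma edge_pt_inj e f t s : 0 < s < 1 -> edge_pt e t = edge_pt f s -> e = f /\ t = s.
Proof.
move=> s01; have [t01|nt01] := boolP (0 < t < 1).
  by move=> /(congr1 val); rewrite !val_edge_pt => -[-> ->].
by move=> /(congr1 val); rewrite (val_edge_pt f s01) /= /edge_map insubF //; exact: negbTE.
Qed.

Lemma edge_pt_vertex_neq e t v : 0 < t < 1 -> edge_pt e t <> vertex_pt v.
Proof. by move=> t01 /(congr1 val); rewrite val_edge_pt. Qed.

Lemma vertex_pt_vertex_or_end v : vertex_or_end (vertex_pt v).
Proof.
by move=> e [t]; rewrite /= in_itv /= => t01; exact: edge_pt_vertex_neq.
Qed.

Lemma end_pt_vertex_or_end w (nd : ~ dominated w) : vertex_or_end (end_pt nd).
Proof.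
by move=> e [t]; rewrite /= in_itv /= => t01 /(congr1 val); rewrite val_edge_pt.
Qed.

Variant vertex_or_end_spec x : Prop :=
  | VertexPoint v of x = vertex_pt v
  | EndPoint w (nd : ~ dominated w) of x = end_pt nd.

Lemma vertex_or_endP x : vertex_or_end x -> vertex_or_end_spec x.
Proof.
by case: (dtopP x) => [v ->|e t t01 -> /(_ e)/(_ (inner_edge_pt e t01))|w nd ->];
  [left with v|by []|right with w nd].
Qed.

Lemma edges_ofP (X : set (dtop R G)) e :
  edges_of X e <-> exists2 t, 0 < t < 1 & X (edge_pt e t).
Proof.
split=> [[x Xx [[t t01] xE]]|[t t01 Xt]].
  by exists t => //; rewrite (_ : edge_pt e t = x) //; apply: val_inj; rewrite xE -val_edge_pt.
by exists (edge_pt e t) => //; exists (exist _ t t01); rewrite val_edge_pt.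
Qed.

Lemma edge_pt_continuous e : {within `[0, 1], continuous (edge_pt e)}.
Proof.
move=> t U /dtop_nbhsP[B [bB Bt] BU]; have [_ /(_ e) oB] := vtop_basis_complex bB.
have : nbhs (t : subspace `[0, 1]%classic) (edge_map e @^-1` (B `&` complex_points)).
  apply: open_nbhs_nbhs; split=> //; split=> //=.
  by rewrite /edge_map; case: insub.
by apply: filterS => s [Bs _]; exact: BU.
Qed.

Lemma edge_compact e : compact (edge_pt e @` `[0, 1]).
Proof.
apply: continuous_compact; [exact: edge_pt_continuous|exact: segment_compact].
Qed.

Lemma dtop_continuous (F : vtop -> R) :
  (forall e, exists2 g : R -> R, continuous g &
     forall t, 0 <= t <= 1 -> F (edge_map e t) = g t) ->
  (forall w eps, ~ dominated w -> 0 < eps -> exists S d, finite_set S /\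
     forall y : dtop R G, end_nbhd S w d (val y) -> `|F (OPoint w) - F (val y)| < eps) ->
  continuous (fun x : dtop R G => F (val x)).
Proof.
move=> F_edge F_end x U /nbhs_ballP[eps /= eps0 epsU]; apply/dtop_nbhsP.
suff [B BP nearB] : exists2 B : set vtop, vtop_basis B /\ B (val x) &
    forall y : dtop R G, B (val y) -> `|F (val x) - F (val y)| < eps.
  by exists B => // y /nearB near_y; apply: epsU; rewrite -ball_normE.
have in_complex : complex_points (val x) -> exists2 B : set vtop, vtop_basis B /\ B (val x) &
    forall y : dtop R G, B (val y) -> `|F (val x) - F (val y)| < eps.
  move=> cx; exists (complex_points `&` [set z | `|F (val x) - F z| < eps]); last by move=> y [].
  split; last by split=> //; rewrite /= subrr normr0.
  left; split=> [w [[]]//|e]; have [g cg gE] := F_edge e.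
  apply/open_subspaceP; exists (g @^-1` ball (F (val x)) eps).
    by apply: open_comp => [t _|]; [exact: cg|exact: ball_open].
  have inc t : complex_points (edge_map (R := R) e t) by rewrite /edge_map; case: insub.
  rewrite -ball_normE; apply/seteqP; split=> t [ht It]; split=> //=;
    have t01 : 0 <= t <= 1 by move: It; rewrite /= in_itv.
    by split; [exact: inc|rewrite gE].
  by case: ht => _; rewrite /= gE.
case: (dtopP x) in_complex => [v ->|e t t01 ->|w nd -> _]; first by apply.
  by apply; rewrite /= /edge_map; case: insub.
have [S [d [finS nearS]]] := F_end w eps nd eps0.
by exists (end_nbhd S w d) => //; split=> //; right; exists S, w, d.
Qed.

Definition half_oint : @oint R :=
  exist (fun t : R => is_true (0 < t < 1)) 2^-1 ltac:(by apply/andP; split; lra).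

Definition edge_fun e (phi : R -> R) (x : dtop R G) : R :=
  if val x is EPoint f t then (if f == e then phi (val t) else phi 0) else phi 0.

Section EdgeFunction.
Variables (e : edge G) (phi : R -> R).

Lemma edge_fun_off x : ~ inner_edge e x -> edge_fun e phi x = phi 0.
Proof.
case: (dtopP x) => [v ->|f t t01 ->|w nd ->] //; rewrite /edge_fun val_edge_pt.
by case: eqP => // -> []; exact: inner_edge_pt.
Qed.

Lemma edge_fun_other f t : f <> e -> edge_fun e phi (edge_pt f t) = phi 0.
Proof.
move=> fe; apply: edge_fun_off => -[s]; rewrite /= in_itv /= => s01 /esym.
by move=> /(edge_pt_inj s01)[].
Qed.

Hypothesis phi01 : phi 1 = phi 0.

Lemma edge_fun_edge t : 0 <= t <= 1 -> edge_fun e phi (edge_pt e t) = phi t.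
Proof.
move=> t01; have It : `[0, 1]%classic t by rewrite /= in_itv.
rewrite /edge_fun /=; have [->|->|[s <- ->]] := edge_mapP e It.
- by rewrite edge_map0.
- by rewrite edge_map1.
- by rewrite eqxx.
Qed.

Lemma edge_fun_continuous : continuous phi -> continuous (edge_fun e phi).
Proof.
move=> cphi; apply: (@dtop_continuous (fun z =>
    if z is EPoint f t then (if f == e then phi (val t) else phi 0) else phi 0)) =>
    [f|w eps nd eps0].
  have [->|fe] := pselect (f = e); last first.
    exists (fun=> phi 0); first by move=> t; exact: cvg_cst.
    by move=> t t01; have := edge_fun_other t fe.
  by exists phi => // t t01; exact: edge_fun_edge.
have finS : finite_set [set src e; tgt e] by exact: finite_set2.
exists [set src e; tgt e], (fun=> half_oint); split=> //.
have [/is_componentP[a na CE] _] := end_compP w finS.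
have offC u : [set src e; tgt e] u -> ~ end_comp [set src e; tgt e] w u.
  by rewrite CE => Su /component_subset.
move=> y; case: (val y) => [v _|f t|w' _] /=; rewrite ?subrr ?normr0 //.
case: eqP => [->|_]; last by rewrite subrr normr0.
have ns := offC (src e) (or_introl erefl); have nt := offC (tgt e) (or_intror erefl).
by case=> -[].
Qed.

End EdgeFunction.

Definition bump e : dtop R G -> R := edge_fun e (fun t => t * (1 - t)).

Lemma bump_continuous e : continuous (bump e).
Proof.
apply: edge_fun_continuous; first by rewrite subrr mulr0 mul0r.
by move=> t; apply: cvgM; [exact: cvg_id|apply: cvgB; [exact: cvg_cst|exact: cvg_id]].
Qed.

Lemma bump_edge e t : 0 <= t <= 1 -> bump e (edge_pt e t) = t * (1 - t).
Proof. by move=> t01; rewrite /bump edge_fun_edge // subrr mulr0 mul0r. Qed.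

Lemma bump_off e x : ~ inner_edge e x -> bump e x = 0.
Proof. by move=> xe; rewrite /bump edge_fun_off // mul0r. Qed.

Lemma bump_gt0 e x : 0 < bump e x <-> inner_edge e x.
Proof.
split=> [|[t]]; last first.
  rewrite /= in_itv /= => /andP[t0 t1] <-.
  by rewrite bump_edge ?(ltW t0) ?(ltW t1) // mulr_gt0 ?subr_gt0.
by move=> b0; apply: contrapT => /bump_off bE; move: b0; rewrite bE ltxx.
Qed.

(** The coordinate along [e]; [0] off [e], where the division is by [0]. *)
Definition edge_coord e (x : dtop R G) : R :=
  edge_fun e (fun t => t * (t * (1 - t))) x / bump e x.

Lemma edge_coord_edge e t : 0 <= t < 1 -> edge_coord e (edge_pt e t) = t.
Proof.
move=> /andP[t0 t1]; have t01 : 0 <= t <= 1 by rewrite t0 ltW.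
rewrite /edge_coord edge_fun_edge ?subrr ?mulr0 ?mul0r // bump_edge //.
have [->|t_neq0] := eqVneq t 0; first by rewrite !mul0r.
by rewrite mulfK // mulf_neq0 // subr_eq0 gt_eqF.
Qed.

Lemma edge_coord_numerator_continuous e :
  continuous (edge_fun e (fun t => t * (t * (1 - t)))).
Proof.
apply: edge_fun_continuous; first by rewrite subrr !mulr0 mul0r.
move=> t; apply: cvgM; first exact: cvg_id.
by apply: cvgM; [exact: cvg_id|apply: cvgB; [exact: cvg_cst|exact: cvg_id]].
Qed.

Lemma edge_coord_continuous e x : inner_edge e x -> {for x, continuous (edge_coord e)}.
Proof.
move=> /bump_gt0 bx; have bx0 : bump e x != 0 by rewrite gt_eqF.
exact: cvgM (@edge_coord_numerator_continuous e x) (cvgV bx0 (@bump_continuous e x)).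
Qed.

Lemma open_inner_edge e : open (inner_edge e).
Proof.
have -> : inner_edge e = bump e @^-1` [set r | 0 < r].
  by apply/seteqP; split=> x /bump_gt0.
by apply: open_comp => [x _|]; [exact: bump_continuous|exact: open_gt].
Qed.

Lemma closed_vertex_or_end : closed vertex_or_end.
Proof.
have -> : vertex_or_end = ~` \bigcup_e inner_edge e.
  by rewrite setC_bigcup; apply/seteqP; split=> x xe e; [move=> _|]; exact: xe.
by apply: open_closedC; apply: bigcup_open => e _; exact: open_inner_edge.
Qed.

End Points.

Section Indicator.
Context {R : realType} {T : Type}.
Implicit Types (A : set T) (x : T).

Lemma indic1 A x : A x -> \1_A x = 1 :> R.
Proof. by move=> Ax; rewrite indicE mem_set. Qed.

Lemma indic0 A x : ~ A x -> \1_A x = 0 :> R.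
Proof. by move=> nAx; rewrite indicE memNset. Qed.

Variant indic_spec A x : R -> Prop :=
  | IndicIn of A x : indic_spec A x 1
  | IndicOut of ~ A x : indic_spec A x 0.

Lemma indicP A x : indic_spec A x (\1_A x).
Proof.
by have [Ax|nAx] := pselect (A x); [rewrite (indic1 Ax)|rewrite (indic0 nAx)]; constructor.
Qed.

End Indicator.

Lemma indic_iff {R : realType} (T U : Type) (A : set T) (B : set U) x y :
  (A x <-> B y) -> \1_A x = \1_B y :> R.
Proof. by case: (indicP A x); case: (indicP B y) => // ? ? ?; exfalso; tauto. Qed.

Section Cuts.
Context {R : realType} {G : graph}.
Variable Y : nat -> set (vertex G).
Hypothesis layY : layering Y.
Implicit Types (A B : set (vertex G)) (e f g : edge G) (v : vertex G) (w : gend G)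
  (t s : R) (x y : dtop R G) (K : set (dtop R G)).

Local Notation vtop := (vtop R G).
Local Notation node n x := (component (Y n) x).
Local Notation decided := (decided Y).

Definition side A : set (gend G) := [set w | exists n, end_node Y n w `<=` A].

Lemma side_sub A B : A `<=` B -> side A `<=` side B.
Proof. by move=> AB w [n wA]; exists n; exact: subset_trans AB. Qed.

Lemma sideI A B w : ~ dominated w -> (side (A `&` B) w <-> side A w /\ side B w).
Proof.
move=> nd; split=> [wAB|[[n wA] [m wB]]].
  by split; apply: side_sub wAB => v [].
exists (maxn n m) => v wv; split.
  by apply/wA/(end_node_subset layY nd (leq_maxl n m)).
by apply/wB/(end_node_subset layY nd (leq_maxr n m)).
Qed.

Lemma sideC A w : decided A -> ~ dominated w -> (side (~` A) w <-> ~ side A w).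
Proof.
move=> dA nd; split=> [sC sA|nA].
  have [n wn] : side (~` A `&` A) w by apply/sideI.
  by have [v /wn[]] := end_node_nonempty layY n nd.
have [z bz zE] := end_branch layY nd; have [n [zA|zA]] := dA _ bz.
  by case: nA; exists n; rewrite zE.
by exists n; rewrite zE.
Qed.

Lemma side_end_node n w : side (end_node Y n w) w. Proof. by exists n. Qed.

Lemma side_set1 v w : ~ dominated w -> ~ side [set v] w.
Proof.
move=> nd; apply/sideC => //; first exact: decided1.
have [n nY] := layers_vanish layY v; exists n => a /(end_node_layer layY nd) Ya /= av.
by apply: nY; rewrite -av.
Qed.

Lemma end_node_separation w w' : ~ dominated w -> ~ dominated w' -> w <> w' ->
  exists n, ~ side (end_node Y n w) w'.
Proof.
move=> nd nd' ww'; apply: contrapT => /forallNP same; apply: ww'.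
apply: (end_node_inj layY) => // n; have /contrapT[m sub] := same n.
have [a wa] := end_node_nonempty layY (maxn n m) nd'.
have w'a := end_node_subset layY nd' (leq_maxl n m) wa.
have {}wa := sub _ (end_node_subset layY nd' (leq_maxr n m) wa).
by rewrite (end_node_component layY nd wa) (end_node_component layY nd' w'a).
Qed.

Definition inside A : set (dtop R G) := [set x | match val x with
  | VPoint v => A v
  | EPoint e _ => A (src e) /\ A (tgt e)
  | OPoint w => side A w
  end].

Lemma inside_edge A e t : 0 < t < 1 -> (inside A (edge_pt e t) <-> A (src e) /\ A (tgt e)).
Proof. by move=> t01; rewrite /inside /mkset (val_edge_pt e t01). Qed.

Lemma inside_sub A B : A `<=` B -> inside A `<=` inside B.
Proof.
move=> AB x; rewrite /inside /mkset; case: (val x) => [v|e t|w]; first exact: AB.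
  by move=> [/AB ? /AB ?].
exact: side_sub.
Qed.

Lemma insideI A B x : inside (A `&` B) x <-> inside A x /\ inside B x.
Proof.
case: (dtopP x) => [v ->|e t t01 ->|w nd ->]; first by [].
  by rewrite !inside_edge // /setI /=; tauto.
exact: sideI.
Qed.

Lemma insideC A x : decided A -> vertex_or_end x -> (inside (~` A) x <-> ~ inside A x).
Proof. by move=> dA /vertex_or_endP[v ->|w nd ->]; [|exact: sideC]. Qed.

Lemma insideU A B x : decided A -> decided B -> vertex_or_end x ->
  (inside (A `|` B) x <-> inside A x \/ inside B x).
Proof.
move=> dA dB vx; rewrite -(setCK (A `|` B)) setCU insideC //; last first.
  by apply: decidedI => //; exact: decidedC.
rewrite insideI !insideC //.
by have [] := pselect (inside A x); have [] := pselect (inside B x); tauto.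
Qed.

Lemma insideY A B x : decided A -> decided B -> vertex_or_end x ->
  (inside (A `+` B) x <-> ~ (inside A x <-> inside B x)).
Proof.
move=> dA dB vx; have dCA := decidedC dA; have dCB := decidedC dB.
rewrite /setY !setDE insideU //; try exact: decidedI.
rewrite !insideI !insideC //.
by have [] := pselect (inside A x); have [] := pselect (inside B x); tauto.
Qed.

Lemma inside_set0 x : ~ inside set0 x.
Proof.
case: (dtopP x) => [v ->|e t t01 ->|w nd -> [n wn]]; [by []|by case/inside_edge|].
by have [v /wn] := end_node_nonempty layY n nd.
Qed.

Definition cut_val A (z : vtop) : R :=
  match z with
  | VPoint v => \1_A v
  | EPoint e t => (1 - val t) * \1_A (src e) + val t * \1_A (tgt e)
  | OPoint w => \1_(side A) w
  end.

Definition cut_fun A x : R := cut_val A (val x).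

Lemma cut_fun_vertex A v : cut_fun A (vertex_pt v) = \1_A v. Proof. by []. Qed.

Lemma cut_fun_edge A e t : 0 <= t <= 1 ->
  cut_fun A (edge_pt e t) = (1 - t) * \1_A (src e) + t * \1_A (tgt e).
Proof.
move=> t01; have It : `[0, 1]%classic t by rewrite /= in_itv.
rewrite /cut_fun /=; have [->|->|[s <- ->]] := edge_mapP e It;
  rewrite ?edge_map0 ?edge_map1 //=.
  by rewrite subr0 mul1r mul0r addr0.
by rewrite subrr mul0r add0r mul1r.
Qed.

Lemma cut_fun_unseparated A e t : ~ separates A e -> 0 <= t <= 1 ->
  cut_fun A (edge_pt e t) = \1_A (src e).
Proof. by move=> /contrapT sA t01; rewrite cut_fun_edge // -(indic_iff sA); ring. Qed.

Lemma cut_fun_inside A x : vertex_or_end x -> cut_fun A x = \1_(inside A) x.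
Proof. by move=> /vertex_or_endP[v ->|w nd ->]; apply: indic_iff. Qed.

Lemma cut_fun_range A x : 0 <= cut_fun A x <= 1.
Proof.
have indic01 T (B : set T) u : 0 <= (\1_B u : R) <= 1.
  by case: indicP => _; rewrite ?lexx ler01.
case: (dtopP x) => [v ->|e t /andP[t0 t1] ->|w nd ->]; try exact: indic01.
rewrite cut_fun_edge; last by rewrite !ltW.
by case: indicP => _; case: indicP => _; apply/andP; split; lra.
Qed.

Lemma end_node_same_side A w : decided A -> ~ dominated w -> exists n,
  (forall v, end_node Y n w v -> (A v <-> side A w)) /\
  forall w', ~ dominated w' -> end_node Y n w' = end_node Y n w -> (side A w' <-> side A w).
Proof.
move=> dA nd; have [sA|/sideC-/(_ dA nd) sCA] := pselect (side A w).
  have [n wn] := sA; exists n; split=> [v /wn //|w' nd' ww'].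
  by split=> // _; exists n; rewrite ww'.
have nsA : ~ side A w by apply/sideC.
have [n wn] := sCA; exists n; split=> [v /wn //|w' nd' ww'].
by split=> // sA; have : side (~` A) w' by [exists n; rewrite ww']; move/(sideC dA nd').
Qed.

Lemma cut_fun_continuous A : decided A -> continuous (cut_fun A).
Proof.
move=> dA; apply: dtop_continuous => [e|w eps nd eps0].
  exists (fun t => (1 - t) * \1_A (src e) + t * \1_A (tgt e)); last first.
    by move=> t t01; rewrite -cut_fun_edge.
  move=> t; apply: cvgD; apply: cvgM; try exact: cvg_cst; last exact: cvg_id.
  by apply: cvgB; [exact: cvg_cst|exact: cvg_id].
have d01 : 0 < eps / (1 + eps) < 1.
  by rewrite divr_gt0 ?addr_gt0 //= ltr_pdivrMr ?addr_gt0 // mul1r ltrDr.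
have d_eps : eps / (1 + eps) < eps.
  by rewrite ltr_pdivrMr ?addr_gt0 // mulrDr mulr1 ltrDl mulr_gt0.
have [n [sameV sameE]] := end_node_same_side dA nd.
have {}sameV v : end_node Y n w v -> \1_A v = \1_(side A) w :> R.
  by move=> /sameV; exact: indic_iff.
exists (neighbors (end_node Y n w)), (fun=> exist (fun t : R => is_true (0 < t < 1)) _ d01).
split=> [|y]; first exact: end_node_neighbors_finite.
have near_end (t : R) (a : vertex G) : 0 <= t -> t < eps / (1 + eps) ->
    `|\1_(side A) w - ((1 - t) * \1_(side A) w + t * \1_A a)| < eps.
  move=> t0 /lt_trans/(_ d_eps); apply: le_lt_trans.
  by case: indicP => _; case: indicP => _; rewrite ler_norml; apply/andP; split; lra.
rewrite /end_nbhd end_node_neighbors //; case yE : (val y) => [v|e t|w'] /=.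
- by move=> /sameV ->; rewrite subrr normr0.
- have /andP[t0 t1] := valP t.
  case=> [[/sameV -> /sameV ->]|[/sameV -> _]|[_ /sameV ->]].
  + by rewrite -mulrDl subrK mul1r subrr normr0.
  + by apply: near_end; exact: ltW.
  + have t1' : 0 <= 1 - val t by rewrite subr_ge0 ltW.
    by move=> /(near_end _ (src e) t1'); rewrite subKr [val t * _ + _]addrC.
- have nd' : ~ dominated w' by have := set_mem (valP y); rewrite yE.
  move=> E; have ww' : end_node Y n w' = end_node Y n w.
    by apply: end_node_of_end_comp => //; rewrite E end_node_neighbors.
  by rewrite (indic_iff (sameE _ nd' ww')) subrr normr0.
Qed.

Lemma end_pt_nbhs w (nd : ~ dominated w) (U : set (dtop R G)) : nbhs (end_pt nd) U ->
  exists n, inside (end_node Y n w) `<=` U.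
Proof.
move=> /dtop_nbhsP[B [bB Bw] BU].
case: bB => [[/(_ w)/(_ Bw)//]|[S [w0 [eps [finS BE]]]]]; subst B.
have CE : end_comp S w = end_comp S w0 by exact: Bw.
have [n sub] := end_node_end_comp layY finS nd; rewrite CE in sub.
exists n => x /(inside_sub sub) xC; apply: BU; rewrite /end_nbhd /mkset.
case: (dtopP x) xC => [v ->|g t t01 ->|w' nd' ->]; first by [].
  by rewrite inside_edge // val_edge_pt; constructor 1.
move=> [m w'C] /=; have [c0 _] := end_compP w0 finS; have [c' tailC] := end_compP w' finS.
have [r wr] := end_rays_nonempty w'.
have [a ca w'a] := tail_in_meet (tailC _ wr) (tail_in_end_node layY m nd' wr).
exact: component_eq c' c0 ca (w'C _ w'a).
Qed.

Lemma vertex_or_end_separation x y : vertex_or_end x -> vertex_or_end y -> x <> y ->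
  exists A, [/\ decided A, inside A x & ~ inside A y].
Proof.
move=> /vertex_or_endP[v ->|w nd ->] /vertex_or_endP[v' ->|w' nd' ->] xy.
- exists [set v]; split; [exact: decided1|by []|move=> v'v; apply: xy].
  by rewrite (v'v : v' = v).
- by exists [set v]; split; [exact: decided1|by []|exact: side_set1].
- have dv' := decided1 layY v'; exists (~` [set v']); split; first exact: decidedC.
    by apply/sideC => //; exact: side_set1.
  by move=> /(_ erefl).
- have [|n nw'] := end_node_separation nd nd'.
    by move=> ww'; subst w'; apply: xy; congr end_pt; exact: Prop_irrelevance.
  exists (end_node Y n w); split=> //; [exact: decided_end_node|exact: side_end_node].
Qed.

Lemma dtop_separation x y : x <> y ->
  exists2 F : dtop R G -> R, continuous F & F x <> F y.
Proof.
move=> xy; apply: contrapT => none; apply: xy.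
have agree (F : dtop R G -> R) : continuous F -> F x = F y.
  by move=> cF; apply: contrapT => Fxy; apply: none; exists F.
have bump_agree e : bump e x = bump e y by exact/agree/bump_continuous.
have inner_agree e : inner_edge e x <-> inner_edge e y by rewrite -!bump_gt0 bump_agree.
have [[e xe]|nx] := pselect (exists e, inner_edge e x).
  have ye : inner_edge e y by apply/inner_agree.
  have : edge_coord e x = edge_coord e y.
    by rewrite /edge_coord bump_agree (agree _ (@edge_coord_numerator_continuous _ _ e)).
  case: xe ye => t; rewrite /= in_itv /= => t01 <- [s]; rewrite /= in_itv /= => s01 <-.
  have /andP[t0 t1] := t01; have /andP[s0 s1] := s01.
  by rewrite !edge_coord_edge ?(ltW t0) ?(ltW s0) // => ->.
have vx : vertex_or_end x by move=> e xe; apply: nx; exists e.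
have vy : vertex_or_end y by move=> e /inner_agree xe; apply: nx; exists e.
apply: contrapT => /(vertex_or_end_separation vx vy)[A [dA Ax nAy]].
have := agree _ (cut_fun_continuous dA); rewrite !cut_fun_inside // indic1 // indic0 //.
by apply/eqP; rewrite oner_eq0.
Qed.

Lemma dtop_hausdorff : hausdorff_space (dtop R G).
Proof. exact: hausdorff_of_separation dtop_separation. Qed.

Lemma compact_decided_cover (P : set (set (vertex G))) K : compact K -> K `<=` vertex_or_end ->
  P set0 -> (forall A B, P A -> P B -> P (A `|` B)) ->
  (forall x, K x -> exists A, [/\ decided A, P A & inside A x]) ->
  exists A, [/\ decided A, P A & K `<=` inside A].
Proof.
move=> cptK vK P0 PU cover.
have /choice[A AP] : forall x, exists A, K x -> [/\ decided A, P A & inside A x].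
  move=> x; have [/cover[A ?]|nK] := pselect (K x); first by exists A.
  by exists set0.
have [x Kx|s sK Ks] := compact_finite_cover (U := fun x => [set y | 0 < cut_fun (A x) y]) cptK.
  have [dA _ Ax] := AP x Kx; have cA := cut_fun_continuous dA.
  apply: open_nbhs_nbhs; split.
    apply: (@open_comp _ _ (cut_fun (A x)) [set r | 0 < r]) => [y _|]; first exact: cA.
    exact: open_gt.
  by rewrite /mkset cut_fun_inside ?indic1 //; exact: vK.
have good (s' : seq (dtop R G)) : {subset s' <= s} ->
    decided (\bigcup_(x in [set` s']) A x) /\ P (\bigcup_(x in [set` s']) A x).
  move=> s's; rewrite bigcup_seq big_seq.
  elim/big_ind: _ => [|B B' [dB PB] [dB' PB']|x /s's/sK/AP[]//].
    by split=> //; exact: decided_finite.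
  by split; [exact: decidedU|exact: PU].
have [dU PU'] := good s (fun=> id); exists (\bigcup_(x in [set` s]) A x); split=> //.
move=> y Ky; have [x xs] := Ks y Ky; rewrite /mkset cut_fun_inside; last exact: vK.
case: indicP; rewrite ?ltxx // => Axy _.
by apply: inside_sub Axy => v Av; exists x.
Qed.

Lemma compact_separation K1 K2 : compact K1 -> compact K2 ->
  K1 `<=` vertex_or_end -> K2 `<=` vertex_or_end -> K1 `&` K2 = set0 ->
  exists A, [/\ decided A, K1 `<=` inside A & K2 `<=` ~` inside A].
Proof.
move=> cptK1 cptK2 vK1 vK2 K12.
have [|B B'|x K1x|A [dA [_ AK2] K1A]] := @compact_decided_cover
    [set A | decided A /\ K2 `<=` ~` inside A] K1 cptK1 vK1; last by exists A.
- by split; [exact: decided_finite|move=> y _; exact: inside_set0].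
- move=> [dB BK2] [dB' B'K2]; split; first exact: decidedU.
  by move=> y K2y /(insideU dB dB' (vK2 _ K2y))[/BK2|/B'K2]; apply.
have [|A B|y K2y|A [dA [_ nAx] K2A]] := @compact_decided_cover
    [set A | decided A /\ ~ inside A x] K2 cptK2 vK2.
- by split; [exact: decided_finite|exact: inside_set0].
- move=> [dA nAx] [dB nBx]; split; first exact: decidedU.
  by move=> /(insideU dA dB (vK1 _ K1x))[].
- have [|A [dA Ay nAx]] := vertex_or_end_separation (vK2 _ K2y) (vK1 _ K1x).
    by move=> yx; have : (K1 `&` K2) x by [split=> //; rewrite -yx]; rewrite K12.
  by exists A.
have dCA := decidedC dA; exists (~` A); split=> //; last by apply/insideC => //; exact: vK1.
by split=> // y K2y /(insideC dA (vK2 _ K2y)); apply; exact: K2A.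
Qed.

End Cuts.

(** * Closed curves *)

Section UnitCircle.
Context {R : realType}.
Implicit Types (s t u v : R) (p : unit_circle R).

Definition circle_pt t : R * R := (cos (2 * pi * t), sin (2 * pi * t)).

Lemma circle_pt_unit_circle t : unit_circle R (circle_pt t).
Proof. exact: cos2Dsin2. Qed.

Definition circle t : unit_circle R := exist _ (circle_pt t) (mem_set (circle_pt_unit_circle t)).

Lemma circle_pt_continuous : continuous circle_pt.
Proof.
have cmul : continuous (fun t : R => 2 * pi * t).
  by move=> t; apply: cvgM; [exact: cvg_cst|exact: cvg_id].
apply: continuous_pair => t.
- exact: continuous_comp (cmul t) (@continuous_cos R _).
- exact: continuous_comp (cmul t) (@continuous_sin R _).
Qed.

Lemma circle_pt_inj s t : `|t - s| < 1 -> circle_pt s = circle_pt t -> s = t.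
Proof.
wlog st : s t / s <= t.
  by move=> wl; have [st|/ltW ts] := leP s t; [exact: wl|rewrite distrC => ? /esym/wl ->].
rewrite ger0_norm ?subr_ge0 // => st1 [Ecos Esin]; move: st; rewrite le_eqVlt.
move=> /orP[/eqP//|lt_st]; exfalso.
have : cos ((pi * (t - s)) *+ 2) = 1.
  have -> : (pi * (t - s)) *+ 2 = 2 * pi * t - 2 * pi * s by ring.
  by rewrite cosB Ecos Esin -!expr2 cos2Dsin2.
have sin_pos : 0 < sin (pi * (t - s)).
  have pi0 := pi_gt0 R; apply: sin_gt0_pi; rewrite mulr_gt0 ?subr_gt0 //=.
  by rewrite gtr_pMr.
have := cos2Dsin2 (pi * (t - s)); rewrite cos_mulr2n.
by move: sin_pos; set c := cos _; set d := sin _; nra.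
Qed.

Lemma circle_pt_opp t : circle_pt (1 - t) = ((circle_pt t).1, - (circle_pt t).2).
Proof.
rewrite /circle_pt /= (_ : 2 * pi * (1 - t) = - (2 * pi * t) + pi *+ 2); last by ring.
by rewrite cosD2pi sinD2pi cosN sinN.
Qed.

Lemma circle_pt_surj u v : u ^+ 2 + v ^+ 2 = 1 ->
  exists2 t, 0 <= t < 1 & circle_pt t = (u, v).
Proof.
move=> uv; have pi0 := pi_gt0 R; have u1 : -1 <= u <= 1 by apply/andP; split; nra.
have cosE : cos (acos u) = u by rewrite acosK // in_itv.
have sinE : sin (acos u) = `|v|.
  by rewrite sin_acos // -sqrtr_sqr; congr Num.sqrt; rewrite -uv; ring.
pose t := acos u / (2 * pi); have tE : 2 * pi * t = acos u.
  by rewrite /t mulrC divfK // mulf_neq0 ?gt_eqF.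
have t0 : 0 <= t by rewrite divr_ge0 ?acos_ge0 // mulr_ge0 ?(ltW pi0).
have t2 : t <= 2^-1.
  by rewrite /t ler_pdivrMr ?mulr_gt0 // mulrA mulVf ?mul1r ?acos_lepi ?pnatr_eq0.
have [v0|v0] := leP 0 v.
  exists t; first by apply/andP; split; lra.
  by rewrite /circle_pt tE cosE sinE ger0_norm.
exists (1 - t); last by rewrite circle_pt_opp /circle_pt /= tE cosE sinE ltr0_norm // opprK.
have t_pos : 0 < t.
  by rewrite divr_gt0 ?mulr_gt0 // acos_gt0 //; case/andP: u1 => -> _ /=; nra.
by apply/andP; split; lra.
Qed.

Lemma circle_inj s t : `|t - s| < 1 -> circle s = circle t -> s = t.
Proof. by move=> st /(congr1 val); exact: circle_pt_inj. Qed.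

Lemma circle_surj p : exists2 t, 0 <= t < 1 & circle t = p.
Proof.
have /circle_pt_surj[t t01 tE] : (val p).1 ^+ 2 + (val p).2 ^+ 2 = 1.
  exact: set_mem (valP p).
by exists t => //; apply: val_inj; rewrite /= tE -surjective_pairing.
Qed.

Lemma circle_continuous : continuous circle.
Proof. by apply: continuous_comp_initial; exact: circle_pt_continuous. Qed.

Lemma circleD1 t : circle (t + 1) = circle t.
Proof.
apply: val_inj; rewrite /= /circle_pt (_ : 2 * pi * (t + 1) = 2 * pi * t + pi *+ 2); last by ring.
by rewrite cosD2pi sinD2pi.
Qed.

Lemma unit_circle_hausdorff : hausdorff_space (unit_circle R).
Proof.
have cval : continuous (fun p => val p : R * R) by exact: initial_continuous.
apply: (@hausdorff_of_separation R) => p q pq.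
have [fstE|/eqP fstE] := eqVneq (val p).1 (val q).1; last first.
  exists (fun p => (val p).1) => // r.
  exact: (continuous_comp (cval r) cvg_fst).
exists (fun p => (val p).2) => [r|sndE].
  exact: (continuous_comp (cval r) cvg_snd).
apply: pq; apply: val_inj; case: (val p) (val q) fstE sndE => [a b] [a' b'] /= -> ->.
by [].
Qed.

End UnitCircle.

Section ClosedCurves.
Context {R : realType} {T : topologicalType}.
Implicit Types (X Z : set T) (gamma : R -> T) (s t a b c : R).

Record closed_curve X gamma : Prop := ClosedCurve {
  closed_curve_continuous : continuous gamma;
  closed_curve_in : forall t, X (gamma t);
  closed_curve_period : forall t, gamma (t + 1) = gamma t;
  closed_curve_inj : forall s t, `|t - s| < 1 -> gamma s = gamma t -> s = t;
  closed_curve_surj : forall x, X x -> exists2 t, 0 <= t < 1 & gamma t = x }.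

Lemma topological_cycle_curve X x : topological_cycle R X -> X x ->
  exists2 gamma, closed_curve X gamma & gamma 0 = x.
Proof.
move=> [f [g [fK gK cf cg]]] Xx; pose F p : T := set_val (f p).
have cF : continuous F.
  by move=> p; apply: continuous_comp; [exact: cf|exact: initial_continuous].
have F_inj : injective F by move=> p q /val_inj E; rewrite -(fK p) E fK.
have F_surj y : X y -> exists2 s : R, 0 <= s < 1 & F (circle s) = y.
  move=> Xy; have [s s01 sE] := circle_surj (g (exist _ y (mem_set Xy))).
  by exists s => //; rewrite sE /F gK.
have [a /andP[a0 a1] <-] := F_surj _ Xx; exists (fun t => F (circle (a + t)));
  last by rewrite addr0.
split=> [t|t|t|s t st /F_inj/circle_inj E|y /F_surj[s /andP[s0 s1] <-]].
- apply: continuous_comp; last exact: cF.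
  apply: continuous_comp; last exact: circle_continuous.
  by apply: cvgD; [exact: cvg_cst|exact: cvg_id].
- exact: set_mem (valP (f _)).
- by rewrite addrA circleD1.
- by apply: (addrI a); apply: E; rewrite opprD addrACA subrr add0r.
- have [as_|sa] := leP a s.
    by exists (s - a); [apply/andP; split; lra|rewrite addrC subrK].
  exists (s - a + 1); first by apply/andP; split; lra.
  by rewrite addrA circleD1 addrC subrK.
Qed.

Section Curve.
Variables (X : set T) (gamma : R -> T).
Hypothesis curve : closed_curve X gamma.

Lemma closed_curve_image : X = gamma @` `[0, 1].
Proof.
apply/seteqP; split=> [x /(closed_curve_surj curve)[t /andP[t0 t1] <-]|_ [t _ <-]].
  by exists t; rewrite //= in_itv /= t0 ltW.
exact: (closed_curve_in curve).
Qed.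

Lemma closed_curve_arc_compact a b : compact (gamma @` `[a, b]).
Proof.
have cg := closed_curve_continuous curve.
by apply: continuous_compact; [exact: continuous_subspaceT|exact: segment_compact].
Qed.

Lemma closed_curve_arc_connected a b : connected (gamma @` `[a, b]).
Proof.
have cg := closed_curve_continuous curve.
by apply: connected_continuous_connected; [exact: segment_connected|exact: continuous_subspaceT].
Qed.

Lemma closed_curve_closed : hausdorff_space T -> closed X.
Proof.
move=> hausT; rewrite closed_curve_image; apply: compact_closed => //.
exact: closed_curve_arc_compact.
Qed.

Lemma closed_curve_arcs_meet c x : 0 < c < 1 -> (gamma @` `[0, c]) x -> (gamma @` `[c, 1]) x ->
  x = gamma 0 \/ x = gamma c.
Proof.
move=> /andP[c0 c1] [s s0c <-] [t tc1].
move: s0c tc1; rewrite /= !in_itv /= => /andP[s0 sc] /andP[ct t1].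
have [->|/eqP nst] := eqVneq s 0; first by left.
have s_gt0 : 0 < s by rewrite lt_def s0 andbT; apply/eqP.
move=> /esym/(closed_curve_inj curve) st; right; congr gamma; apply/le_anti; rewrite sc /=.
by rewrite st // ger0_norm; lra.
Qed.

Lemma closed_curve_crossing (F : T -> R) v x y : continuous F -> X x -> X y ->
  x <> gamma 0 -> y <> gamma 0 -> F x <= v <= F y ->
  exists z, [/\ X z, z <> gamma 0 & F z = v].
Proof.
move=> cF Xx Xy xn yn vxy; have cFg : continuous (F \o gamma).
  by move=> t; apply: continuous_comp; [exact: (closed_curve_continuous curve)|exact: cF].
have off0 z : X z -> z <> gamma 0 -> exists2 t, 0 < t < 1 & gamma t = z.
  move=> /(closed_curve_surj curve)[t /andP[t0 t1] <-] tn; exists t => //.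
  by rewrite t1 andbT lt_def t0 andbT; apply: contra_notN tn => /eqP ->.
have [a /andP[a0 a1] aE] := off0 _ Xx xn; have [b /andP[b0 b1] bE] := off0 _ Xy yn.
have [t /andP[t0 t1] tE] : exists2 t, 0 < t < 1 & F (gamma t) = v.
  move: vxy; rewrite -aE -bE => /andP[av vb]; have [ab|/ltW ba] := leP a b.
    have [||t] := @IVT R (F \o gamma) a b v ab; first exact: continuous_subspaceT.
      by rewrite ge_min le_max /= av vb orbT.
    rewrite in_itv /= => /andP[at_ tb] tE; exists t => //.
    by rewrite (lt_le_trans a0 at_) (le_lt_trans tb b1).
  have [||t] := @IVT R (F \o gamma) b a v ba; first exact: continuous_subspaceT.
    by rewrite ge_min le_max /= av vb orbT.
  rewrite in_itv /= => /andP[bt ta] tE; exists t => //.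
  by rewrite (lt_le_trans b0 bt) (le_lt_trans ta a1).
exists (gamma t); split=> //; first exact: (closed_curve_in curve).
move=> /(closed_curve_inj curve) t_eq0; move: (t0); rewrite t_eq0 ?ltxx //.
by rewrite sub0r normrN gtr0_norm.
Qed.

End Curve.

End ClosedCurves.

Lemma connected_closed_cover (T : topologicalType) (C K1 K2 : set T) : connected C ->
  closed K1 -> closed K2 -> C `<=` K1 `|` K2 -> (forall x, C x -> K1 x -> ~ K2 x) ->
  C `<=` K1 \/ C `<=` K2.
Proof.
move=> conC clK1 clK2 cover disj.
suff sep : separated (C `&` K1) (C `&` K2).
  have CC : C `<=` (C `&` K1) `|` (C `&` K2).
    by move=> x Cx; case: (cover x Cx) => Kx; [left|right].
  by have [CK|CK] := connected_subset sep CC conC; [left|right]; move=> x /CK[].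
have closure_sub K : closed K -> closure (C `&` K) `<=` K.
  by move=> /closure_id {2}->; apply: closure_subset => x [].
split; rewrite -subset0 => x; first by move=> [/(closure_sub _ clK1) K1x [/disj]]; apply.
by move=> [[Cx /(disj _ Cx) nK2x] /(closure_sub _ clK2)].
Qed.

Lemma inj_continuous_image_nbhs (R : realType) (f : R -> R) a b c :
  a < c < b -> {within `[a, b], continuous f} -> {in `[a, b] &, injective f} ->
  nbhs (f c) (f @` `[a, b]).
Proof.
move=> /andP[ac cb] cf injf; have ab := lt_trans ac cb.
have sub : [set v | Num.min (f a) (f b) <= v <= Num.max (f a) (f b)] `<=` f @` `[a, b].
  by move=> v /(IVT (ltW ab) cf)[t tab tE]; exists t.
have Ia : a \in `[a, b] by rewrite in_itv /= lexx ltW.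
have Ib : b \in `[a, b] by rewrite in_itv /= lexx ltW.
have Ic : c \in `[a, b] by rewrite in_itv /= !ltW.
have : f c \in `]Num.min (f a) (f b), Num.max (f a) (f b)[.
  rewrite in_itv /= gt_min lt_max.
  case: (itv_continuous_inj_mono cf injf) => mono.
    by rewrite (mono _ _ Ia Ic ac) (mono _ _ Ic Ib cb) orbT.
  by rewrite (mono _ _ Ic Ia ac) (mono _ _ Ib Ic cb) orbT.
move=> /near_in_itvoo; apply: filterS => v; rewrite in_itv /= => /andP[lo hi].
by apply: sub; rewrite /= !ltW.
Qed.

(** * Topological cycles are cut-cyclic *)

Section Cycles.
Context {R : realType} {G : graph}.
Variable Y : nat -> set (vertex G).
Hypothesis layY : layering Y.
Implicit Types (X : set (dtop R G)) (A : set (vertex G)) (e f g : edge G) (x y z : dtop R G)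
  (gamma : R -> dtop R G) (t s : R).

Local Notation decided := (decided Y).
Local Notation hausdorff := (@dtop_hausdorff R G Y layY).

Definition midpoint e : dtop R G := edge_pt e 2^-1.

Lemma edge_pt_midpoint e t f : edge_pt e t = midpoint f -> e = f.
Proof.
have half01 : 0 < (2^-1 : R) < 1 by apply/andP; split; lra.
by move=> /(edge_pt_inj half01)[].
Qed.

Lemma midpoint_inj : injective midpoint.
Proof. by move=> e f /edge_pt_midpoint. Qed.

Lemma inner_edge_midpoint e : inner_edge e (midpoint e).
Proof. by apply: inner_edge_pt; apply/andP; split; lra. Qed.

Lemma vertex_or_end_midpoint_neq x e : vertex_or_end x -> x <> midpoint e.
Proof. by move=> vx xE; apply: (vx e); rewrite xE; exact: inner_edge_midpoint. Qed.

Lemma inner_edge_eq e f x : inner_edge e x -> inner_edge f x -> e = f.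
Proof.
by move=> [t _ <-] [s]; rewrite /= in_itv /= => s01 /esym/(edge_pt_inj s01)[].
Qed.

Lemma curve_edge_interior X gamma e t : closed_curve X gamma -> 0 < t < 1 ->
  X (edge_pt e t) -> \forall s \near t, X (edge_pt e s).
Proof.
move=> curve t01 /(closed_curve_surj curve)[c _ cE]; have cg := closed_curve_continuous curve.
have : nbhs c (gamma @^-1` inner_edge e).
  apply: cg; rewrite cE; apply: open_nbhs_nbhs; split; first exact: open_inner_edge.
  exact: inner_edge_pt.
move=> /nbhs_ballP[d /= d0]; rewrite ball_itv => d_inner.
pose r := Num.min (d / 2) 4^-1; have r0 : 0 < r by rewrite lt_min; apply/andP; split; lra.
have r_le : r <= 4^-1 by rewrite ge_min lexx orbT.
have r_lt : r < d by rewrite gt_min; apply/orP; left; lra.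
have near_inner s : s \in `[c - r, c + r] -> inner_edge e (gamma s).
  rewrite in_itv /= => /andP[s1 s2]; apply: d_inner; rewrite /= in_itv /=.
  by apply/andP; split; lra.
pose p := edge_coord e \o gamma; have pE s : s \in `[c - r, c + r] -> edge_pt e (p s) = gamma s.
  move=> /near_inner[u]; rewrite /= in_itv /= /p /= => /andP[u0 u1] <-.
  by rewrite edge_coord_edge ?(ltW u0).
have <- : p c = t by have /andP[t0 t1] := t01; rewrite /p /= cE edge_coord_edge ?(ltW t0).
have : nbhs (p c) (p @` `[c - r, c + r]).
  apply: inj_continuous_image_nbhs; first by apply/andP; split; lra.
    apply: continuous_in_subspaceT => s; rewrite inE => /near_inner inner_s.
    by apply: continuous_comp; [exact: cg|exact: edge_coord_continuous].
  move=> s s' Is Is' pss'; apply: (closed_curve_inj curve); last by rewrite -!pE // pss'.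
  move: Is Is'; rewrite !in_itv /= => /andP[? ?] /andP[? ?].
  by rewrite ltr_norml; apply/andP; split; lra.
by apply: filterS => _ [s Is <-]; rewrite pE //; exact: (closed_curve_in curve).
Qed.

Lemma curve_whole_edge X gamma e t : closed_curve X gamma -> edges_of X e -> 0 <= t <= 1 ->
  X (edge_pt e t).
Proof.
move=> curve /edges_ofP[s s01 Xs] t01.
have clX : closed X := closed_curve_closed curve hausdorff.
have [V clV VE] : exists2 V : set R, closed V & V `&` `[0, 1] = edge_pt e @^-1` X `&` `[0, 1].
  apply/closed_subspaceP; move: (@edge_pt_continuous R G e) => /continuous_closedP; exact.
have VX (u : R) : 0 <= u <= 1 -> (V u <-> X (edge_pt e u)).
  move=> u01; have Iu : `[0, 1]%classic u by rewrite /= in_itv.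
  split=> h; first by have : (V `&` `[0, 1]) u by []; rewrite VE => -[].
  by have : (edge_pt e @^-1` X `&` `[0, 1]) u by []; rewrite -VE => -[].
have oo_cc (u : R) : `]0, 1[%classic u -> 0 <= u <= 1.
  by rewrite /= in_itv /= => /andP[? ?]; rewrite !ltW.
have ooV : `]0, 1[%classic `<=` V.
  have con : connected (`]0, 1[%classic : set R).
    by apply/connected_intervalP; exact: interval_is_interval.
  suff <- : `]0, 1[%classic `&` V = `]0, 1[%classic by move=> u [].
  apply: con.
  - by exists s; split; rewrite /= ?in_itv //; apply/VX => //; apply: oo_cc; rewrite /= in_itv.
  - exists [set u | X (edge_pt e u)]^°; first exact: open_interior.
    apply/seteqP; split=> u [Iu Xu]; have VXu := VX _ (oo_cc _ Iu); split=> //.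
      by apply: (curve_edge_interior curve); [move: Iu; rewrite /= in_itv|exact/VXu].
    by apply/VXu; exact: interior_subset Xu.
  - by exists V.
have V0 : V 0.
  apply: (@closed_cvg _ _ (0 : R)^'+ _ id V) => //; last first.
    by apply: cvg_at_right_filter; exact: cvg_id.
  by near=> r; apply: ooV; rewrite /= in_itv /=; apply/andP; split.
have V1 : V 1.
  apply: (@closed_cvg _ _ (1 : R)^'- _ id V) => //; last first.
    by apply: cvg_at_left_filter; exact: cvg_id.
  by near=> r; apply: ooV; rewrite /= in_itv /=; apply/andP; split.
apply/VX => //; move: t01; rewrite !le_eqVlt => /andP[/orP[/eqP <- //|t0] /orP[/eqP -> //|t1]].
by apply: ooV; rewrite /= in_itv /= t0.
Unshelve. all: by end_near.
Qed.

Lemma cut_fun_half A z : cut_fun Y A z = 2^-1 ->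
  exists2 e, separates A e & z = midpoint e.
Proof.
have half_neq0 : 2^-1 != 0 :> R by rewrite invr_eq0 pnatr_eq0.
have half_neq1 : 2^-1 != 1 :> R by apply/eqP; lra.
case: (dtopP z) => [v|e t t01|w nd] ->.
- by rewrite cut_fun_vertex; case: indicP => _ /esym/eqP;
    rewrite ?(negPf half_neq0) ?(negPf half_neq1).
- have /andP[t0 t1] := t01; rewrite cut_fun_edge; last by rewrite !ltW.
  move=> half; have sep : separates A e.
    apply: contrapT => /contrapT same; move: half.
    by rewrite -(indic_iff same); case: indicP => _ ?; lra.
  exists e => //; rewrite /midpoint; congr edge_pt; move: half.
  by rewrite /separates in sep; case: indicP; case: indicP => ? ?; try tauto; lra.
- rewrite cut_fun_inside; last exact: end_pt_vertex_or_end.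
  by case: indicP => _ /esym/eqP; rewrite ?(negPf half_neq0) ?(negPf half_neq1).
Qed.

Lemma connected_meets_vertex_or_end (K : set (dtop R G)) e x y : connected K -> K x -> K y ->
  inner_edge e x -> ~ inner_edge e y -> exists2 z, K z & vertex_or_end z.
Proof.
move=> conK Kx Ky xe ye; apply: contrapT => none; apply: ye.
have inner z : K z -> exists g, inner_edge g z.
  by move=> Kz; apply: contrapT => /forallNP vz; apply: none; exists z.
suff KE : K `&` inner_edge e = K by move: Ky; rewrite -{1}KE => -[].
apply: conK.
- by exists x.
- by exists (inner_edge e) => //; exact: open_inner_edge.
- exists (~` \bigcup_(g in [set g | g <> e]) inner_edge g).
    by apply: open_closedC; apply: bigcup_open => g _; exact: open_inner_edge.
  apply/seteqP; split=> z [Kz]; last first.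
    move=> notother; split=> //; have [g zg] := inner z Kz.
    have [<-//|ge] := pselect (g = e); by case: notother; exists g.
  by move=> ze; split=> // -[g /= ge zg]; apply: ge; exact: inner_edge_eq zg ze.
Qed.

Lemma not_separates_closed_cover (L M : set (dtop R G)) A g : closed L -> closed M ->
  L `&` vertex_or_end `<=` inside Y A -> M `&` vertex_or_end `<=` ~` inside Y A ->
  (forall t, 0 <= t <= 1 -> (L `|` M) (edge_pt g t)) ->
  (forall t, 0 <= t <= 1 -> L (edge_pt g t) -> ~ M (edge_pt g t)) -> ~ separates A g.
Proof.
move=> clL clM LA MA cover disj.
have Icc (t : R) : `[0, 1]%classic t -> 0 <= t <= 1 by rewrite /= in_itv.
have edge_in : edge_pt g @` `[0, 1] `<=` L \/ edge_pt g @` `[0, 1] `<=` M.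
  apply: connected_closed_cover => //.
  - by apply: connected_continuous_connected; [exact: segment_connected|exact: edge_pt_continuous].
  - by move=> _ [t /Icc t01 <-]; exact: cover.
  - by move=> _ [t /Icc t01 <-]; exact: disj.
have vv v := @vertex_pt_vertex_or_end R G v.
have I0 : `[0, 1]%classic (0 : R) by rewrite /= in_itv /= lexx ler01.
have I1 : `[0, 1]%classic (1 : R) by rewrite /= in_itv /= lexx ler01.
rewrite /separates => sep; apply: sep.
case: edge_in => sub; have := sub _ (imageP _ I0); have := sub _ (imageP _ I1);
  rewrite edge_pt0 edge_pt1 => t_in s_in.
- by split=> _; [exact: (LA _ (conj t_in (vv _)))|exact: (LA _ (conj s_in (vv _)))].
- by split=> v_in; [case: (MA _ (conj s_in (vv _)))|case: (MA _ (conj t_in (vv _)))].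
Qed.

Section Cycle.
Variable X : set (dtop R G).
Hypothesis cycX : topological_cycle R X.

Lemma cycle_cut_crossing A x0 x y : decided A -> X x0 -> X x -> X y -> x <> x0 -> y <> x0 ->
  vertex_or_end x -> vertex_or_end y -> inside Y A x -> ~ inside Y A y ->
  exists e, [/\ edges_of X e, midpoint e <> x0 & separates A e].
Proof.
move=> dA /(topological_cycle_curve cycX)[gamma curve <-] Xx Xy xn yn vx vy Ax nAy.
have [|z [Xz zn /cut_fun_half[e sep zE]]] := closed_curve_crossing curve (v := 2^-1)
  (@cut_fun_continuous R G Y layY A dA) Xy Xx yn xn.
  by rewrite !cut_fun_inside // indic0 // indic1 //; apply/andP; split; lra.
exists e; split=> //; last by rewrite -zE.
by apply/edges_ofP; exists 2^-1; [apply/andP; split; lra|have := Xz; rewrite zE].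
Qed.

Lemma cycle_nonempty : edges_of X !=set0.
Proof.
have [x Xx] : X !=set0.
  have [f _] := cycX; have one_in : unit_circle R (1, 0).
    by rewrite /unit_circle /mkset /= expr1n expr0n addr0.
  by exists (set_val (f (exist _ (1, 0) (mem_set one_in)))); exact: set_mem (valP (f _)).
have [gamma curve _] := topological_cycle_curve cycX Xx; apply: contrapT => noedge.
have vX y : X y -> vertex_or_end y.
  move=> Xy e [t]; rewrite /= in_itv /= => t01 tE.
  by apply: noedge; exists e; apply/edges_ofP; exists t => //; rewrite tE.
have Xg := closed_curve_in curve.
have neq s t : `|t - s| < 1 -> s <> t -> gamma s <> gamma t.
  by move=> st nst /(closed_curve_inj curve st).
have neq20 : gamma 2^-1 <> gamma 0 by apply: neq; [rewrite ltr_norml; apply/andP; split; lra|lra].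
have neq40 : gamma 4^-1 <> gamma 0 by apply: neq; [rewrite ltr_norml; apply/andP; split; lra|lra].
have neq24 : gamma 2^-1 <> gamma 4^-1.
  by apply: neq; [rewrite ltr_norml; apply/andP; split; lra|lra].
have [A [dA A2 nA4]] := vertex_or_end_separation layY (vX _ (Xg _)) (vX _ (Xg _)) neq24.
have [e [Xe _ _]] := cycle_cut_crossing dA (Xg 0) (Xg _) (Xg _) neq20 neq40
  (vX _ (Xg _)) (vX _ (Xg _)) A2 nA4.
by apply: noedge; exists e.
Qed.

Lemma cycle_edge e t : edges_of X e -> 0 <= t <= 1 -> X (edge_pt e t).
Proof.
move=> Xe; have [s _ Xs] := (edges_ofP X e).1 Xe.
by have [gamma curve _] := topological_cycle_curve cycX Xs; exact: curve_whole_edge curve Xe.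
Qed.

Lemma cycle_src e : edges_of X e -> X (vertex_pt (src e)).
Proof. by move=> Xe; rewrite -edge_pt0; apply: cycle_edge; rewrite // lexx ler01. Qed.

Lemma cycle_tgt e : edges_of X e -> X (vertex_pt (tgt e)).
Proof. by move=> Xe; rewrite -edge_pt1; apply: cycle_edge; rewrite // lexx ler01. Qed.

Lemma cycle_midpoint e : edges_of X e -> X (midpoint e).
Proof. by move=> Xe; apply: cycle_edge => //; apply/andP; split; lra. Qed.

Lemma cycle_other A e : decided A -> edges_of X e -> separates A e ->
  exists f, [/\ edges_of X f, f <> e & separates A f].
Proof.
move=> dA Xe; have neq v : vertex_pt v <> midpoint e.
  exact/vertex_or_end_midpoint_neq/vertex_pt_vertex_or_end.
have vv v := @vertex_pt_vertex_or_end R G v.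
suff cross u v : X (vertex_pt u) -> X (vertex_pt v) -> A u -> ~ A v ->
    exists f, [/\ edges_of X f, f <> e & separates A f].
  have [Xs Xt] := (cycle_src Xe, cycle_tgt Xe).
  rewrite {1}/separates; have [As|nAs] := pselect (A (src e));
    have [At|nAt] := pselect (A (tgt e)).
  - by case; split.
  - by move=> _; exact: (cross (src e) (tgt e)).
  - by move=> _; exact: (cross (tgt e) (src e)).
  - by case; split.
move=> Xu Xv Au nAv; have [f [Xf fn sf]] := cycle_cut_crossing dA (cycle_midpoint Xe) Xu Xv
  (neq u) (neq v) (vv u) (vv v) Au nAv.
by exists f; split=> // fe; apply: fn; rewrite fe.
Qed.

Lemma cycle_arcs e f : edges_of X e -> edges_of X f -> e <> f -> exists L M,
  [/\ compact L /\ connected L, compact M /\ connected M, L `|` M = X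
    & L `&` M = [set midpoint e; midpoint f]].
Proof.
move=> Xe Xf ef; have [gamma curve g0] := topological_cycle_curve cycX (cycle_midpoint Xe).
have [c /andP[c0 c1] gc] := closed_curve_surj curve (cycle_midpoint Xf).
have c_gt0 : 0 < c.
  rewrite lt_def c0 andbT; apply/eqP => c_eq0; apply: ef.
  by apply: midpoint_inj; rewrite -g0 -gc c_eq0.
have g1 : gamma 1 = midpoint e by rewrite -g0 -(closed_curve_period curve 0) add0r.
have arc a b : compact (gamma @` `[a, b]) /\ connected (gamma @` `[a, b]).
  by split; [exact: (closed_curve_arc_compact curve)|exact: (closed_curve_arc_connected curve)].
exists (gamma @` `[0, c]), (gamma @` `[c, 1]); split=> //.
  apply/seteqP; split=> [x [] [t _ <-]|x]; try exact: (closed_curve_in curve).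
  move=> /(closed_curve_surj curve)[t /andP[t0 t1] <-].
  by have [tc|/ltW ct] := leP t c; [left|right]; exists t; rewrite //= in_itv /= ?t0 ?ct //= ltW.
apply/seteqP; split=> [x [Lx Mx]|x [->|->]].
- by rewrite -g0 -gc; apply: (closed_curve_arcs_meet curve) Lx Mx; rewrite c_gt0.
- by split; [exists 0|exists 1]; rewrite //= in_itv /= lexx // ltW.
- by split; exists c; rewrite //= in_itv /= lexx ?c0 // ltW.
Qed.

Lemma cycle_pair e f : edges_of X e -> edges_of X f -> e <> f -> exists2 A, decided A &
  forall g, edges_of X g -> (separates A g <-> g = e \/ g = f).
Proof.
move=> Xe Xf ef; have [L [M [[cptL conL] [cptM conM] LM meet]]] := cycle_arcs Xe Xf ef.
have clL : closed L := compact_closed hausdorff cptL.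
have clM : closed M := compact_closed hausdorff cptM.
have clV : closed (@vertex_or_end R G) := @closed_vertex_or_end R G.
have [|||A [dA LA MA]] := compact_separation layY (compact_closedI cptL clV)
  (compact_closedI cptM clV); try by move=> x [].
  rewrite -subset0 => x [[Lx vx] [Mx _]]; have : (L `&` M) x by [].
  by rewrite meet => -[]; exact: (vertex_or_end_midpoint_neq vx).
have others g : edges_of X g -> separates A g -> g = e \/ g = f.
  move=> Xg sg; apply: contrapT => /not_orP[ge gf]; move: sg.
  apply: (not_separates_closed_cover clL clM LA MA) => t t01.
    by rewrite LM; exact: cycle_edge.
  by move=> Lt Mt; have : (L `&` M) (edge_pt g t) by []; rewrite meet => -[] /edge_pt_midpoint.
have nfe : ~ inner_edge e (midpoint f) by move=> /inner_edge_eq/(_ (inner_edge_midpoint f)).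
have [[Le Me] [Lf Mf]] : (L `&` M) (midpoint e) /\ (L `&` M) (midpoint f).
  by rewrite meet; split; [left|right].
have [x Lx vx] := connected_meets_vertex_or_end conL Le Lf (inner_edge_midpoint e) nfe.
have [y My vy] := connected_meets_vertex_or_end conM Me Mf (inner_edge_midpoint e) nfe.
have [Xx Xy] : X x /\ X y by rewrite -LM; split; [left|right].
have [g [Xg _ sg]] := cycle_cut_crossing dA (cycle_midpoint Xe) Xx Xy
  (vertex_or_end_midpoint_neq vx) (vertex_or_end_midpoint_neq vy) vx vy
  (LA _ (conj Lx vx)) (MA _ (conj My vy)).
have [h [Xh hg sh]] := cycle_other dA Xg sg.
have [sep_e sep_f] : separates A e /\ separates A f.
  by case: (others g Xg sg) (others h Xh sh) => gE [] hE; subst.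
by exists A => // k Xk; split=> [|[->|->]]; first exact: others.
Qed.

Lemma topological_cycle_cut_cyclic : cut_cyclic Y (edges_of X).
Proof. by split; [exact: cycle_nonempty|exact: cycle_other|exact: cycle_pair]. Qed.

End Cycle.

End Cycles.

(** * Weighted sums and circle coordinates *)

Section WeightedSum.
Context {R : realType} {T : topologicalType}.
Variable a : nat -> T -> R.
Hypothesis a_continuous : forall k, continuous (a k).
Hypothesis a_range : forall k x, 0 <= a k x <= 1.
Implicit Types (x y : T) (n k : nat).

Let weight k : R := 2^-1 ^+ k.+1.
Let weighted x : R ^nat := fun k => weight k * a k x.

Definition weighted_sum x : R := limn (series (weighted x)).

Let weight_gt0 k : 0 < weight k. Proof. by rewrite exprn_gt0 // invr_gt0. Qed.

Let weighted_range x k : 0 <= weighted x k <= weight k.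
Proof.
have /andP[a0 a1] := a_range k x.
by rewrite mulr_ge0 ?(ltW (weight_gt0 k)) // ger_pMr.
Qed.

Lemma weighted_series_cvg x : cvgn (series (weighted x)).
Proof.
apply: (@series_le_cvg _ _ weight) => [k|k|k|].
- by have /andP[] := weighted_range x k.
- exact: ltW.
- by have /andP[] := weighted_range x k.
rewrite (_ : weight = geometric 2^-1 2^-1).
  by apply: is_cvg_geometric_series; rewrite ger0_norm ?invr_ge0 //; lra.
by apply/funext => k; rewrite /weight exprS.
Qed.

Lemma weighted_sum_ge_partial x n : series (weighted x) n <= weighted_sum x.
Proof.
apply: nondecreasing_cvgn_le; last exact: weighted_series_cvg.
by apply: nondecreasing_series => k _ _; have /andP[] := weighted_range x k.
Qed.

Lemma weighted_sum_le_partial x n : weighted_sum x <= series (weighted x) n + 2^-1 ^+ n.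
Proof.
pose u n : R := series (weighted x) n + 2^-1 ^+ n.
have cvg_u : u @ \oo --> weighted_sum x.
  rewrite -[weighted_sum x]addr0; apply: cvgD; first exact: weighted_series_cvg.
  by apply: cvg_expr; rewrite ger0_norm ?invr_ge0 //; lra.
have <- : limn u = weighted_sum x by exact: cvg_lim.
apply: (@nonincreasing_cvgn_ge _ u) => //; last by apply/cvg_ex; exists (weighted_sum x).
apply/nonincreasing_seqP => m; rewrite /u seriesSr; have /andP[_] := weighted_range x m.
by rewrite /weight exprS; lra.
Qed.

Lemma weighted_sum_continuous : continuous weighted_sum.
Proof.
have partial_continuous n : continuous (fun x => series (weighted x) n).
  apply: continuous_big => [p|k _ x]; first exact: add_continuous.
  by apply: cvgM; [exact: cvg_cst|exact: a_continuous].
move=> x; apply/cvgrPdist_lt => eps eps0; have eps2 : 0 < eps / 2 by lra.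
have [n n_eps] : exists n, 2^-1 ^+ n < eps / 2.
  have [n _ /(_ n (leqnn n)) /= n_eps] := near_infty_natSinv_expn_lt (PosNum eps2).
  by exists n; rewrite exprVn -div1r.
have /cvgrPdist_lt/(_ _ eps2) := @partial_continuous n x; apply: filterS => y.
have := weighted_sum_ge_partial x n; have := weighted_sum_ge_partial y n.
have := weighted_sum_le_partial x n; have := weighted_sum_le_partial y n.
by rewrite !ltr_norml => *; apply/andP; split; lra.
Qed.

Lemma weighted_sum_ge0 x : 0 <= weighted_sum x.
Proof. by have := weighted_sum_ge_partial x 0; rewrite /series /= big_geq. Qed.

Lemma weighted_sum_le x y : (forall k, a k x <= a k y) -> weighted_sum x <= weighted_sum y.
Proof.
move=> axy; apply: lim_series_le; try exact: weighted_series_cvg.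
by move=> k; rewrite ler_pM2l.
Qed.

Lemma weighted_sum_lt x y k : (forall j, a j x <= a j y) -> a k x < a k y ->
  weighted_sum x < weighted_sum y.
Proof.
move=> axy axyk; rewrite -subr_gt0 -lim_seriesB; try exact: weighted_series_cvg.
have diff_ge0 j : 0 <= (weighted y - weighted x) j by rewrite /GRing.add /= subr_ge0 ler_pM2l.
apply: (@lt_le_trans _ _ (series (weighted y - weighted x) k.+1)).
  rewrite seriesSr ltr_wpDl ?sumr_ge0 // /GRing.add /= subr_gt0 ltr_pM2l //.
apply: nondecreasing_cvgn_le; first by apply: nondecreasing_series => j _ _; exact: diff_ge0.
by apply: is_cvg_seriesB; exact: weighted_series_cvg.
Qed.

Lemma weighted_sum1 x : (forall k, a k x = 1) -> weighted_sum x = 1.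
Proof.
move=> ax1; have half1 : `|2^-1 : R| < 1 by rewrite ger0_norm ?invr_ge0 //; lra.
rewrite /weighted_sum (_ : weighted x = geometric 2^-1 2^-1); last first.
  by apply/funext => k; rewrite /weighted /weight ax1 mulr1 exprS.
by rewrite (cvg_lim _ (@cvg_geometric_series R 2^-1 2^-1 half1)) //; field.
Qed.

Lemma weighted_sum_scale x y t : (forall k, a k y = t * a k x) ->
  weighted_sum y = t * weighted_sum x.
Proof.
move=> ayx; have -> : weighted_sum y = limn (series (t *: weighted x)).
  congr (limn (series _)); apply/funext => k; rewrite /weighted ayx.
  by rewrite mulrCA.
by rewrite lim_seriesZ //; exact: weighted_series_cvg.
Qed.

End WeightedSum.

Lemma topological_cycle_angle (R : realType) (T : topologicalType) (X : set T)
    (F : T -> R * R) (theta : T -> R) : compact X -> continuous F ->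
  (forall x, X x -> 0 <= theta x < 1 /\ F x = circle_pt (theta x)) ->
  (forall x y, X x -> X y -> theta x = theta y -> x = y) ->
  (forall t, 0 <= t < 1 -> exists2 x, X x & theta x = t) ->
  topological_cycle R X.
Proof.
move=> cptX cF FX theta_inj theta_surj.
have XP (x : X) : X (val x) by exact: set_mem (valP x).
have FP (x : X) : unit_circle R (F (val x)).
  by have [_ ->] := FX _ (XP x); exact: circle_pt_unit_circle.
pose f (x : X) : unit_circle R := exist (fun z => z \in unit_circle R) _ (mem_set (FP x)).
have fE x : f x = circle (theta (val x)).
  by apply: val_inj => /=; have [_ ->] := FX _ (XP x).
have cf : continuous f.
  apply: continuous_comp_initial => x.
  exact: (continuous_comp (@initial_continuous _ _ (@set_val _ X) x) (cF (set_val x))).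
have f_inj : injective f.
  move=> x y; rewrite !fE => E; apply: val_inj; apply: theta_inj; try exact: XP.
  have [/andP[x0 x1] _] := FX _ (XP x); have [/andP[y0 y1] _] := FX _ (XP y).
  by apply: circle_inj E; rewrite ltr_norml; apply/andP; split; lra.
have /choice[g fK] : forall p : unit_circle R, exists x : X, f x = p.
  move=> p; have [t /theta_surj[x Xx <-] <-] := circle_surj p.
  by exists (exist _ x (mem_set Xx)); rewrite fE.
have gK : cancel f g by move=> x; apply: f_inj; rewrite fK.
exists g, f; split=> //.
apply: (continuous_inverse_compact _ _ cf) => //; first exact: compact_set_type.
exact: unit_circle_hausdorff.
Qed.

Lemma ultra_bigcup (T : Type) (I : choiceType) (F : set_system T) (D : set I) (A : I -> set T) :
  UltraFilter F -> finite_set D -> F (\bigcup_(i in D) A i) -> exists2 i, D i & F (A i).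
Proof.
move=> ultraF finD FA; apply: contrapT => none.
have : F (\bigcap_(i in [set` fset_set D]) ~` A i).
  apply: filter_bigI => i; rewrite in_fset_set // inE => Di.
  by have [FAi|//] := in_ultra_setVsetC (A i) ultraF; case: none; exists i.
rewrite fset_setK // => FCA; have [x [[i Di Ax] CAx]] := filter_ex (filterI FA FCA).
exact: CAx Di Ax.
Qed.

(** * Cut-cyclic sets are topological cycles *)

Section CyclePoints.
Context {R : realType} {G : graph}.
Variable Y : nat -> set (vertex G).
Hypothesis layY : layering Y.
Variable C : set (edge G).
Hypothesis cutC : cut_cyclic Y C.
Implicit Types (A B Z : set (vertex G)) (e f g h : edge G) (v z : vertex G) (w : gend G)
  (t s : R) (x y : dtop R G).

Local Notation node n x := (component (Y n) x).
Local Notation decided := (decided Y).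
Local Notation inside := (inside Y).

Definition cycle_points : set (dtop R G) := [set x | match val x with
  | VPoint v => exists2 g, C g & v = src g \/ v = tgt g
  | EPoint g _ => C g
  | OPoint w => forall n, exists2 g, C g & touching (end_node Y n w) g
  end].

Lemma cycle_points_inner_edge g t : 0 < t < 1 -> (cycle_points (edge_pt g t) <-> C g).
Proof. by move=> t01; rewrite /cycle_points /mkset (val_edge_pt g t01). Qed.

Lemma cycle_points_edge g t : C g -> 0 <= t <= 1 -> cycle_points (edge_pt g t).
Proof.
move=> Cg; rewrite !le_eqVlt => /andP[/orP[/eqP <- _|t0 /orP[/eqP ->|t1]]].
- by rewrite edge_pt0; exists g => //; left.
- by rewrite edge_pt1; exists g => //; right.
- by apply/cycle_points_inner_edge; rewrite ?t0.
Qed.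

Lemma edges_of_cycle_points : edges_of cycle_points = C.
Proof.
apply/seteqP; split=> g; first by move=> /edges_ofP[t t01 /cycle_points_inner_edge]; exact.
move=> Cg; apply/edges_ofP; have half01 : 0 < (2^-1 : R) < 1 by apply/andP; split; lra.
by exists 2^-1 => //; apply/cycle_points_inner_edge.
Qed.

Variant cycle_points_spec x : Prop :=
  | CycleEdge g t of C g & 0 <= t <= 1 & x = edge_pt g t
  | CycleEnd w (nd : ~ dominated w) of
      (forall n, exists2 g, C g & touching (end_node Y n w) g) & x = end_pt nd.

Lemma cycle_pointsP x : cycle_points x -> cycle_points_spec x.
Proof.
case: (dtopP x) => [v ->|g t t01 ->|w nd ->].
- move=> [g Cg [->|->]]; [left with g 0 => //|left with g 1 => //];
    by rewrite ?edge_pt0 ?edge_pt1 // lexx ler01.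
- move=> /(cycle_points_inner_edge _ t01) Cg; left with g t => //.
  by have /andP[? ?] := t01; rewrite !ltW.
- by move=> Xw; right with w nd.
Qed.

Lemma inside_segment A g t : A (src g) -> A (tgt g) -> 0 <= t <= 1 -> inside A (edge_pt g t).
Proof.
move=> As At; rewrite !le_eqVlt => /andP[/orP[/eqP <- _|t0 /orP[/eqP ->|t1]]].
- by rewrite edge_pt0.
- by rewrite edge_pt1.
- by apply/inside_edge; rewrite ?t0.
Qed.

Lemma inside_nonempty A x : inside A x -> A !=set0.
Proof.
move=> Ax; apply/set0P/eqP => A0; have := @inside_set0 R G Y layY x; rewrite -A0; exact.
Qed.

Lemma cycle_points_touching A x : cycle_points x -> inside A x -> exists2 g, C g & touching A g.
Proof.
case: (dtopP x) => [v ->|g t t01 ->|w nd ->].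
- by move=> [g Cg [->|->]] Av; exists g => //; [left|right].
- move=> /(cycle_points_inner_edge _ t01) Cg /(inside_edge Y A g t01)[As _].
  by exists g => //; left.
- by move=> Xw [n wA]; have [g Cg wg] := Xw n; exists g => //; exact: touching_sub wA _ wg.
Qed.

Lemma end_node_touching_avoid w (P : set (edge G)) : ~ dominated w -> finite_set P ->
  exists n, forall g, P g -> ~ touching (end_node Y n w) g.
Proof.
move=> nd finP; apply: finite_set_uniform => // [n m g nm ng wg|g _].
  by apply: ng; exact: touching_sub (end_node_subset layY nd nm) _ wg.
have [n [ns nt]] := edge_outside_layer layY g; exists n.
by have [z [_ -> _]] := end_nodeP layY n nd; exact: layer_not_touching.
Qed.

Lemma cycle_points_cover n : exists2 KK : set (set (dtop R G)), finite_set KK &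
  (forall K, KK K -> (exists2 g, C g & K = edge_pt g @` `[0, 1]) \/
    exists z, K = inside (node n z)) /\ cycle_points `<=` \bigcup_(K in KK) K.
Proof.
have [es [S [fin_es finS thinC]]] := cut_cyclic_thin layY n.+1 cutC.
exists ([set edge_pt g @` `[0, 1] | g in es `&` C] `|` [set inside (node n z) | z in S]).
  by rewrite finite_setU; split; apply: finite_image => //; exact: finite_setIl.
split=> [K [[g [_ Cg] <-]|[z _ <-]]|x]; [by left; exists g|by right; exists z|].
case/cycle_pointsP => [g t Cg t01|w nd touch_w] ->.
  have [es_g|[z Sz zg]] := thinC _ Cg.
    exists (edge_pt g @` `[0, 1]); first by left; exists g.
    by exists t; rewrite //= in_itv.
  exists (inside (node n z)); first by right; exists z.
  have [/(node_closed_neighbors layY) zs /(node_closed_neighbors layY) zt] :=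
    touching_closed_neighbors zg.
  exact: inside_segment.
have [m avoid] := end_node_touching_avoid nd fin_es.
have [g Cg touch_g] := touch_w (maxn m n.+1).
have touch_le k : (k <= maxn m n.+1)%N -> touching (end_node Y k w) g.
  by move=> k_le; exact: touching_sub (end_node_subset layY nd k_le) _ touch_g.
have [/avoid/(_ (touch_le _ (leq_maxl _ _)))//|[z Sz zg]] := thinC _ Cg.
exists (inside (node n z)); first by right; exists z.
exists n.+1; have := touch_le _ (leq_maxr m n.+1).
have [a [_ -> _]] := end_nodeP layY n.+1 nd => /(touching_component_same zg) <-.
exact: node_subset.
Qed.

Lemma cycle_points_compact : compact cycle_points.
Proof.
rewrite compact_ultra => F ultraF FX.
have [[g Cg Fg]|no_edge] := pselect (exists2 g, C g & F (edge_pt g @` `[0, 1])).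
  have := @edge_compact R G g; rewrite compact_ultra => /(_ F ultraF Fg)[_ [[t It <-] cvgF]].
  by exists (edge_pt g t); split=> //; apply: cycle_points_edge; rewrite // in_itv in It.
have /choice[z Fz] : forall n, exists z, F (inside (node n z)).
  move=> n; have [KK finKK [KKP cover]] := cycle_points_cover n.
  have [K /KKP[[g Cg ->] Fg|[z ->] Fz]] := ultra_bigcup ultraF finKK (filterS cover FX).
    by case: no_edge; exists g.
  by exists z.
have bz : branch Y z.
  move=> n; have [x [xn xSn]] := filter_ex (filterI (Fz n) (Fz n.+1)).
  have [a [an aSn]] : (node n (z n) `&` node n.+1 (z n.+1)) !=set0.
    by apply: (@inside_nonempty _ x); apply/insideI.
  split; first exact: component_root an.
  by rewrite -(component_same an); apply: connected_sym; exact: node_subset (leqnSn n) _ aSn.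
have [w nd wE] := branch_end layY bz; exists (end_pt nd); split=> [n|U].
  have [x [xn Xx]] := filter_ex (filterI (Fz n) FX).
  by rewrite wE; exact: cycle_points_touching Xx xn.
move=> /(end_pt_nbhs layY)[n sub]; apply: filterS sub _; rewrite wE; exact: Fz.
Qed.

Lemma cut_cyclic_countable : countable C.
Proof.
have /choice[es esP] : forall n, exists es : set (edge G), finite_set es /\
    forall g, C g -> ~ Y n (src g) -> ~ Y n (tgt g) -> es g.
  move=> n; have [es [S [fin_es _ thinC]]] := cut_cyclic_thin layY n cutC.
  exists es; split=> // g /thinC[//|[z _ zg]] ns nt.
  by case: (layer_not_touching ns nt zg).
apply: (@sub_countable _ _ _ (\bigcup_n es n)); last first.
  by apply: bigcup_countable => // n _; apply: finite_set_countable; exact: (esP n).1.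
apply: subset_card_le => g Cg; have [n [ns nt]] := edge_outside_layer layY g.
by exists n => //; exact: (esP n).2.
Qed.

Lemma unseparated_const Z e f : decided Z -> (forall g, C g -> ~ separates Z g) ->
  C e -> C f -> Z (src e) -> Z (src f).
Proof.
move=> dZ unsep Ce Cf Ze; apply: contrapT => nZf.
have ef : e <> f by move=> ef; apply: nZf; rewrite -ef.
have [A dA sepA] := cut_cyclic_pair cutC Ce Cf ef.
have sepZA g : C g -> separates (Z `&` A) g <-> Z (src g) /\ separates A g.
  move=> /unsep; rewrite /separates /setI /=.
  by have [] := pselect (Z (src g)); have [] := pselect (Z (tgt g)); tauto.
have [|g [Cg ge]] := cut_cyclic_other cutC (decidedI layY dZ dA) Ce.
  by apply/sepZA => //; split=> //; apply/sepA => //; left.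
by move=> /(sepZA _ Cg)[Zg /(sepA _ Cg)[//|gf]]; apply: nZf; rewrite -gf.
Qed.

Lemma cycle_points_separation Z x y : decided Z -> cycle_points x -> cycle_points y ->
  vertex_or_end y -> inside Z x -> ~ inside Z y -> exists2 g, C g & separates Z g.
Proof.
move=> dZ Xx Xy vy Zx nZy; apply: contrapT => none.
have unsep g : C g -> ~ separates Z g by move=> Cg sg; apply: none; exists g.
have [e Ce touch_e] := cycle_points_touching Xx Zx.
have [f Cf touch_f] : exists2 f, C f & touching (~` Z) f.
  by apply: cycle_points_touching Xy _; apply/insideC.
have := unseparated_const dZ unsep Ce Cf; have := unsep _ Ce; have := unsep _ Cf.
by move: touch_e touch_f; rewrite /touching /separates /setC /=; tauto.
Qed.

End CyclePoints.

Section CutOrder.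
Context {R : realType} {G : graph}.
Variable Y : nat -> set (vertex G).
Hypothesis layY : layering Y.
Variable C : set (edge G).
Hypothesis cutC : cut_cyclic Y C.
Variable e : edge G.
Hypothesis Ce : C e.
Implicit Types (A B Z : set (vertex G)) (f g h k : edge G) (v : vertex G) (w : gend G)
  (t s : R) (x y : dtop R G).

Local Notation decided := (decided Y).
Local Notation inside := (inside Y).
Local Notation D := (C `\ e).
Local Notation X := (@cycle_points R G Y C).

Definition edge_cut g : set (vertex G) := xget set0 [set A |
  [/\ decided A, ~ A (src e), A (tgt e) & forall h, C h -> (separates A h <-> h = e \/ h = g)]].

Lemma edge_cutP g : D g -> [/\ decided (edge_cut g), ~ edge_cut g (src e), edge_cut g (tgt e) &
  forall h, C h -> (separates (edge_cut g) h <-> h = e \/ h = g)].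
Proof.
move=> [Cg ge]; apply: (@xgetPex _ set0 [set A | [/\ decided A, ~ A (src e), A (tgt e) & _]]).
have [A dA sepA] := cut_cyclic_pair cutC Ce Cg (nesym ge).
have sAe : separates A e by apply/sepA => //; left.
have [As|nAs] := pselect (A (src e)); last first.
  by exists A; split=> //; apply: contrapT => nAt; apply: sAe.
exists (~` A); split=> [||At|h Ch]; [exact: decidedC|by move=> /(_ As)|by apply: sAe|].
by rewrite separatesC; exact: sepA.
Qed.

Lemma edge_cut_separates g h : D g -> D h -> (separates (edge_cut g) h <-> h = g).
Proof. by move=> /edge_cutP[_ _ _ sepg] [/sepg -> he]; split=> [[]|]; [|by []|right]. Qed.

Definition height g : dtop R G -> R := cut_fun Y (edge_cut g).

Lemma height_continuous g : D g -> continuous (height g).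
Proof. by move=> /edge_cutP[dA _ _ _]; exact: cut_fun_continuous. Qed.

Lemma height_base g t : D g -> 0 <= t <= 1 -> height g (edge_pt e t) = t.
Proof.
move=> /edge_cutP[_ ns tt _] t01.
by rewrite /height cut_fun_edge // indic0 // indic1 //; ring.
Qed.

Lemma height_self g : D g ->
  (forall t, 0 <= t <= 1 -> height g (edge_pt g t) = t) \/
  (forall t, 0 <= t <= 1 -> height g (edge_pt g t) = 1 - t).
Proof.
move=> Dg; have : separates (edge_cut g) g by apply/edge_cut_separates.
rewrite /height /separates; have gE t := @cut_fun_edge R G Y (edge_cut g) g t.
have [As|nAs] := pselect (edge_cut g (src g)); have [At|nAt] := pselect (edge_cut g (tgt g)).
- by case.
- by move=> _; right=> t t01; rewrite gE // indic1 // indic0 //; ring.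
- by move=> _; left=> t t01; rewrite gE // indic0 // indic1 //; ring.
- by case.
Qed.

Lemma height_other g h t : D g -> D h -> h <> g -> 0 <= t <= 1 ->
  height g (edge_pt h t) = \1_(edge_cut g) (src h).
Proof. by move=> Dg Dh hg; apply: cut_fun_unseparated; rewrite edge_cut_separates. Qed.

Lemma height_range g x : 0 <= height g x <= 1. Proof. exact: cut_fun_range. Qed.

Lemma height_inside g x : vertex_or_end x -> height g x = \1_(inside (edge_cut g)) x.
Proof. exact: cut_fun_inside. Qed.

Definition off_edge : set (dtop R G) := X `\` inner_edge e.

Lemma off_edge_segment g t : D g -> 0 <= t <= 1 -> off_edge (edge_pt g t).
Proof.
move=> [Cg ge] t01; split; first exact: cycle_points_edge.
by move=> [s]; rewrite /= in_itv /= => s01 /esym/(edge_pt_inj s01)[].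
Qed.

Variant off_edge_spec x : Prop :=
  | OffVertexOrEnd of vertex_or_end x
  | OffEdge g t of D g & 0 < t < 1 & x = edge_pt g t.

Lemma off_edgeP x : off_edge x -> off_edge_spec x.
Proof.
move=> [Xx xe]; have [vx|] := pselect (vertex_or_end x); first by left.
move=> /existsNP[g /contrapT[t]]; rewrite /= in_itv /= => t01 tE.
right with g t => //; split; first by move: Xx; rewrite -tE => /cycle_points_inner_edge; exact.
by move=> ge; apply: xe; rewrite -tE -ge; exact: inner_edge_pt.
Qed.

Lemma off_edge_vertex_or_end x : X x -> vertex_or_end x -> off_edge x.
Proof. by move=> Xx vx; split=> //; exact: vx. Qed.

Lemma edge_cut_difference x y g h : X x -> X y -> vertex_or_end x -> vertex_or_end y ->
  D g -> D h -> inside (edge_cut g) x -> ~ inside (edge_cut h) x -> ~ inside (edge_cut g) y ->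
  separates (edge_cut g `\` edge_cut h) g /\ separates (edge_cut g `\` edge_cut h) h.
Proof.
move=> Xx Xy vx vy Dg Dh gx nhx ngy; rewrite setDE; set Z := _ `&` _.
have [dg gs gt sepg] := edge_cutP Dg; have [dh hs ht seph] := edge_cutP Dh.
have dZ : decided Z by apply: decidedI => //; exact: decidedC.
have only k : C k -> separates Z k -> k = g \/ k = h.
  move=> Ck sk; have ke : k <> e by move=> ke; apply: sk; rewrite /Z ke; split=> -[].
  have Dk : D k by [].
  by case: (separatesI sk) => [|/separatesC] /edge_cut_separates-/(_ _ Dk); [left|right]; auto.
have [f Cf sf] : exists2 f, C f & separates Z f.
  apply: (cycle_points_separation layY cutC dZ Xx Xy vy).
    by apply/(insideI layY); split=> //; apply/insideC.
  by move=> /(insideI layY)[].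
have [k [Ck kf sk]] := cut_cyclic_other cutC dZ Cf sf.
by case: (only f Cf sf) (only k Ck sk) => fE [] kE; subst.
Qed.

(** Both differences of the two cuts would separate [g], although only one of the
    cuts does. *)
Lemma edge_cut_crossing x y g h : X x -> X y -> vertex_or_end x -> vertex_or_end y ->
  D g -> D h -> inside (edge_cut g) x -> ~ inside (edge_cut g) y ->
  inside (edge_cut h) y -> ~ inside (edge_cut h) x -> False.
Proof.
move=> Xx Xy vx vy Dg Dh gx ngy hy nhx.
have gh : h <> g by move=> gh; apply: nhx; rewrite gh.
have [sg _] := edge_cut_difference Xx Xy vx vy Dg Dh gx nhx ngy.
have [_ tg] := edge_cut_difference Xy Xx vy vx Dh Dg hy ngy nhx.
have nsg : ~ separates (edge_cut h) g by move=> /(edge_cut_separates Dh Dg)/esym.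
move: sg tg nsg; rewrite /separates /setD /=.
by have [] := pselect (edge_cut h (src g)); have [] := pselect (edge_cut h (tgt g)); tauto.
Qed.

Definition below x y := forall g, D g -> height g x <= height g y.

Lemma height_endpoints g : D g -> exists lo hi : R,
  [/\ 0 <= lo <= 1, vertex_or_end (edge_pt g lo) & height g (edge_pt g lo) = 0] /\
  [/\ 0 <= hi <= 1, vertex_or_end (edge_pt g hi) & height g (edge_pt g hi) = 1].
Proof.
move=> Dg; have vv v := @vertex_pt_vertex_or_end R G v.
have v0 : vertex_or_end (edge_pt g (0 : R)) by rewrite edge_pt0.
have v1 : vertex_or_end (edge_pt g (1 : R)) by rewrite edge_pt1.
by case: (height_self Dg) => gE; [exists 0, 1|exists 1, 0]; split; split;
  rewrite ?gE ?lexx ?ler01 ?subrr ?subr0.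
Qed.

Lemma off_edge_rounding x g h : off_edge x -> D g -> D h -> g <> h -> exists x',
  [/\ X x', vertex_or_end x', height g x <= height g x' & height h x' <= height h x].
Proof.
move=> offx Dg Dh gh; have [Xx _] := offx.
case/off_edgeP: offx Xx => [vx|k t Dk t01 -> _]; first by exists x.
have t01' : 0 <= t <= 1 by have /andP[? ?] := t01; rewrite !ltW.
have k01 := height_range k (edge_pt k t).
have [lo [hi [[lo01 vlo klo] [hi01 vhi khi]]]] := height_endpoints Dk.
have other j s : D j -> j <> k -> 0 <= s <= 1 -> height j (edge_pt k s) = height j (edge_pt k t).
  by move=> Dj /nesym kj s01; rewrite !height_other.
have [gk|gk] := pselect (g = k).
  exists (edge_pt k hi); split=> //; first by apply: cycle_points_edge; [case: Dk|].
    by rewrite gk khi; have /andP[] := k01.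
  by rewrite (other h) // => hk; apply: gh; rewrite gk.
exists (edge_pt k lo); split=> //; first by apply: cycle_points_edge; [case: Dk|].
  by rewrite (other g).
have [hk|hk] := pselect (h = k); last by rewrite (other h).
by rewrite hk klo; have /andP[] := k01.
Qed.

Lemma below_total x y : off_edge x -> off_edge y -> below x y \/ below y x.
Proof.
move=> offx offy; apply: contrapT => /not_orP[].
move=> /existsNP[g /not_implyP[Dg /negP]]; rewrite -ltNge => yx_g.
move=> /existsNP[h /not_implyP[Dh /negP]]; rewrite -ltNge => xy_h.
have gh : g <> h by move=> gh; move: yx_g; rewrite gh ltNge ltW.
have [x' [Xx' vx' gx hx]] := off_edge_rounding offx Dg Dh gh.
have [y' [Xy' vy' hy gy]] := off_edge_rounding offy Dh Dg (nesym gh).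
have {yx_g gx gy} : height g y' < height g x'.
  exact: le_lt_trans gy (lt_le_trans yx_g gx).
have {xy_h hx hy} : height h x' < height h y'.
  exact: le_lt_trans hx (lt_le_trans xy_h hy).
rewrite !height_inside //; case: indicP => hx'; case: indicP => hy'; rewrite ?ltxx ?ltr10 // => _.
case: indicP => gy'; case: indicP => gx'; rewrite ?ltxx ?ltr10 // => _.
exact: edge_cut_crossing Xx' Xy' vx' vy' Dg Dh gx' gy' hy' hx'.
Qed.

Lemma height_fractional g y : D g -> off_edge y -> 0 < height g y < 1 ->
  exists2 s, 0 < s < 1 & y = edge_pt g s.
Proof.
move=> Dg offy; have integral T (A : set T) z : ~ (0 < (\1_A z : R) < 1).
  by case: indicP => _; rewrite ltxx ?andbF.
case/off_edgeP: offy => [vy|h s Dh s01 ->].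
  by rewrite height_inside // => frac; case: (integral _ _ _ frac).
have [->|hg] := pselect (h = g); first by exists s.
have s01' : 0 <= s <= 1 by have /andP[? ?] := s01; rewrite !ltW.
by rewrite (height_other Dg Dh hg s01') => frac; case: (integral _ _ _ frac).
Qed.

(** A decided set that separates [x] from [y] can be cleared, by adding edge cuts,
    of all edges of [C] other than [e]. *)
Lemma heights_inj_vertex_or_end x y : X x -> X y -> vertex_or_end x -> vertex_or_end y ->
  (forall g, D g -> height g x = height g y) -> x = y.
Proof.
move=> Xx Xy vx vy same; apply: contrapT => /(vertex_or_end_separation layY vx vy)[A [dA Ax nAy]].
pose splits B := decided B /\ ~ (inside B x <-> inside B y).
pose agrees B := decided B /\ (inside B x <-> inside B y).
have finC : finite_set (C `&` separates A).
  exact: (thin_all_finite_separated layY (fun n => cut_cyclic_thin layY n cutC) dA).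
have /finite_seqP[s sE] := finC.
have [||t ts Dt|B [dB splitB] sepB] := @clear_separated G splits agrees D s A.
- move=> B B' [dB splitB] [dB' agreeB']; have dY := decidedY layY dB dB'; split=> //.
  by rewrite !(insideY layY) //; tauto.
- by split=> //; tauto.
- exists (edge_cut t); last by move=> f Df; exact: edge_cut_separates.
  have [dt _ _ _] := edge_cutP Dt; split=> //; have := same t Dt; rewrite !height_inside //.
  by case: indicP => h1; case: indicP => h2 // /eqP; rewrite ?oner_eq0 // eq_sym oner_eq0.
have unsep g : C g -> ~ separates B g.
  have clear g' : D g' -> ~ separates B g'.
    move=> Dg' /(sepB _ Dg')[sA /negP]; apply.
    by have : (C `&` separates A) g' by [split=> //; case: Dg']; rewrite sE.
  move=> Cg sg; have [ge|ge] := pselect (g = e); last exact: (clear g).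
  have [f [Cf fg sf]] := cut_cyclic_other cutC dB Cg sg.
  by apply: (clear f) sf; split=> //; rewrite -ge.
have nosplit u u' : X u -> X u' -> vertex_or_end u' -> inside B u -> inside B u'.
  move=> Xu Xu' vu' Bu; apply: contrapT => nBu'.
  by have [g Cg] := cycle_points_separation layY cutC dB Xu Xu' vu' Bu nBu'; exact: unsep.
by apply: splitB; split; exact: nosplit.
Qed.

Lemma heights_inj x y : off_edge x -> off_edge y -> (forall g, D g -> height g x = height g y) ->
  x = y.
Proof.
have on_edge u u' g t : D g -> 0 < t < 1 -> u = edge_pt g t -> off_edge u' ->
    height g u = height g u' -> u = u'.
  move=> Dg t01 -> offu' same; have t01' : 0 <= t <= 1 by have /andP[? ?] := t01; rewrite !ltW.
  have frac : 0 < height g u' < 1.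
    by rewrite -same; case: (height_self Dg) => -> //; lra.
  have [s s01 u'E] := height_fractional Dg offu' frac.
  have s01' : 0 <= s <= 1 by have /andP[? ?] := s01; rewrite !ltW.
  rewrite u'E; congr edge_pt; move: same; rewrite u'E.
  by case: (height_self Dg) => gE; rewrite !gE //; lra.
move=> offx offy same; case/off_edgeP: (offx) => [vx|g t Dg t01 xE].
  case/off_edgeP: (offy) => [vy|g t Dg t01 yE].
    by apply: heights_inj_vertex_or_end => //; [case: offx|case: offy].
  by apply/esym; apply: (on_edge _ _ g t) => //; rewrite same.
by apply: (on_edge _ _ g t) => //; exact: same.
Qed.

Section Arc.
Variable nth_edge : nat -> edge G.
Hypothesis nth_edgeP : range nth_edge = D.

Let nth_edge_in n : D (nth_edge n). Proof. by rewrite -nth_edgeP; exists n. Qed.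

Let nth_edge_surj g : D g -> exists n, nth_edge n = g.
Proof. by rewrite -nth_edgeP => -[n _ <-]; exists n. Qed.

Definition total_height : dtop R G -> R := weighted_sum (fun n => height (nth_edge n)).

Let nth_height_range n x : 0 <= height (nth_edge n) x <= 1. Proof. exact: height_range. Qed.

Lemma total_height_continuous : continuous total_height.
Proof.
apply: weighted_sum_continuous => [n|]; last exact: nth_height_range.
exact: height_continuous (nth_edge_in n).
Qed.

Lemma total_height_tgt : total_height (vertex_pt (tgt e)) = 1.
Proof.
apply: weighted_sum1 => n.
by rewrite -edge_pt1 (height_base (nth_edge_in n)) // ler01 lexx.
Qed.

Lemma total_height_base t : 0 <= t <= 1 -> total_height (edge_pt e t) = t.
Proof.
move=> t01; rewrite -[RHS]mulr1 -total_height_tgt.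
apply: (weighted_sum_scale nth_height_range) => n.
by rewrite -edge_pt1 !(height_base (nth_edge_in n)) ?mulr1 // ler01 lexx.
Qed.

Lemma total_height_range x : 0 <= total_height x <= 1.
Proof.
rewrite (weighted_sum_ge0 nth_height_range) /= -total_height_tgt.
apply: (weighted_sum_le nth_height_range) => n.
rewrite -edge_pt1 (height_base (nth_edge_in n)) ?ler01 ?lexx //.
by have /andP[] := nth_height_range n x.
Qed.

Lemma total_height_inj x y : off_edge x -> off_edge y -> total_height x = total_height y -> x = y.
Proof.
have strict u u' : below u u' -> total_height u = total_height u' ->
    forall g, D g -> height g u = height g u'.
  move=> uu' E g Dg; apply: contrapT => /eqP neq; have [n nE] := nth_edge_surj Dg.
  suff : total_height u < total_height u' by rewrite E ltxx.
  apply: (weighted_sum_lt nth_height_range (k := n)) => [k|]; first exact: uu'.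
  by rewrite nE lt_neqAle neq uu'.
move=> offx offy E; apply: heights_inj => // g Dg.
by case: (below_total offx offy) => [/strict-> //|/strict <-].
Qed.

Lemma total_height_surj s : 0 <= s <= 1 -> exists2 x, off_edge x & total_height x = s.
Proof.
move=> /andP[s0 s1]; apply: contrapT => missed.
have neq x : off_edge x -> total_height x <> s by move=> offx xs; apply: missed; exists x.
have cptXV := compact_closedI (cycle_points_compact layY cutC) (@closed_vertex_or_end R G).
pose low := (X `&` vertex_or_end) `&` (total_height @^-1` [set r | r <= s]).
pose high := (X `&` vertex_or_end) `&` (total_height @^-1` [set r | s <= r]).
have ch := total_height_continuous; have /continuous_closedP clh := ch.
have [|||||A [dA lowA highA]] := @compact_separation R G Y layY low high.
- by apply: compact_closedI => //; apply: clh; exact: closed_le.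
- by apply: compact_closedI => //; apply: clh; exact: closed_ge.
- by move=> x [[]].
- by move=> x [[]].
- rewrite -subset0 => x [[[Xx vx] xs] [_ sx]].
  by apply: (neq x); [exact: off_edge_vertex_or_end|apply/le_anti/andP].
have Av v : X (vertex_pt v) -> (A v <-> total_height (vertex_pt v) < s).
  move=> Xv; have vv := @vertex_pt_vertex_or_end R G v.
  have /eqP := neq _ (off_edge_vertex_or_end Xv vv); rewrite neq_lt => /orP[lt_s|gt_s].
    by split=> // _; apply: (lowA (vertex_pt v)); split; [|exact: ltW].
  split=> [|/(lt_trans gt_s)]; last by rewrite ltxx.
  by move: (highA (vertex_pt v)) => /[apply]; case; split; [|exact: ltW].
have Xs g : C g -> X (vertex_pt (src g)) by move=> Cg; exists g => //; left.
have Xt g : C g -> X (vertex_pt (tgt g)) by move=> Cg; exists g => //; right.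
have sep_e : separates A e.
  have As : A (src e).
    apply/(Av _ (Xs e Ce)); rewrite -edge_pt0 total_height_base ?lexx ?ler01 // lt_def s0 andbT.
    have := neq _ (off_edge_vertex_or_end (Xs e Ce) (@vertex_pt_vertex_or_end R G _)).
    by rewrite -edge_pt0 total_height_base ?lexx ?ler01 // => /nesym/eqP.
  have nAt : ~ A (tgt e) by move=> /(Av _ (Xt e Ce)); rewrite total_height_tgt ltNge s1.
  by move=> [/(_ As)].
have [f [Cf fe sep_f]] := cut_cyclic_other cutC dA Ce sep_e.
have [|||t t01 ft] := @IVT R (total_height \o edge_pt f) 0 1 s.
- exact: ler01.
- by apply: within_continuous_comp; [move=> x _; exact: ch|exact: edge_pt_continuous].
- rewrite /= edge_pt0 edge_pt1; move: sep_f (Av _ (Xs f Cf)) (Av _ (Xt f Cf)).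
  rewrite /separates ge_min le_max; case: ltP => hs; case: ltP => ht;
    rewrite ?(ltW hs) ?(ltW ht) ?hs ?ht ?orbT //; tauto.
by apply: (neq (edge_pt f t)) => //; apply: off_edge_segment; rewrite // in_itv in t01.
Qed.

Definition arc_angle x : R :=
  if `[< inner_edge e x >] then 1 - total_height x / 2 else total_height x / 2.

Lemma arc_angle_inner t : 0 < t < 1 -> arc_angle (edge_pt e t) = 1 - t / 2.
Proof.
move=> t01; rewrite /arc_angle asboolT; last exact: inner_edge_pt.
by have /andP[t0 t1] := t01; rewrite total_height_base ?(ltW t0) ?(ltW t1).
Qed.

Lemma arc_angle_off x : off_edge x -> arc_angle x = total_height x / 2.
Proof. by move=> [_ xe]; rewrite /arc_angle asboolF. Qed.

Lemma off_edge_or_inner x : X x -> off_edge x \/ exists2 t, 0 < t < 1 & x = edge_pt e t.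
Proof.
move=> Xx; have [[t]|xe] := pselect (inner_edge e x); last by left.
by rewrite /= in_itv /= => t01 <-; right; exists t.
Qed.

(** On [e], where [total_height] is the coordinate [t], subtracting [2 sin (pi t)]
    reflects the upper half circle to the lower one. *)
Definition arc_pt x : R * R :=
  (cos (pi * total_height x), sin (pi * total_height x) - edge_fun e (fun t => 2 * sin (pi * t)) x).

Lemma arc_pt_continuous : continuous arc_pt.
Proof.
have ch := total_height_continuous; have c_pi : continuous (fun t : R => pi * t).
  by move=> t; apply: cvgM; [exact: cvg_cst|exact: cvg_id].
have c_sin : continuous (fun t : R => sin (pi * t)).
  by move=> t; exact: (continuous_comp (c_pi t) (@continuous_sin R _)).
have c_cos : continuous (fun t : R => cos (pi * t)).
  by move=> t; exact: (continuous_comp (c_pi t) (@continuous_cos R _)).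
have c_height : continuous (fun x => sin (pi * total_height x)).
  by move=> x; exact: (continuous_comp (ch x) (c_sin _)).
have c_refl : continuous (edge_fun e (fun t : R => 2 * sin (pi * t))).
  apply: edge_fun_continuous; first by rewrite mulr0 mulr1 sin0 sinpi.
  by move=> t; apply: cvgM; [exact: cvg_cst|exact: c_sin].
apply: continuous_pair => x; first exact: (continuous_comp (ch x) (c_cos _)).
exact: (cvgB (c_height x) (c_refl x)).
Qed.

Lemma arc_pt_angle x : X x -> 0 <= arc_angle x < 1 /\ arc_pt x = circle_pt (arc_angle x).
Proof.
rewrite /arc_pt => /off_edge_or_inner[offx|[t t01 ->]].
  rewrite arc_angle_off // edge_fun_off; last by case: offx.
  rewrite mulr0 sin0 mulr0 subr0 /circle_pt.
  rewrite (_ : 2 * pi * (total_height x / 2) = pi * total_height x); last by field.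
  by have /andP[h0 h1] := total_height_range x; split=> //; apply/andP; split; lra.
have /andP[t0 t1] := t01; have t01' : 0 <= t <= 1 by rewrite !ltW.
rewrite arc_angle_inner // total_height_base // edge_fun_edge ?mulr0 ?mulr1 ?sin0 ?sinpi //.
rewrite circle_pt_opp /circle_pt /= (_ : 2 * pi * (t / 2) = pi * t); last by field.
split; first by apply/andP; split; lra.
by congr pair; ring.
Qed.

Lemma topological_cycle_arc : topological_cycle R X.
Proof.
apply: (@topological_cycle_angle _ _ _ arc_pt arc_angle).
- exact: (cycle_points_compact layY cutC).
- exact: arc_pt_continuous.
- exact: arc_pt_angle.
- have neq x t : off_edge x -> 0 < t < 1 -> arc_angle x <> arc_angle (edge_pt e t).
    move=> offx t01; rewrite arc_angle_off // arc_angle_inner //.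
    by have /andP[_ h1] := total_height_range x; have /andP[_ t1] := t01; lra.
  move=> x y /off_edge_or_inner[offx|[t t01 ->]] /off_edge_or_inner[offy|[s s01 ->]].
  + by rewrite !arc_angle_off // => E; apply: total_height_inj => //; lra.
  + by move=> /neq; case.
  + by move=> /esym/neq; case.
  + by rewrite !arc_angle_inner // => E; congr edge_pt; lra.
- move=> t /andP[t0 t1]; have [t_le|t_gt] := leP t 2^-1.
    have [|x offx xE] := @total_height_surj (2 * t); first by apply/andP; split; lra.
    by exists x; [case: offx|rewrite arc_angle_off // xE; field].
  have u01 : 0 < 2 * (1 - t) < 1 by apply/andP; split; lra.
  exists (edge_pt e (2 * (1 - t))); first exact/cycle_points_inner_edge.
  by rewrite arc_angle_inner //; field.
Qed.

End Arc.

Lemma topological_cycle_loop : D = set0 -> topological_cycle R X.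
Proof.
move=> D0; have Ce_only g : C g -> g = e.
  by move=> Cg; apply: contrapT => ge; have : D g by []; rewrite D0.
have loop : src e = tgt e.
  apply: contrapT => st; have sep_e : separates [set src e] e by move=> [/(_ erefl)/esym].
  by have [f [/Ce_only]] := cut_cyclic_other cutC (decided1 layY (src e)) Ce sep_e.
have XP x : X x -> exists2 t, 0 <= t < 1 & x = edge_pt e t.
  case/cycle_pointsP=> [g t /Ce_only -> /andP[t0 t1] ->|w nd touch_w ->].
    have [t_lt1|t_ge1] := ltP t 1; first by exists t; rewrite ?t0.
    exists 0; first by rewrite lexx ltr01.
    by rewrite (_ : t = 1) ?edge_pt1 ?edge_pt0 ?loop //; apply/le_anti/andP.
  have [n avoid] := end_node_touching_avoid layY nd (finite_set1 e).
  by have [g /Ce_only -> /avoid] := touch_w n; case.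
pose cos2 (t : R) := cos (2 * pi * t); pose sin2 (t : R) := sin (2 * pi * t).
have [cos01 sin01] : cos2 1 = cos2 0 /\ sin2 1 = sin2 0.
  by have := @circleD1 R 0; rewrite add0r => /(congr1 val)[].
have c_mul : continuous (fun t : R => 2 * pi * t).
  by move=> t; apply: cvgM; [exact: cvg_cst|exact: cvg_id].
apply: (@topological_cycle_angle _ _ _ (fun x => (edge_fun e cos2 x, edge_fun e sin2 x))
  (edge_coord e)).
- exact: (cycle_points_compact layY cutC).
- apply: continuous_pair; apply: edge_fun_continuous => // t.
    exact: continuous_comp (c_mul t) (@continuous_cos R _).
  exact: continuous_comp (c_mul t) (@continuous_sin R _).
- move=> x /XP[t t01 ->]; rewrite edge_coord_edge // !edge_fun_edge //.
    by have /andP[t0 t1] := t01; rewrite t0 ltW.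
  by have /andP[t0 t1] := t01; rewrite t0 ltW.
- by move=> x y /XP[t t01 ->] /XP[s s01 ->]; rewrite !edge_coord_edge // => ->.
- move=> t t01; exists (edge_pt e t); last exact: edge_coord_edge.
  by apply: cycle_points_edge => //; have /andP[t0 t1] := t01; rewrite t0 ltW.
Qed.

Lemma cycle_points_cycle : topological_cycle R X.
Proof.
have /pfcard_geP[D0|[nth_edge]] : countable D.
  by apply: sub_countable (cut_cyclic_countable layY cutC); apply: subset_card_le => g [].
- exact: topological_cycle_loop.
- by apply: (@topological_cycle_arc nth_edge); exact: image_eq.
Qed.

End CutOrder.

Lemma cut_cyclic_topological_cycle (R : realType) (G : graph) (Y : nat -> set (vertex G))
    (C : set (edge G)) : layering Y -> cut_cyclic Y C ->
  exists2 X : set (dtop R G), topological_cycle R X & edges_of X = C.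
Proof.
move=> layY cutC; have [e Ce] := cut_cyclic_nonempty cutC; exists (cycle_points Y C).
  exact: (cycle_points_cycle layY cutC Ce).
exact: edges_of_cycle_points.
Qed.

Local Close Scope ring_scope.

Theorem theorem1p1 (R : realType) (G : graph) :
  exists M : matroid (edge G),
    circuits M =
      [set edges_of X | X in [set X : set (dtop R G) | topological_cycle R X]].
Proof.
have [Y layY] := @exists_layering G; exists (layer_matroid layY).
apply/seteqP; split=> [C /layer_circuitP cutC|_ [X cycX <-]].
  by have [X cycX <-] := cut_cyclic_topological_cycle R layY cutC; exists X.
by apply/layer_circuitP; exact: topological_cycle_cut_cyclic.
Qed.
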